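(* Let $K$ be an algebraically closed field of characteristic $0$ and let $\alpha:\mathbb{P}^{15}=\mathbb{P}\operatorname{End}(K^4)\dashrightarrow\mathbb{P}^9$ be the rational map associated with the smooth quadric $Q=V(x_0x_3-x_1x_2)\subset\mathbb{P}^3$. Let $V_3\xrightarrow{\pi_3}V_2\xrightarrow{\pi_2}V_1\xrightarrow{\pi_1}\mathbb{P}^{15}$ be the sequence of blow-ups with centers, respectively, $C_1=Z_1\cap Z_2\subset\mathbb{P}^{15}$ for $\pi_1$, $C_2\subset V_1$ for $\pi_2$, and $\widehat{Z_1}\cup\widehat{Z_2}\subset V_2$ for $\pi_3$, as defined in the context, and let $\alpha_3:V_3\dashrightarrow\mathbb{P}^9$ be the rational map induced by $\alpha$. Then $\alpha_3$ is regular (a morphism) and $V_3$ is smooth.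
   Context: $\mathbb{P}^{15}=\mathbb{P}\operatorname{End}(K^4)$ is the space of nonzero $4\times4$ matrices up to scalar and $\mathbb{P}^9=\mathbb{P}\operatorname{Sym}^2((K^4)^\vee)$ the space of quadrics in $\mathbb{P}^3$ (projective spaces of lines). With $f=x_0x_3-x_1x_2$, $\alpha$ is the rational map $\varphi\mapsto[f(\varphi(\cdot))]$. For $q\in\mathbb{P}^3$ represented by $v$, the point condition $P_q\subset\mathbb{P}^{15}$ is the hypersurface $f(\varphi(v))=0$. For $\varphi\in\mathbb{P}^{15}$, $\operatorname{im}\varphi\subset\mathbb{P}^3$ is the projectivization of the image of a representative matrix. Let $\sigma:\mathbb{P}^1\times\mathbb{P}^1\to\mathbb{P}^3$, $((s_0:s_1),(t_0:t_1))\mapsto(s_0t_0:s_0t_1:s_1t_0:s_1t_1)$, whose image is $Q$. The $a$-line determined by $p\in\mathbb{P}^1$ is $\sigma(\{p\}\times\mathbb{P}^1)$; the $b$-line determined by $p$ is $\sigma(\mathbb{P}^1\times\{p\})$. $Z_1$ (resp. $Z_2$) is the locus of $\varphi\in\mathbb{P}^{15}$ with $\operatorname{im}\varphi$ contained in some $a$-line (resp. $b$-line); $Z_1,Z_2$ are smooth subvarieties isomorphic to $\mathbb{P}^1\times\mathbb{P}^7$. $C_1:=Z_1\cap Z_2\cong Q\times\mathbb{P}^3$, a smooth subvariety. $\pi_1:V_1\to\mathbb{P}^{15}$ is the blow-up along $C_1$, with exceptional divisor $E_1=\mathbb{P}(N_{C_1}\mathbb{P}^{15})$, and $\widetilde{Z_1},\widetilde{Z_2}$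 are the proper transforms of $Z_1,Z_2$ in $V_1$. $\mathcal{G}\subset T\mathbb{P}^{15}|_{C_1}$ is the vector bundle over $C_1$ whose fiber at $\varphi$ is $\bigcap_{q\in\mathbb{P}^3}T_\varphi P_q$ (with $T_\varphi P_q=T_\varphi\mathbb{P}^{15}$ when $P_q$ is singular at $\varphi$); it contains $TC_1$. $\mathcal{F}:=\mathcal{G}/TC_1\subset N_{C_1}\mathbb{P}^{15}$, and $C_2:=\mathbb{P}(\mathcal{F})\subset E_1$ (projectivization by lines). $\pi_2:V_2\to V_1$ is the blow-up along $C_2$, and $\widehat{Z_1},\widehat{Z_2}$ are the proper transforms of $\widetilde{Z_1},\widetilde{Z_2}$ in $V_2$. $\pi_3:V_3\to V_2$ is the blow-up along $\widehat{Z_1}\cup\widehat{Z_2}$, and $\alpha_3=\alpha\circ\pi_1\circ\pi_2\circ\pi_3$ as a rational map. *)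

(* Defs.v *)
From HB Require Import structures.
From mathcomp Require Import all_boot all_order all_algebra.
From mathcomp Require Export mpoly.

Set Implicit Arguments.
Unset Strict Implicit.
Unset Printing Implicit Defensive.

Import GRing.Theory.
Local Open Scope ring_scope.

(* Classical algebraic geometry in a product of projective spaces over K.
   A product of projective spaces with n homogeneous coordinates altogether is
   given by a map [b : 'I_n -> nat]; two coordinates belong to the same factor
   iff they have the same label.  A point is given by its homogeneous
   coordinates, and a subset of the product by the predicate on coordinate
   vectors that it induces. *)

Definition is_point (K : closedFieldType) n (b : 'I_n -> nat) (x : 'rV[K]_n) :
    Prop :=
  forall i, exists2 j, b j = b i & x 0 j != 0.

Definition is_multihomog (K : closedFieldType) n (b : 'I_n -> nat)
    (d : nat -> nat) (p : {mpoly K[n]}) : Prop :=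
  forall m, m \in msupp p -> forall l, (\sum_(i < n | b i == l) m i)%N = d l.

Definition vanishes_on (K : closedFieldType) n (X : 'rV[K]_n -> Prop)
    (p : {mpoly K[n]}) : Prop :=
  forall x, X x -> p.@[x 0] = 0.

Definition zclosure (K : closedFieldType) n (b : 'I_n -> nat)
    (X : 'rV[K]_n -> Prop) (x : 'rV[K]_n) : Prop :=
  is_point b x /\
  forall d p, is_multihomog b d p -> vanishes_on X p -> p.@[x 0] = 0.

Definition differential (K : closedFieldType) n (p : {mpoly K[n]})
    (x w : 'rV[K]_n) : K :=
  \sum_(i < n) p^`M(i).@[x 0] * w 0 i.

(* The preimage of the Zariski tangent space of X at x in the space of
   coordinate vectors: it contains the lines spanned by the components of x in
   the factors, and the tangent space is the quotient by their sum. *)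
Definition tangent (K : closedFieldType) n (b : 'I_n -> nat)
    (X : 'rV[K]_n -> Prop) (x w : 'rV[K]_n) : Prop :=
  forall d p, is_multihomog b d p -> vanishes_on X p -> differential p x w = 0.

(* The stalk at x of the ideal sheaf of C in the structure sheaf of X is
   generated by (the dehomogenizations of) g_0, ..., g_(r-1): localizing at x
   inverts the polynomials s with s(x) != 0, and an identity between functions
   on X is one modulo the ideal of X. *)
Definition generates_at (K : closedFieldType) n (b : 'I_n -> nat)
    (X C : 'rV[K]_n -> Prop) r (g : 'I_r -> {mpoly K[n]}) (x : 'rV[K]_n) :
    Prop :=
  (forall k, vanishes_on C (g k)) /\
  forall d p, is_multihomog b d p -> vanishes_on C p ->
  exists s : {mpoly K[n]}, s.@[x 0] != 0 /\
  exists a : 'I_r -> {mpoly K[n]},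
    vanishes_on X (s * p - \sum_(k < r) a k * g k).

(* X is smooth at x when, near x, its ideal in the ambient product of
   projective spaces is generated by functions whose differentials at x are
   linearly independent.  Since the g_k vanish at x, Euler's relations make the
   independence of the gradients in homogeneous coordinates equivalent to that
   of the differentials in an affine chart. *)
Definition smooth_at (K : closedFieldType) n (b : 'I_n -> nat)
    (X : 'rV[K]_n -> Prop) (x : 'rV[K]_n) : Prop :=
  exists (r : nat) (g : 'I_r -> {mpoly K[n]}),
    [/\ forall k, exists d, is_multihomog b d (g k),
        generates_at b (@is_point K n b) X g x
      & row_free (\matrix_(k < r, i < n) (g k)^`M(i).@[x 0])].

Definition smooth (K : closedFieldType) n (b : 'I_n -> nat)
    (X : 'rV[K]_n -> Prop) : Prop :=
  forall x, X x -> smooth_at b X x.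

(* For an irreducible closed X, and A giving homogeneous coordinates (indexed
   by T, all 0 where undefined) of a rational map from X to a projective space:
   the map is regular when near every point it is represented by forms of equal
   multidegree without a common zero at this point. *)
Definition is_regular (K : closedFieldType) n (b : 'I_n -> nat)
    (X : 'rV[K]_n -> Prop) (T : Type) (A : 'rV[K]_n -> T -> K) : Prop :=
  forall x, X x ->
  exists (d : nat -> nat) (h : T -> {mpoly K[n]}),
    [/\ forall t, is_multihomog b d (h t),
        exists t, (h t).@[x 0] != 0
      & forall y, X y -> forall t u,
          (h t).@[y 0] * A y u = (h u).@[y 0] * A y t].

(* g_0, ..., g_m have equal multidegree and generate the ideal sheaf of C in
   X.  For X irreducible and closed and C a proper closed subset, the blow-up
   of X along C is then the closure of the graph of (g_0 : ... : g_m) over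
   X \ C, inside the product of the ambient space of X with a further P^m. *)
Definition presents_center (K : closedFieldType) n (b : 'I_n -> nat)
    (X C : 'rV[K]_n -> Prop) m (g : 'I_m.+1 -> {mpoly K[n]}) : Prop :=
  (exists d, forall k, is_multihomog b d (g k)) /\
  forall x, X x -> generates_at b X C g x.

Definition blocks_ext n (b : 'I_n -> nat) m (i : 'I_(n + m.+1)) : nat :=
  match split i with inl j => (b j).+1 | inr _ => 0%N end.

(* As z is a point, the last component of z is nonzero; hence so is c, and
   lsubmx z is not a common zero of the g_k. *)
Definition graph (K : closedFieldType) n (b : 'I_n -> nat)
    (X : 'rV[K]_n -> Prop) m (g : 'I_m.+1 -> {mpoly K[n]})
    (z : 'rV[K]_(n + m.+1)) : Prop :=
  [/\ is_point (blocks_ext b (m := m)) z, X (lsubmx z)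
    & exists c : K, rsubmx z = c *: \row_k (g k).@[(lsubmx z) 0]].

Definition blowup (K : closedFieldType) n (b : 'I_n -> nat)
    (X : 'rV[K]_n -> Prop) m (g : 'I_m.+1 -> {mpoly K[n]}) :
    'rV[K]_(n + m.+1) -> Prop :=
  zclosure (blocks_ext b (m := m)) (graph b X g).

(* The projection from the blow-up is lsubmx. *)
Definition proper_transform (K : closedFieldType) n (b : 'I_n -> nat)
    (X C : 'rV[K]_n -> Prop) m (g : 'I_m.+1 -> {mpoly K[n]})
    (Z : 'rV[K]_n -> Prop) : 'rV[K]_(n + m.+1) -> Prop :=
  zclosure (blocks_ext b (m := m))
    (fun z => [/\ blowup b X g z, Z (lsubmx z) & ~ C (lsubmx z)]).

(* A matrix phi in P(End(K^4)) has coordinate vector mxvec phi; vectors of K^4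
   are columns. *)

Definition quadric (K : closedFieldType) : {mpoly K[4]} :=
  'X_0 * 'X_3 - 'X_1 * 'X_2.

Definition b15 (i : 'I_(4 * 4)) : nat := 0.

Definition P15 (K : closedFieldType) : 'rV[K]_(4 * 4) -> Prop := is_point b15.

Definition quadric_comp (K : closedFieldType) (phi : 'M[K]_4) : {mpoly K[4]} :=
  quadric K \mPo [tuple \sum_(j < 4) phi i j *: 'X_j | i < 4].

(* The ten monomials of degree 2, indexing the coordinates of the space of
   quadrics. *)
Definition monomial2 : Type := {m : 'X_{1..4} | mdeg m == 2%N}.

Definition alpha (K : closedFieldType) (x : 'rV[K]_(4 * 4)) (t : monomial2) :
    K :=
  (quadric_comp (vec_mx x))@_(val t).

Definition point_condition (K : closedFieldType) (v : 'cV[K]_4)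
    (x : 'rV[K]_(4 * 4)) : Prop :=
  P15 x /\ (quadric K).@[fun i => (vec_mx x *m v) i 0] = 0.

Definition segre (K : closedFieldType) (s t : 'cV[K]_2) : 'cV[K]_4 :=
  \col_(i < 4) [:: s 0 0 * t 0 0; s 0 0 * t 1 0; s 1 0 * t 0 0; s 1 0 * t 1 0]`_i.

Definition a_line (K : closedFieldType) (p : 'cV[K]_2) (u : 'cV[K]_4) : Prop :=
  exists t : 'cV[K]_2, t != 0 /\ exists2 c : K, c != 0 & u = c *: segre p t.

Definition b_line (K : closedFieldType) (p : 'cV[K]_2) (u : 'cV[K]_4) : Prop :=
  exists s : 'cV[K]_2, s != 0 /\ exists2 c : K, c != 0 & u = c *: segre s p.

(* u represents a point of im phi. *)
Definition im_pt (K : closedFieldType) (x : 'rV[K]_(4 * 4)) (u : 'cV[K]_4) :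
    Prop :=
  u != 0 /\ exists v : 'cV[K]_4, u = vec_mx x *m v.

Definition Z1 (K : closedFieldType) (x : 'rV[K]_(4 * 4)) : Prop :=
  P15 x /\ exists2 p : 'cV[K]_2, p != 0 & forall u, im_pt x u -> a_line p u.

Definition Z2 (K : closedFieldType) (x : 'rV[K]_(4 * 4)) : Prop :=
  P15 x /\ exists2 p : 'cV[K]_2, p != 0 & forall u, im_pt x u -> b_line p u.

Definition C1 (K : closedFieldType) (x : 'rV[K]_(4 * 4)) : Prop :=
  Z1 x /\ Z2 x.

(* The fiber at x of the bundle G, as a space of coordinate vectors. *)
Definition Gfiber (K : closedFieldType) (x w : 'rV[K]_(4 * 4)) : Prop :=
  forall v : 'cV[K]_4, v != 0 -> tangent b15 (point_condition v) x w.

Section Tower.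
Variables (K : closedFieldType).
Variables (m1 : nat) (g1 : 'I_m1.+1 -> {mpoly K[4 * 4]}).

Definition b1 := blocks_ext b15 (m := m1).
Definition V1 := blowup b15 (@P15 K) g1.
Definition Z1tilde := proper_transform b15 (@P15 K) (@C1 K) g1 (@Z1 K).
Definition Z2tilde := proper_transform b15 (@P15 K) (@C1 K) g1 (@Z2 K).

(* The exceptional divisor over x in C1 is identified with P(N_x) by sending
   the class of a normal vector w to (x, [dg1(w)]); the components of g1
   generate the ideal of C1 at x, so dg1(w) = 0 exactly for w tangent to C1. *)
Definition C2 (z : 'rV[K]_(4 * 4 + m1.+1)) : Prop :=
  [/\ is_point b1 z, C1 (lsubmx z)
    & exists w, [/\ Gfiber (lsubmx z) w, ~ tangent b15 (@C1 K) (lsubmx z) w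
        & exists c : K,
            rsubmx z = c *: \row_k differential (g1 k) (lsubmx z) w]].

Variables (m2 : nat) (g2 : 'I_m2.+1 -> {mpoly K[4 * 4 + m1.+1]}).

Definition b2 := blocks_ext b1 (m := m2).
Definition V2 := blowup b1 V1 g2.
Definition Z1hat := proper_transform b1 V1 C2 g2 Z1tilde.
Definition Z2hat := proper_transform b1 V1 C2 g2 Z2tilde.
Definition C3 (z : 'rV[K]_(4 * 4 + m1.+1 + m2.+1)) : Prop :=
  Z1hat z \/ Z2hat z.

Variables (m3 : nat) (g3 : 'I_m3.+1 -> {mpoly K[4 * 4 + m1.+1 + m2.+1]}).

Definition b3 := blocks_ext b2 (m := m3).
Definition V3 := blowup b2 V2 g3.

Definition alpha3 (z : 'rV[K]_(4 * 4 + m1.+1 + m2.+1 + m3.+1)) :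
    monomial2 -> K :=
  alpha (lsubmx (lsubmx (lsubmx z))).

End Tower.

(* Main.v *)
Require Import Defs.
From mathcomp Require Import all_boot all_order all_algebra.
From mathcomp Require Import ring.
Local Open Scope ring_scope.

Set Implicit Arguments.
Unset Strict Implicit.
Unset Printing Implicit Defensive.
Import GRing.Theory.

(* Every point of P^15, V_1, V_2, V_3 lies in the image of a polynomial map psi from A^15
   which near that point is an isomorphism onto an open subset, with inverse tau / sg for
   forms tau_k, sg of equal multidegree.  Write the columns of phi as 2 x 2 matrices M_j with
   f = det, normalize an entry of a column M_c to 1 and clear the rest of its row and column
   by unipotent row and column operations: in the resulting coordinates
   (delta, rho_j, p_j, q_j, a, b, m_j), up to sign,
     f(phi X) = Y (R - delta Y) - P Q,  Y, P, Q, R linear with coefficients m, p, q, rho,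
   and, with D = (delta, rho), Z_1 = {D = q = 0}, Z_2 = {D = p = 0} and C_1 = {D = p = q = 0}.

   Blowing up a coordinate subspace {t_k = 0, k in S} gives for each e in S the chart
   t_k = t'_k t'_e (k in S, k <> e), whatever generators g of the centre define the blow-up:
   if s tau_k = sum_i a_ki g_i then Q_k = sum_i a_ki w_i, with w the coordinates of the fibre,
   is the strict transform of tau_k, and t'_k = Q_k / Q_e.  On V_1, C_2 is empty in the charts
   with e in D, and is {D = t_e = 0} in those with e among the p (or the q), where the strict
   transform of Z_1 (resp. Z_2) is {D = q = 0} (resp. {D = p = 0}) and that of the other locus
   is empty; the same equations describe the centre of pi_3 in the only charts of V_2 that
   meet it.  In each chart of V_3 the coefficients of f(phi X) then have a common monomial
   factor whose cofactors do not vanish simultaneously.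

   A chart gives smoothness: the equations y = psi(tau(y) / sg(y)) generate the ideal, and the
   identities tau(psi(t)) = t sg(psi(t)) express 15 of them, up to a unit, through the others,
   whose differentials are independent. *)

(** * Polynomials over an infinite field *)

(** The coordinates delta and rho_j are the value of f on column c and its polarizations with the
    other columns, so their differentials vanish on the fibres of G and every centre becomes a
    coordinate subspace. After pi_1, in a chart with e among the p, the factor t_e splits off and Y
    (R - delta Y) - t_e P Q remains. Its coefficients vanish together only if D = 0 and t_e P Q = 0,
    where P is nonzero because p_e = 1. What is left of the base locus is therefore {D = t_e = 0}
    and {D = q = 0}, the centres still to be blown up. The obstacle is that the generators of the
    centres are arbitrary and comparable with the tau_k only up to local units, while a blow-up is
    only known as the closure of a graph. Equations are therefore proved on dense subsets, of A^15
    or of the graph, and extended as identities between polynomials or forms; charts carry a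
    denominator [sg], which can be enlarged to shrink them. *)

Lemma mpoly_ring_ind (R : comNzRingType) n (P : {mpoly R[n]} -> Prop) :
  (forall c, P c%:MP) -> (forall i, P 'X_i) ->
  (forall p q, P p -> P q -> P (p + q)) ->
  (forall p q, P p -> P q -> P (p * q)) -> forall p, P p.
Proof.
move=> PC PX PD PM p.
have P1 : P 1 by rewrite -mpolyC1.
have PE q k : P q -> P (q ^+ k).
  by move=> Pq; elim: k => [|k IHk]; rewrite ?expr0 // exprS; apply: PM.
elim/mpolyind: p => [|c m p _ _ Pp]; first by rewrite -mpolyC0.
apply: PD => //; rewrite -mul_mpolyC mpolyXE_id; apply: (PM _ _ (PC c)).
by elim/big_ind: _ => // i _; apply: PE.
Qed.

(** Uniqueness of digits in base [B]: it keeps distinct monomials distinct under the substitution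
    X_i -> x^(B^i) of [mpoly_fun0]. *)
Lemma base_expansion_inj B n (f g : 'I_n -> nat) :
  (forall i, (f i < B)%N) -> (forall i, (g i < B)%N) ->
  (\sum_(i < n) f i * B ^ i = \sum_(i < n) g i * B ^ i)%N -> f =1 g.
Proof.
elim: n f g => [|n IHn] f g ltf ltg; first by move=> _ [].
have B0 : (0 < B)%N by apply: leq_ltn_trans (ltf ord0).
rewrite !big_ord_recl /= expn0 !muln1.
have E (h : 'I_n.+1 -> nat) : (\sum_(i < n) h (lift ord0 i) * B ^ bump 0 i =
    (\sum_(i < n) h (lift ord0 i) * B ^ i) * B)%N.
  by rewrite big_distrl; apply: eq_bigr => i _; rewrite /bump add1n expnSr mulnA.
rewrite !E => eqS.
have e0 : f ord0 = g ord0.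
  have /(congr1 (modn^~ B)) := eqS.
  by rewrite /= ![(_ ord0 + _)%N]addnC !modnMDl !modn_small.
move: eqS; rewrite e0 => /addnI/eqP; rewrite eqn_pmul2r // => /eqP eqS i.
case: (unliftP ord0 i) => [j|] -> //.
by apply: (IHn (f \o lift ord0) (g \o lift ord0)) => // k; apply: ltf || apply: ltg.
Qed.

Section Density.
Variable K : closedFieldType.

Lemma poly_fun0 (p : {poly K}) : (forall x, p.[x] = 0) -> p = 0.
Proof.
move=> p0; apply/eqP; apply: contraT => /closed_nonrootP [x].
by rewrite /root p0 eqxx.
Qed.

(** Kronecker substitution X_i -> x^(B^i), with [B] above all exponents, turns [p] into a univariate
    polynomial with the same coefficients, which vanishes everywhere on an infinite field. *)
Lemma mpoly_fun0 n (p : {mpoly K[n]}) : (forall v, p.@[v] = 0) -> p = 0.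
Proof.
move=> p0; pose B := msize p.
pose e (m : 'X_{1..n}) := (\sum_(i < n) m i * B ^ i)%N.
pose u := \sum_(m <- msupp p) p@_m *: 'X^(e m) : {poly K}.
have u0 : u = 0.
  apply: poly_fun0 => x; rewrite -[RHS](p0 (fun i => x ^+ (B ^ i))) mevalE.
  rewrite horner_sum; apply: eq_bigr => m _; rewrite hornerZ hornerXn; congr (_ * _).
  rewrite /e; elim/big_rec2: _ => [|i y1 y2 _ <-]; first by rewrite expr0.
  by rewrite exprD -exprM mulnC.
apply/mpolyP => m; rewrite mcoeff0; apply/eqP; rewrite mcoeff_eq0.
apply/negP => mp; have /eqP := congr1 (fun q : {poly K} => q`_(e m)) u0.
rewrite coef0 coef_sum (bigD1_seq m) ?msupp_uniq //= coefZ coefXn eqxx mulr1.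
rewrite big1_seq ?addr0; first by rewrite (negbTE (_ : p@_m != 0)) // -mcoeff_msupp.
move=> m' /andP[nm m'p]; rewrite coefZ coefXn; case: eqP => [em|]; last by rewrite mulr0.
case/eqP: nm; apply/mnmP => i; apply/esym.
apply: (@base_expansion_inj B n (fun i => m i) (fun i => m' i)) => // {}i.
  apply: leq_ltn_trans (msize_mdeg_lt mp).
  by rewrite mdegE (bigD1 i) //= leq_addr.
apply: leq_ltn_trans (msize_mdeg_lt m'p).
by rewrite mdegE (bigD1 i) //= leq_addr.
Qed.

Lemma mpoly_fun_eq n (p q : {mpoly K[n]}) : (forall v, p.@[v] = q.@[v]) -> p = q.
Proof.
by move=> pq; apply/subr0_eq/mpoly_fun0 => v; rewrite mevalB pq subrr.
Qed.

(** The complement of a hypersurface is Zariski dense. Identities with denominators are checked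
    where these do not vanish and extended by this lemma. *)
Lemma meval_dense n (p q : {mpoly K[n]}) :
  q != 0 -> (forall v, q.@[v] != 0 -> p.@[v] = 0) -> p = 0.
Proof.
move=> q0 pq; have : q * p = 0.
  apply: mpoly_fun0 => v; rewrite mevalM.
  by have [->|/pq ->] := eqVneq q.@[v] 0; rewrite ?mul0r ?mulr0.
by move/eqP; rewrite mulf_eq0 (negbTE q0) => /eqP.
Qed.

Lemma meval_neq0 n (p : {mpoly K[n]}) v : p.@[v] != 0 -> p != 0.
Proof. by apply: contraNneq => ->; rewrite meval0. Qed.

Definition pullback n N (psi : 'I_N -> {mpoly K[n]}) (p : {mpoly K[N]}) :=
  p \mPo [tuple psi i | i < N].

Definition param n N (psi : 'I_N -> {mpoly K[n]}) (t : 'I_n -> K) : 'rV[K]_N :=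
  \row_i (psi i).@[t].

Lemma paramE n N (psi : 'I_N -> {mpoly K[n]}) t i : param psi t 0 i = (psi i).@[t].
Proof. by rewrite mxE. Qed.

Lemma meval_pullback n N (psi : 'I_N -> {mpoly K[n]}) p t :
  (pullback psi p).@[t] = p.@[param psi t 0].
Proof.
rewrite comp_mpoly_meval; apply: meval_eq => i.
by rewrite tnth_mktuple mxE.
Qed.

(** Hadamard's lemma: p(u) - p(v) lies in the ideal of the u_i - v_i, with cofactors that become the
    partial derivatives where u = v. The first clause yields ideal membership for the equations of a
    chart, the second the chain rule and the Jacobian of their relations. *)
Lemma mpoly_difference n N (p : {mpoly K[N]}) (u v : 'I_N -> {mpoly K[n]}) :
  exists q : 'I_N -> {mpoly K[n]},
    pullback u p - pullback v p = \sum_i (u i - v i) * q i /\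
    forall t, param u t = param v t ->
      forall i, (q i).@[t] = p^`M(i).@[param u t 0].
Proof.
have pbM w (a b : {mpoly K[N]}) :
    pullback w (a * b) = pullback w a * pullback w b by apply: rmorphM.
elim/mpoly_ring_ind: p => [c|i|p1 p2 [q1 [E1 D1]] [q2 [E2 D2]]|
    p1 p2 [q1 [E1 D1]] [q2 [E2 D2]]].
- exists (fun=> 0); rewrite /pullback !comp_mpolyC subrr big1.
    by split=> // t _ i; rewrite mderivC !meval0.
  by move=> i _; rewrite mulr0.
- exists (fun j => (j == i)%:R); split=> [|t _ j].
    rewrite (bigD1 i) //= eqxx mulr1 big1 ?addr0 => [|j /negbTE->]; last by rewrite mulr0.
    by rewrite /pullback !comp_mpolyXU -!tnth_nth !tnth_mktuple.
  rewrite mderivX !mnm1E eq_sym; case: eqP => [->|_].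
    have -> : (U_(j) - U_(j))%MM = 0%MM by apply/mnmP => k; rewrite mnmBE mnm0E subnn.
    by rewrite mpolyX0 scale1r !meval1.
  by rewrite scale0r !meval0.
- exists (fun i => q1 i + q2 i); split=> [|t uv i].
    rewrite /pullback !comp_mpolyD -!/(pullback _ _).
    have -> a b c d : a + b - (c + d) = a - c + (b - d) :> {mpoly K[n]} by ring.
    by rewrite E1 E2 -big_split; apply: eq_bigr => i _; rewrite mulrDr.
  by rewrite mderivD !mevalD D1 // D2.
exists (fun i => q1 i * pullback u p2 + pullback v p1 * q2 i); split=> [|t uv i].
  rewrite !pbM.
  have -> (a b c d : {mpoly K[n]}) : a * b - c * d = (a - c) * b + c * (b - d) by ring.
  rewrite E1 E2 mulr_suml mulr_sumr -big_split; apply: eq_bigr => i _ /=.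
  by ring.
by rewrite mderivM !mevalD !mevalM D1 // D2 // !meval_pullback uv.
Qed.

Lemma mderiv_pullback n N (psi : 'I_N -> {mpoly K[n]}) p j t :
  (pullback psi p)^`M(j).@[t] =
  \sum_i p^`M(i).@[param psi t 0] * (psi i)^`M(j).@[t].
Proof.
(* Comparison with the constant point psi(t): at [t] only the terms in which a difference psi_i -
   psi_i(t) is differentiated survive. *)
pose v i : {mpoly K[n]} := ((psi i).@[t])%:MP.
have [q [E D]] := mpoly_difference p psi v.
have uv : param psi t = param v t by apply/rowP => i; rewrite !mxE mevalC.
have vC : (pullback v p)^`M(j) = 0.
  suff -> : pullback v p = (p.@[param v t 0])%:MP by rewrite mderivC.
  apply: mpoly_fun_eq => s; rewrite meval_pullback mevalC; apply: meval_eq => i.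
  by rewrite !mxE !mevalC.
have /(congr1 (fun q => q^`M(j).@[t])) := E.
rewrite mderivB vC subr0 => ->.
rewrite (linear_sum (mderiv j)) (raddf_sum (meval t)); apply: eq_bigr => i _ /=.
by rewrite mderivM mevalD !mevalM mderivB mderivC subr0 mevalB mevalC subrr mul0r addr0
  D // mulrC.
Qed.

End Density.

(** * Multihomogeneous polynomials *)

Lemma map_mpolyX (R S : comNzRingType) (f : {rmorphism R -> S}) n (m : 'X_{1..n}) :
  map_mpoly f 'X_[m] = 'X_[m].
Proof. by apply/mpolyP => k; rewrite mcoeff_map_mpoly !mcoeffX /= rmorph_nat. Qed.

Section Multihomogeneous.
Variables (K : closedFieldType) (n : nat) (b : 'I_n -> nat).
Implicit Types (p q : {mpoly K[n]}) (d : nat -> nat) (y : 'rV[K]_n).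

Definition scale_block l (c : K) y : 'rV[K]_n :=
  \row_i (if b i == l then c * y 0 i else y 0 i).

Lemma meval_scale_block p l c y :
  p.@[scale_block l c y 0] = \sum_(m <- msupp p)
    p@_m * c ^+ (\sum_(i < n | b i == l) m i) * \prod_i y 0 i ^+ m i.
Proof.
rewrite mevalE; apply: eq_bigr => m _; rewrite -mulrA; congr (_ * _).
rewrite -prodrXr [X in X * _]big_mkcond -big_split; apply: eq_bigr => i _ /=.
by rewrite mxE; case: ifP; rewrite ?exprMn ?mul1r.
Qed.

(** Scaling one block reads off the degree, since over an infinite field the functions c ^ a and c ^
    d agree only for a = d. Degree computations thereby become evaluations. *)
Lemma multihomogP d p : is_multihomog b d p <->
  forall l c y, p.@[scale_block l c y 0] = c ^+ d l * p.@[y 0].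
Proof.
split=> [hp l c y|hp m mp l].
  rewrite meval_scale_block [in RHS]mevalE mulr_sumr !big_seq.
  by apply: eq_bigr => m /hp ->; rewrite mulrCA mulrA.
have E (c : K) : c ^+ (\sum_(i < n | b i == l) m i) = c ^+ d l.
  pose q := \sum_(m <- msupp p)
    (p@_m * c ^+ (\sum_(i < n | b i == l) m i)) *: 'X_[m] : {mpoly K[n]}.
  have : q = c ^+ d l *: p.
    apply: mpoly_fun_eq => v; rewrite mevalZ.
    have vE r : r.@[v] = r.@[(\row_i v i) 0] :> K by apply: meval_eq => i; rewrite mxE.
    rewrite (vE p) -hp meval_scale_block /q (raddf_sum (meval v)); apply: eq_bigr => m' _ /=.
    by rewrite mevalZ mevalX; congr (_ * _); apply: eq_bigr => i _; rewrite mxE.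
  move/(congr1 (mcoeff m)); rewrite mcoeffZ (raddf_sum (mcoeff m)) (bigD1_seq m) ?msupp_uniq //=.
  rewrite mcoeffZ mcoeffX eqxx mulr1 [X in _ + X]big1 ?addr0 => [|m' /negbTE nm]; last first.
    by rewrite mcoeffZ mcoeffX nm mulr0.
  by rewrite mulrC => /mulIf; apply; rewrite -mcoeff_msupp.
set a := (\sum_(i < n | b i == l) m i)%N in E *.
have : 'X^a - 'X^(d l) = 0 :> {poly K}.
  by apply: poly_fun0 => c; rewrite hornerD hornerN !hornerXn E subrr.
move/(congr1 (fun q : {poly K} => q`_a)); rewrite coefB !coefXn eqxx coef0.
by case: eqP => // _ /eqP; rewrite subr0 oner_eq0.
Qed.

Lemma eq_multihomog d d' p : d =1 d' -> is_multihomog b d p -> is_multihomog b d' p.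
Proof. by move=> dd hp m mp l; rewrite -dd hp. Qed.

Lemma multihomogD d p q :
  is_multihomog b d p -> is_multihomog b d q -> is_multihomog b d (p + q).
Proof. by move=> /multihomogP hp /multihomogP hq; apply/multihomogP => l c y;
  rewrite !mevalD hp hq mulrDr. Qed.

Lemma multihomogB d p q :
  is_multihomog b d p -> is_multihomog b d q -> is_multihomog b d (p - q).
Proof. by move=> /multihomogP hp /multihomogP hq; apply/multihomogP => l c y;
  rewrite !mevalB hp hq mulrBr. Qed.

Lemma multihomogM d d' p q : is_multihomog b d p -> is_multihomog b d' q ->
  is_multihomog b (fun l => d l + d' l)%N (p * q).
Proof. by move=> /multihomogP hp /multihomogP hq; apply/multihomogP => l c y;
  rewrite !mevalM hp hq exprD mulrACA. Qed.

Lemma multihomog0 d : is_multihomog b d (0 : {mpoly K[n]}).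
Proof. by apply/multihomogP => l c y; rewrite !meval0 mulr0. Qed.

Lemma multihomogC (c : K) : is_multihomog b (fun=> 0%N) c%:MP.
Proof. by apply/multihomogP => l a y; rewrite !mevalC mul1r. Qed.

Lemma multihomogZ d (c : K) p : is_multihomog b d p -> is_multihomog b d (c *: p).
Proof. by move/multihomogP=> hp; apply/multihomogP => l a y; rewrite !mevalZ hp mulrCA. Qed.

Lemma multihomog_sum d (I : Type) (r : seq I) (P : pred I) (F : I -> {mpoly K[n]}) :
  (forall i, P i -> is_multihomog b d (F i)) ->
  is_multihomog b d (\sum_(i <- r | P i) F i).
Proof.
move=> hF; elim/big_ind: _ => //; [exact: multihomog0 | exact: multihomogD].
Qed.

Lemma multihomog_prod (I : Type) (r : seq I) (P : pred I) (F : I -> {mpoly K[n]}) :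
  (forall i, P i -> exists d, is_multihomog b d (F i)) ->
  exists d, is_multihomog b d (\prod_(i <- r | P i) F i).
Proof.
move=> hF; elim/big_ind: _ => //; first by exists (fun=> 0%N); apply: multihomogC.
by move=> p q [d hp] [d' hq]; exists (fun l => d l + d' l)%N; apply: multihomogM.
Qed.

Lemma multihomogX i : is_multihomog b (fun l => (b i == l) : nat) ('X_i : {mpoly K[n]}).
Proof.
apply/multihomogP => l c y; rewrite !mevalXU mxE.
by case: eqP => _; rewrite ?expr1 ?expr0 ?mul1r.
Qed.

(* [L] bounds the labels, and [grading p] is p(X_i T_(b i)) in K[X][T]. *)
Let L := (\max_(i < n) b i).+1.
Let lab_lt i : (b i < L)%N. Proof. by rewrite ltnS (leq_bigmax i). Qed.
Let lab i : 'I_L := Ordinal (lab_lt i).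

Definition grading p : {mpoly {mpoly K[n]}[L]} :=
  mmap (@mpolyC L {mpoly K[n]} \o @mpolyC n K)
    (fun i => ('X_i)%:MP * 'X_(lab i)) p.

Definition homog_part (D : 'X_{1..L}) p := (grading p)@_D.

Definition scale_all (lam : 'I_L -> K) y : 'rV[K]_n := \row_i (lam (lab i) * y 0 i).

Definition degree_vector d : 'X_{1..L} := [multinom d l | l < L].

Let degf (D : 'X_{1..L}) l : nat := if insub l is Some l' then D l' else 0%N.

Let gradingM p q : grading (p * q) = grading p * grading q.
Proof. exact: rmorphM. Qed.

Let gradingD p q : grading (p + q) = grading p + grading q.
Proof. exact: rmorphD. Qed.

Let mdegs (m : 'X_{1..n}) : 'X_{1..L} := [multinom (\sum_(i < n | b i == l) m i)%N | l < L].

Let gradingX m : grading 'X_[m] = ('X_[m])%:MP * 'X_[mdegs m].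
Proof.
rewrite /grading mmapX /mmap1.
under eq_bigr do rewrite exprMn.
rewrite big_split; congr (_ * _).
  by rewrite [in RHS]mpolyXE_id rmorph_prod; apply: eq_bigr => i _; rewrite rmorphXn.
rewrite mprodXnE; congr 'X_[_]; apply/mnmP => l.
rewrite mnm_sumE mnmE [RHS]big_mkcond; apply: eq_bigr => i _.
by rewrite mulmnE mnm1E -val_eqE /=; case: eqP => _; rewrite ?mul1n.
Qed.

Let gradingE p : grading p = \sum_(m <- msupp p) (p@_m *: 'X_[m])%:MP * 'X_[mdegs m].
Proof.
rewrite {1}(mpolyE p) /grading (raddf_sum (mmap _ _)); apply: eq_bigr => m _ /=.
rewrite mmapZ /= -/(grading _) gradingX mulrA; congr (_ * _).
by rewrite -mul_mpolyC rmorphM.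
Qed.

Lemma grading_multihomog d p :
  is_multihomog b d p -> grading p = p%:MP * 'X_[degree_vector d].
Proof.
move=> hp; rewrite gradingE [in RHS](mpolyE p) (raddf_sum (@mpolyC _ _)) mulr_suml.
rewrite !big_seq; apply: eq_bigr => m /hp dm; congr (_ * 'X_[_]).
by apply/mnmP => l; rewrite !mnmE dm.
Qed.

Lemma homog_part_multihomog D p : exists d, [/\ is_multihomog b d (homog_part D p),
   forall l : 'I_L, d l = D l & forall l, (L <= l)%N -> d l = 0%N].
Proof.
exists (degf D); split; last 2 first.
- by move=> l; rewrite /degf valK.
- by move=> l Ll; rewrite /degf insubF // ltnNge Ll.
rewrite /homog_part gradingE (raddf_sum (mcoeff D)).
apply: multihomog_sum => m _ /=; rewrite mcoeffCM mcoeffX; case: eqP => [<-|_]; last first.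
  by rewrite mulr0; apply: multihomog0.
rewrite mulr1; apply: multihomogZ => m'; rewrite msuppX inE => /eqP -> l.
rewrite /degf; case: insubP => [l' _ <-|]; first by rewrite mnmE.
rewrite -leqNgt => Ll; rewrite big_pred0 // => i.
by apply: contraTF Ll => /eqP <-; rewrite -ltnNge lab_lt.
Qed.

Lemma meval_grading p y (lam : 'I_L -> K) :
  (map_mpoly (meval (y 0)) (grading p)).@[lam] = p.@[scale_all lam y 0].
Proof.
move: p; apply: mpoly_ring_ind => [c|i|p q IHp IHq|p q IHp IHq].
- by rewrite /grading mmapC /= map_mpolyC /= !mevalC.
- rewrite /grading mmapX mmap1U rmorphM /= map_mpolyC map_mpolyX /= mevalM mevalC.
  by rewrite !mevalXU mxE mulrC.
- have mapD : {morph map_mpoly (meval (y 0)) : u v / u + v >-> u + v}.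
    by move=> u v; apply: raddfD.
  by rewrite gradingD mapD mevalD [RHS]mevalD; congr (_ + _).
by rewrite gradingM rmorphM /= mevalM [RHS]mevalM; congr (_ * _).
Qed.

Lemma meval_scale_all d p y lam : is_multihomog b d p ->
  p.@[scale_all lam y 0] = p.@[y 0] * \prod_l lam l ^+ d l.
Proof.
move=> hp; rewrite -meval_grading (grading_multihomog hp) rmorphM /= map_mpolyC map_mpolyX /=.
by rewrite mevalM mevalC mevalX; congr (_ * _); apply: eq_bigr => l _; rewrite mnmE.
Qed.

Lemma is_point_scale_all y lam : (forall l, lam l != 0) -> is_point b y ->
  is_point b (scale_all lam y).
Proof.
move=> lam0 py i; have [j bj yj] := py i; exists j => //.
by rewrite mxE mulf_neq0.
Qed.

(** For y in X the polynomial lam -> p(lam y) vanishes on the torus, hence identically, and its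
    coefficients are the values at y of the homogeneous parts of p. *)
Lemma vanishes_homog_part (X : 'rV[K]_n -> Prop) D p :
  (forall y lam, (forall l, lam l != 0) -> X y -> X (scale_all lam y)) ->
  vanishes_on X p -> vanishes_on X (homog_part D p).
Proof.
move=> scX pX y Xy; have : map_mpoly (meval (y 0)) (grading p) = 0.
  apply: (@meval_dense _ _ _ (\prod_(l < L) 'X_l)).
    by apply/prodf_neq0 => l _; rewrite -msupp_eq0 msuppX.
  move=> lam; rewrite rmorph_prod /= => /prodf_neq0 lam0; rewrite meval_grading.
  by apply/pX/scX => // l; have := lam0 l isT; rewrite mevalXU.
by move/(congr1 (mcoeff D)); rewrite mcoeff_map_mpoly mcoeff0.
Qed.

Lemma homog_part_neq0 p y : p.@[y 0] != 0 -> exists D, (homog_part D p).@[y 0] != 0.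
Proof.
move=> p0; pose q := map_mpoly (meval (y 0)) (grading p).
have q0 : q != 0.
  apply: contraNneq p0 => /(congr1 (meval (fun=> 1))).
  rewrite meval_grading meval0 => <-; apply/eqP/meval_eq => i.
  by rewrite mxE mul1r.
have : msupp q != [::] by rewrite msupp_eq0.
case E : (msupp q) => [//|D s] _; exists D.
by rewrite -mcoeff_map_mpoly -mcoeff_msupp E inE eqxx.
Qed.

Lemma homog_partM D d p q : is_multihomog b d q ->
  homog_part (D + degree_vector d)%MM (p * q) = homog_part D p * q.
Proof.
move=> hq; rewrite /homog_part gradingM (grading_multihomog hq) mulrA addmC mcoeffMX.
by rewrite mulrC mcoeffCM mulrC.
Qed.

Lemma homog_partM0 D d p q : is_multihomog b d q ->
  ~~ (degree_vector d <= D)%MM -> homog_part D (p * q) = 0.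
Proof.
move=> hq nD; rewrite /homog_part gradingM (grading_multihomog hq) mulrA.
apply/eqP; rewrite mcoeff_eq0 (perm_mem (msuppMX _ _)).
apply: contra nD => /mapP [m _ ->]; exact: lem_addr.
Qed.

Lemma homog_part_is_additive D : additive (homog_part D).
Proof.
by move=> p q; rewrite /homog_part /grading (raddfB (mmap _ _)) raddfB.
Qed.

Lemma multihomog_degree0 d p : is_multihomog b d p -> p != 0 ->
  forall l, (L <= l)%N -> d l = 0%N.
Proof.
rewrite -msupp_eq0; case E: (msupp p) => [//|m s] hp _ l Ll.
rewrite -(hp m) ?E ?inE ?eqxx // big_pred0 // => i.
by apply: contraTF Ll => /eqP <-; rewrite -ltnNge lab_lt.
Qed.

(** [generates_at] provides arbitrary polynomials s and a_k, whereas only forms can be evaluated on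
    closures. A homogeneous part of s that is nonzero at x is chosen, and one multidegree is
    extracted from the whole identity. The last hypothesis excludes the cases in which sum a_k g_k
    has no part of this degree. *)
Lemma generates_at_homog (X C : 'rV[K]_n -> Prop) r (g : 'I_r -> {mpoly K[n]}) x dg dp p :
  (forall y lam, (forall l, lam l != 0) -> X y -> X (scale_all lam y)) ->
  generates_at b X C g x -> (forall k, is_multihomog b dg (g k)) ->
  is_multihomog b dp p -> vanishes_on C p ->
  (forall s, s.@[x 0] != 0 -> ~ vanishes_on X (s * p)) ->
  exists ds da s (a : 'I_r -> {mpoly K[n]}),
   [/\ is_multihomog b ds s, s.@[x 0] != 0, forall k, is_multihomog b da (a k),
       forall l, (da l + dg l = ds l + dp l)%N &
       vanishes_on X (s * p - \sum_(k < r) a k * g k)].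
Proof.
move=> scX [_ gen] hg hp pC nz.
have [s0 [s0x [a0 van]]] := gen _ _ hp pC.
have [Ds sx] := homog_part_neq0 s0x.
set s := homog_part Ds s0 in sx.
set D := (Ds + degree_vector dp)%MM.
have vanD := vanishes_homog_part D scX van.
have hB p1 p2 : homog_part D (p1 - p2) = homog_part D p1 - homog_part D p2.
  exact: homog_part_is_additive.
have h0 : homog_part D 0 = 0 by have := hB 0 0; rewrite !subrr.
have hS (F : 'I_r -> {mpoly K[n]}) :
    homog_part D (\sum_k F k) = \sum_k homog_part D (F k).
  elim/big_rec2: _ => // k q1 q2 _ <-.
  by rewrite -[q2 in LHS]opprK hB -[- q2]sub0r hB h0 sub0r opprK.
rewrite hB hS homog_partM // -/s in vanD.
have [gD|ngD] := boolP (degree_vector dg <= D)%MM; last first.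
  case: (nz s sx); suff E0 : \sum_(k < r) homog_part D (a0 k * g k) = 0.
    by move: vanD; rewrite E0 subr0.
  by apply: big1 => k _; apply: homog_partM0 (hg k) ngD.
pose Da := (D - degree_vector dg)%MM.
have DE : D = (Da + degree_vector dg)%MM by rewrite submK.
have [k gk|g0] := pickP (fun k => g k != 0); last first.
  case: (nz s sx); suff E0 : \sum_(k < r) homog_part D (a0 k * g k) = 0.
    by move: vanD; rewrite E0 subr0.
  by apply: big1 => k _; have /negbFE/eqP -> := g0 k; rewrite mulr0.
have p0 : p != 0.
  by apply/negP => /eqP p0; apply: (nz s sx) => y _; rewrite p0 mulr0 meval0.
have [ds [hs dsL dsL0]] := homog_part_multihomog Ds s0.
have [da [_ daL daL0]] := homog_part_multihomog Da s0.
exists ds, da, s, (fun k => homog_part Da (a0 k)); split.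
- exact: hs.
- exact: sx.
- move=> j; have [d' [h' d'L d'L0]] := homog_part_multihomog Da (a0 j).
  apply: eq_multihomog h' => l; have [lL|Ll] := ltnP l L; last by rewrite d'L0 ?daL0.
  by have := d'L (Ordinal lL); have := daL (Ordinal lL) => /= -> ->.
- move=> l; have [lL|Ll] := ltnP l L; last first.
    by rewrite daL0 // dsL0 // (multihomog_degree0 (hg k) gk) //
      (multihomog_degree0 hp p0).
  have := dsL (Ordinal lL); have := daL (Ordinal lL) => /= -> ->.
  by have /(congr1 (fun m : 'X_{1..L} => m (Ordinal lL))) := DE; rewrite !mnmDE !mnmE.
suff -> : \sum_(j < r) homog_part Da (a0 j) * g j = \sum_(j < r) homog_part D (a0 j * g j).
  exact: vanD.
by apply: eq_bigr => j _; rewrite [in RHS]DE homog_partM.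
Qed.

(** A factor common to the coordinates of each block comes out of a form as a product of powers
    depending only on the multidegree. It may be a polynomial, as happens for equations cleared of
    denominators. *)
Lemma pullback_scale_blocks N' d (mu : 'I_n -> {mpoly K[N']}) :
  (forall i j, b i = b j -> mu i = mu j) ->
  exists s : {mpoly K[N']},
    (forall v, (forall i, (mu i).@[v] != 0) -> s.@[v] != 0) /\
    forall p psi, is_multihomog b d p ->
      pullback (fun i => mu i * psi i) p = s * pullback psi p.
Proof.
move=> mub; pose lam (l : 'I_L) := if [pick i | b i == l] is Some i then mu i else 1.
have lamE i : lam (lab i) = mu i.
  rewrite /lam; case: pickP => [j /eqP /mub //|/(_ i)].
  by rewrite eqxx.
exists (\prod_l lam l ^+ d l); split=> [v mu0|p psi hp].
  rewrite rmorph_prod; apply/prodf_neq0 => l _; rewrite rmorphXn expf_neq0 //=.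
  by rewrite /lam; case: pickP => [i _|_] //; rewrite meval1 oner_eq0.
apply: mpoly_fun_eq => v; rewrite mevalM !meval_pullback mulrC rmorph_prod.
under eq_bigr do rewrite rmorphXn.
rewrite -(meval_scale_all _ (fun l => (lam l).@[v]) hp); apply: meval_eq => i.
by rewrite !mxE mevalM lamE.
Qed.

End Multihomogeneous.

Lemma meval_scale_blocks (K : closedFieldType) n (b : 'I_n -> nat) d (mu : 'I_n -> K) :
  (forall i j, b i = b j -> mu i = mu j) ->
  exists c : K, ((forall i, mu i != 0) -> c != 0) /\
    forall (p : {mpoly K[n]}) (y : 'rV[K]_n), is_multihomog b d p ->
      p.@[(\row_i (mu i * y 0 i)) 0] = c * p.@[y 0].
Proof.
move=> mub; have := @pullback_scale_blocks K n b 0 d (fun i => (mu i)%:MP).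
case=> [i j /mub -> //|s [s0 sE]]; exists s.@[fun=> 0]; split=> [mu0|p y hp].
  by apply: s0 => i; rewrite mevalC.
have /(congr1 (meval (fun=> 0))) := sE p (fun i => (y 0 i)%:MP) hp.
rewrite mevalM !meval_pullback => E.
have -> : p.@[y 0] = p.@[param (fun i => (y 0 i)%:MP_[0]) (fun=> 0) 0].
  by apply: meval_eq => i; rewrite !mxE mevalC.
by rewrite -E; apply: meval_eq => i; rewrite !mxE mevalM !mevalC.
Qed.

Arguments multihomogX {K n} b i.

(** * Functions of the chart coordinates as forms *)

Section Homogenization.
Variables (K : closedFieldType) (n N : nat).
Variables (tau : 'I_n -> {mpoly K[N]}) (sg : {mpoly K[N]}) (D : nat).

(* sg ^ D * c(tau / sg), for [msize c <= D]. *)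
Definition homogenize (c : {mpoly K[n]}) : {mpoly K[N]} :=
  \sum_(m <- msupp c) c@_m *: ((\prod_i tau i ^+ m i) * sg ^+ (D - mdeg m)).

Lemma meval_homogenize (c : {mpoly K[n]}) (t : 'I_n -> K) y :
  (msize c <= D)%N -> (forall i, (tau i).@[y] = t i * sg.@[y]) ->
  (homogenize c).@[y] = sg.@[y] ^+ D * c.@[t].
Proof.
move=> cD tauE; rewrite /homogenize (raddf_sum (meval y)) (mevalE t) mulr_sumr.
rewrite !big_seq; apply: eq_bigr => m mc /=; rewrite mevalZ mulrCA; congr (_ * _).
rewrite mevalM rmorphXn rmorph_prod /=.
under eq_bigr do rewrite rmorphXn /= tauE exprMn.
rewrite big_split /= prodrXr -mdegE -mulrA -exprD subnKC; first by rewrite mulrC.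
by rewrite ltnW // (leq_trans (msize_mdeg_lt mc)).
Qed.

Lemma homogenize_multihomog (b : 'I_N -> nat) dd c :
  (msize c <= D)%N -> (forall i, is_multihomog b dd (tau i)) -> is_multihomog b dd sg ->
  is_multihomog b (fun l => D * dd l)%N (homogenize c).
Proof.
move=> cD htau /multihomogP hsg; apply/multihomogP => l a y.
rewrite /homogenize !(raddf_sum (meval _)) mulr_sumr !big_seq.
apply: eq_bigr => m mc /=; rewrite !mevalZ mulrCA; congr (_ * _).
rewrite !mevalM !rmorphXn !rmorph_prod /= hsg.
have -> : \prod_(i < n) (tau i ^+ m i).@[scale_block b l a y 0] =
    (a ^+ dd l) ^+ mdeg m * \prod_(i < n) (tau i ^+ m i).@[y 0].
  rewrite mdegE -prodrXr -big_split; apply: eq_bigr => i _ /=.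
  by have /multihomogP E := htau i; rewrite !rmorphXn /= E exprMn.
rewrite exprMn mulrACA -exprD subnKC -?exprM 1?mulnC //.
by rewrite ltnW // (leq_trans (msize_mdeg_lt mc)).
Qed.

End Homogenization.

(** * Charts *)

(* [tau / sg] inverts [psi] near [x]; [chart_generic] says that [X] is the closure of the
   image of [psi]. *)
Record chart (K : closedFieldType) n N (b : 'I_N -> nat) (X : 'rV[K]_N -> Prop)
    (x : 'rV[K]_N) (psi : 'I_N -> {mpoly K[n]}) (t0 : 'I_n -> K)
    (tau : 'I_n -> {mpoly K[N]}) (sg : {mpoly K[N]}) (dd : nat -> nat) : Prop := Chart {
  chart_base : param psi t0 = x;
  chart_den_neq0 : sg.@[x 0] != 0;
  chart_num_homog : forall i, is_multihomog b dd (tau i);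
  chart_den_homog : is_multihomog b dd sg;
  chart_coord : forall t i, (tau i).@[param psi t 0] = t i * sg.@[param psi t 0];
  chart_is_point : forall t, sg.@[param psi t 0] != 0 -> is_point b (param psi t);
  chart_generic : forall d p, is_multihomog b d p ->
    vanishes_on X p <-> forall t, p.@[param psi t 0] = 0;
  chart_closed : forall y, X y <-> zclosure b X y
}.

Arguments chart_num_homog {K n N b X x psi t0 tau sg dd} c i.

(** * Differentials and Euler's relation *)

Section Differential.
Variables (K : closedFieldType) (n : nat).
Implicit Types (p q : {mpoly K[n]}) (x w : 'rV[K]_n).

Lemma differentialD p q x w :
  differential (p + q) x w = differential p x w + differential q x w.
Proof.
by rewrite /differential -big_split; apply: eq_bigr => i _; rewrite mderivD mevalD mulrDl.
Qed.

Lemma differentialZ c p x w : differential (c *: p) x w = c * differential p x w.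
Proof.
by rewrite /differential mulr_sumr; apply: eq_bigr => i _; rewrite mderivZ mevalZ mulrA.
Qed.

Lemma differentialB p q x w :
  differential (p - q) x w = differential p x w - differential q x w.
Proof. by rewrite -scaleN1r differentialD differentialZ mulN1r. Qed.

Lemma differentialM p q x w : differential (p * q) x w =
  differential p x w * q.@[x 0] + p.@[x 0] * differential q x w.
Proof.
rewrite /differential mulr_suml mulr_sumr -big_split; apply: eq_bigr => i _.
by rewrite mderivM mevalD !mevalM mulrDl /= -!mulrA [w 0 i * _]mulrC.
Qed.

Lemma differentialC c x w : differential c%:MP x w = 0.
Proof. by rewrite /differential big1 // => i _; rewrite mderivC meval0 mul0r. Qed.

Lemma differentialXU i x w : differential 'X_i x w = w 0 i.
Proof.
rewrite /differential (bigD1 i) //= big1 ?addr0 => [|j /negbTE ji].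
  rewrite mderivX mnm1E eqxx.
  have -> : (U_(i) - U_(i))%MM = 0%MM by apply/mnmP => k; rewrite mnmBE mnm0E subnn.
  by rewrite mpolyX0 scale1r meval1 mul1r.
by rewrite mderivX mnm1E eq_sym ji scale0r meval0 mul0r.
Qed.

Lemma differential_sum (I : Type) (r : seq I) (P : pred I) (F : I -> {mpoly K[n]}) x w :
  differential (\sum_(i <- r | P i) F i) x w = \sum_(i <- r | P i) differential (F i) x w.
Proof.
elim/big_rec2: _ => [|i p q _ <-]; last by rewrite differentialD.
by rewrite -mpolyC0 differentialC.
Qed.

Lemma differentialDr p x w w' :
  differential p x (w + w') = differential p x w + differential p x w'.
Proof.
by rewrite /differential -big_split; apply: eq_bigr => i _; rewrite mxE mulrDr.
Qed.

Lemma differential_pullback m (psi : 'I_n -> {mpoly K[m]}) p (t v : 'rV[K]_m) :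
  differential (pullback psi p) t v =
  differential p (param psi (t 0)) (\row_i differential (psi i) t v).
Proof.
rewrite /differential; under eq_bigr do rewrite mderiv_pullback mulr_suml.
rewrite exchange_big; apply: eq_bigr => i _ /=; rewrite mxE mulr_sumr.
by apply: eq_bigr => j _; rewrite mulrA.
Qed.

End Differential.

(** Differentiate at c = 1 the identity p(c x) = c^d p(x), where c scales block [l] only. *)
Lemma euler_block (K : closedFieldType) n (b : 'I_n -> nat) d (p : {mpoly K[n]}) l (x : 'rV[K]_n) : is_multihomog b d p ->
  \sum_(i < n | b i == l) p^`M(i).@[x 0] * x 0 i = (d l)%:R * p.@[x 0].
Proof.
move=> /multihomogP hp.
pose psi i : {mpoly K[1]} := if b i == l then (x 0 i) *: 'X_ord0 else (x 0 i)%:MP.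
have pt c : param psi c = scale_block b l (c ord0) x.
  apply/rowP => i; rewrite !mxE /psi; case: ifP => _; last by rewrite mevalC.
  by rewrite mevalZ mevalXU mulrC.
pose v : 'rV[K]_1 := const_mx 1.
have -> : (d l)%:R * p.@[x 0] = differential (pullback psi p) v v.
  have -> : pullback psi p = p.@[x 0] *: 'X_ord0 ^+ d l.
    apply: mpoly_fun_eq => c; rewrite meval_pullback pt hp mevalZ rmorphXn /= mevalXU.
    by rewrite mulrC.
  rewrite differentialZ mulrC; congr (_ * _).
  elim: (d l) => [|k IHk]; first by rewrite expr0 -mpolyC1 differentialC.
  rewrite exprS differentialM -IHk differentialXU rmorphXn /= mevalXU !mxE expr1n.
  by rewrite !mul1r mulrS.
rewrite differential_pullback pt mxE.
have -> : scale_block b l 1 x = x.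
  by apply/rowP => i; rewrite mxE mul1r; case: ifP.
rewrite /differential big_mkcond; apply: eq_bigr => i _; rewrite mxE.
rewrite -/(differential (psi i) v v) /psi; case: ifP => _; last by rewrite differentialC mulr0.
by rewrite differentialZ differentialXU mxE mulr1.
Qed.

Section ChartTheory.
Variables (K : closedFieldType) (n N : nat) (b : 'I_N -> nat) (X : 'rV[K]_N -> Prop).
Variables (x : 'rV[K]_N) (psi : 'I_N -> {mpoly K[n]}) (t0 : 'I_n -> K).
Variables (tau : 'I_n -> {mpoly K[N]}) (sg : {mpoly K[N]}) (dd : nat -> nat).
Hypothesis ch : chart b X x psi t0 tau sg dd.

Lemma chart_mem t : sg.@[param psi t 0] != 0 -> X (param psi t).
Proof.
move=> sgt; apply/(chart_closed ch); split; first exact: chart_is_point ch _ sgt.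
by move=> d p hp /(chart_generic ch hp).
Qed.

Lemma chart_base_coord i : (tau i).@[x 0] = t0 i * sg.@[x 0].
Proof. by rewrite -(chart_base ch) (chart_coord ch). Qed.

Lemma chart_base_mem : X x.
Proof. by rewrite -(chart_base ch); apply: chart_mem; rewrite (chart_base ch) (chart_den_neq0 ch). Qed.

Lemma chart_base_is_point : is_point b x.
Proof. by have /(chart_closed ch)[] := chart_base_mem. Qed.

Lemma chart_scale_all y (lam : 'I_(\max_(i < N) b i).+1 -> K) :
  (forall l, lam l != 0) -> X y -> X (scale_all lam y).
Proof.
move=> lam0 /(chart_closed ch) [py hy]; apply/(chart_closed ch); split.
  exact: is_point_scale_all.
by move=> d p hp pX; rewrite (meval_scale_all _ _ hp) (hy _ _ hp pX) mul0r.
Qed.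

(** Multiplication by [kap] shrinks the open set on which the denominator is nonzero. It serves to
    discard a component of a centre that misses the given point. *)
Lemma chart_rescale kap dk : is_multihomog b dk kap -> kap.@[x 0] != 0 ->
  chart b X x psi t0 (fun i => kap * tau i) (kap * sg) (fun l => dk l + dd l)%N.
Proof.
move=> hk kx; case: (ch) => E1 E2 E3 E4 E5 E6 E7 E8; split=> //.
- by rewrite mevalM mulf_neq0.
- by move=> i; apply: multihomogM.
- exact: multihomogM.
- by move=> t i; rewrite !mevalM E5 mulrCA.
- by move=> t; rewrite mevalM mulf_eq0 negb_or => /andP[_ /E6].
Qed.

(** When the coordinates of a rational map share a factor [theta] on the chart, the cofactors
    [beta], rewritten as forms through t = tau / sg, represent the same map without a common zero at
    x. The uniform bound [D] gives these forms equal multidegree. *)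
Lemma chart_regular (T : Type) (f : T -> {mpoly K[N]}) (beta : T -> {mpoly K[n]})
    (theta : {mpoly K[n]}) D de :
  (forall u, is_multihomog b de (f u)) ->
  (forall u t, (f u).@[param psi t 0] = theta.@[t] * (beta u).@[t]) ->
  (forall u, (msize (beta u) <= D)%N) ->
  (exists u, (beta u).@[t0] != 0) ->
  exists (d : nat -> nat) (h : T -> {mpoly K[N]}),
    [/\ forall u, is_multihomog b d (h u), exists u, (h u).@[x 0] != 0
      & forall y, X y -> forall u v,
          (h u).@[y 0] * (f v).@[y 0] = (h v).@[y 0] * (f u).@[y 0]].
Proof.
move=> hf fE betaD [u0 bu0].
pose h u := homogenize tau sg D (beta u).
have hE t u : (h u).@[param psi t 0] = sg.@[param psi t 0] ^+ D * (beta u).@[t].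
  by apply: meval_homogenize => // i; apply: chart_coord ch _ _.
have hh u : is_multihomog b (fun l => D * dd l)%N (h u).
  apply: homogenize_multihomog => //; [exact: chart_num_homog ch | exact: chart_den_homog ch].
exists (fun l => D * dd l)%N, h; split=> //.
  exists u0; rewrite -(chart_base ch) hE mulf_neq0 ?expf_neq0 //.
  by rewrite (chart_base ch) (chart_den_neq0 ch).
move=> y Xy u v; apply/eqP; rewrite -subr_eq0 -!mevalM -mevalB; apply/eqP.
move: y Xy; apply/(chart_generic ch) => [|t].
  by apply: multihomogB; apply: multihomogM.
by rewrite mevalB !mevalM !hE !fE; ring.
Qed.

End ChartTheory.

(** * A chart gives smoothness *)

Section ChartSmooth.
Variables (K : closedFieldType) (n N : nat) (b : 'I_N -> nat) (X : 'rV[K]_N -> Prop).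
Variables (x : 'rV[K]_N) (psi : 'I_N -> {mpoly K[n]}) (t0 : 'I_n -> K).
Variables (tau : 'I_n -> {mpoly K[N]}) (sg : {mpoly K[N]}) (dd : nat -> nat).
Hypothesis ch : chart b X x psi t0 tau sg dd.

(** The index of a coordinate of the same factor that is nonzero at x; it depends only on the block
    and dehomogenizes that factor. *)
Definition rep (i : 'I_N) : 'I_N := odflt i [pick j | (b j == b i) && (x 0 j != 0)].

Lemma rep_spec i : b (rep i) = b i /\ x 0 (rep i) != 0.
Proof.
rewrite /rep; case: pickP => [j /andP[/eqP bj xj] //|h].
have [j bj xj] := chart_base_is_point ch i.
by have := h j; rewrite bj eqxx xj.
Qed.

Lemma rep_block i j : b i = b j -> rep i = rep j.
Proof.
move=> bij; rewrite /rep bij; case: pickP => [//|h].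
have [k bk xk] := chart_base_is_point ch j.
by have := h k; rewrite bk eqxx xk.
Qed.

(** Near x, X is given by the condition that y and psi(tau(y) / sg(y)) are the same point, block by
    block. Cleared of denominators and dehomogenized by [rep], it reads h_i = v_i - u_i = 0, where v
    is y rescaled on each block and u represents psi(tau(y) / sg(y)). The constant [c] makes [mu]
    equal to 1 at x, so that u = v = x there. *)
Let D := (\sum_(i < N) msize (psi i))%N.
Let c i : K := (sg.@[x 0] ^+ D * x 0 (rep i))^-1.
Let hat i := homogenize tau sg D (psi i).
Let mu i : {mpoly K[N]} := c i *: hat (rep i).
Let v i : {mpoly K[N]} := mu i * 'X_i.
Let u i : {mpoly K[N]} := c i *: ('X_(rep i) * hat i).
Let h i := v i - u i.

Let psiD i : (msize (psi i) <= D)%N.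
Proof. by rewrite /D (bigD1 i) //= leq_addr. Qed.

Let hatE y t i : (forall j, (tau j).@[y] = t j * sg.@[y]) ->
  (hat i).@[y] = sg.@[y] ^+ D * (psi i).@[t].
Proof. by move=> tE; apply: meval_homogenize. Qed.

Let psi0 i : (psi i).@[t0] = x 0 i.
Proof. by rewrite -(chart_base ch) mxE. Qed.

Let hatx i : (hat i).@[x 0] = sg.@[x 0] ^+ D * x 0 i.
Proof. by rewrite (hatE _ (chart_base_coord ch)) psi0. Qed.

Let c0 i : sg.@[x 0] ^+ D * x 0 (rep i) != 0.
Proof. by rewrite mulf_neq0 ?expf_neq0 ?(chart_den_neq0 ch) // (rep_spec i).2. Qed.

Let mux i : (mu i).@[x 0] = 1.
Proof. by rewrite mevalZ hatx mulVf. Qed.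

Let vx : param v (x 0) = x.
Proof. by apply/rowP => i; rewrite mxE mevalM mux mevalXU mul1r. Qed.

Let ux : param u (x 0) = x.
Proof.
apply/rowP => i; rewrite mxE mevalZ mevalM hatx mevalXU [x 0 (rep i) * _]mulrCA.
by rewrite [X in c i * X]mulrA mulrA mulVf ?mul1r.
Qed.

Let mu_block i j : b i = b j -> mu i = mu j.
Proof. by move=> /rep_block ij; rewrite /mu /c ij. Qed.

Let h_rep i : rep i = i -> h i = 0.
Proof. by move=> ri; rewrite /h /v /u /mu ri -scalerAl [hat i * _]mulrC subrr. Qed.

Let hat_homog i : is_multihomog b (fun l => D * dd l)%N (hat i).
Proof.
apply: homogenize_multihomog => //; [exact: chart_num_homog ch | exact: chart_den_homog ch].
Qed.

Let h_homog i : exists d, is_multihomog b d (h i).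
Proof.
exists (fun l => D * dd l + (b i == l))%N; apply: multihomogB.
  have hm : is_multihomog b (fun l => D * dd l)%N (mu i) by exact: multihomogZ (@hat_homog _).
  exact: multihomogM hm (multihomogX b i).
apply: multihomogZ.
have hu := multihomogM (multihomogX b (rep i)) (@hat_homog i).
apply: (eq_multihomog _ hu).
by move=> l; rewrite (rep_spec i).1 addnC.
Qed.

Let h_vanishes i : vanishes_on X (h i).
Proof.
have [d hd] := h_homog i; apply/(chart_generic ch hd) => t.
have E := hatE _ (chart_coord ch t).
rewrite /h /v /u /mu mevalB mevalM !mevalZ mevalM !mevalXU.
rewrite (E i) (E (rep i)); set S := _ ^+ D.
by rewrite !paramE; ring.
Qed.

(* [u y] is, up to scaling of the blocks, the image under psi of the point with
   coordinates tau(y) / sg(y). *)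
Let eval_u d (y : 'rV[K]_N) : sg.@[y 0] != 0 -> exists e : K, forall p, is_multihomog b d p ->
  p.@[param u (y 0) 0] = e * p.@[param psi (fun j => (tau j).@[y 0] / sg.@[y 0]) 0].
Proof.
move=> sy; pose t j := (tau j).@[y 0] / sg.@[y 0].
have tE j : (tau j).@[y 0] = t j * sg.@[y 0] by rewrite divfK.
have [i j /rep_block ij|e [_ E]] := @meval_scale_blocks K N b d
   (fun i => c i * y 0 (rep i) * sg.@[y 0] ^+ D); first by rewrite /c ij.
exists e => p hp; rewrite -E //; apply: meval_eq => i.
by rewrite paramE [RHS]mxE paramE mevalZ mevalM mevalXU (hatE i tE) !mulrA.
Qed.

Let sg_neq0 : sg != 0. Proof. exact: meval_neq0 (chart_den_neq0 ch). Qed.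

Let vE v' (p : {mpoly K[N]}) : p.@[v'] = p.@[(\row_i v' i) 0] :> K.
Proof. by apply: meval_eq => i; rewrite mxE. Qed.

Let scale_v d : exists s : {mpoly K[N]}, s.@[x 0] != 0 /\
  forall p, is_multihomog b d p -> pullback v p = s * p.
Proof.
have [s [s0 sE]] := @pullback_scale_blocks K N b N d mu mu_block.
exists s; split; first by apply: s0 => i; rewrite mux oner_eq0.
by move=> p hp; rewrite sE // /pullback comp_mpoly_id.
Qed.

(** By homogeneity p(v) is p times a unit at x, and p(u) = 0 because u lies on the image of psi up
    to scaling; their difference is in the ideal of the h_i. *)
Let h_generates d p : is_multihomog b d p -> vanishes_on X p ->
  exists2 s, s.@[x 0] != 0 & exists q, s * p = \sum_i h i * q i.
Proof.
move=> hp pX; have [s [sx sE]] := scale_v d; exists s => //.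
have [q [E _]] := mpoly_difference p v u; exists q; rewrite -E sE //.
suff -> : pullback u p = 0 by rewrite subr0.
apply: (meval_dense sg_neq0) => y; rewrite vE => sy.
have [e eE] := eval_u d sy.
rewrite meval_pullback; have := eE p hp.
have -> : param u ((\row_i y i) 0) = param u y.
  by apply/rowP => i; rewrite !mxE -vE.
by move=> ->; rewrite ((chart_generic ch hp).1 pX) mulr0.
Qed.

(** The functions tau_j / sg take the same value at u and at v. Expanding sg (tau_j(v) - tau_j(u)) -
    tau_j (sg(v) - sg(u)) = 0 in the h_k gives one syzygy for each j, whose coefficients at x form
    the row sg^2 d(tau_j / sg). *)
Let h_relations : exists M : 'I_n -> 'I_N -> {mpoly K[N]}, forall j,
  \sum_k h k * M j k = 0 /\ forall k, (M j k).@[x 0] =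
    sg.@[x 0] * (tau j)^`M(k).@[x 0] - (tau j).@[x 0] * sg^`M(k).@[x 0].
Proof.
have [s [_ sE]] := scale_v dd.
have [qs [Es Ds]] := mpoly_difference sg v u.
have [q qE] := fin_all_exists (fun j => mpoly_difference (tau j) v u).
exists (fun j k => sg * q j k - tau j * qs k) => j; have [Ej Dj] := qE j; split.
  have -> : \sum_k h k * (sg * q j k - tau j * qs k) =
      sg * (\sum_k (v k - u k) * q j k) - tau j * (\sum_k (v k - u k) * qs k).
    by rewrite !mulr_sumr -sumrB; apply: eq_bigr => k _; rewrite /h; ring.
  rewrite -Ej -Es (sE _ (chart_den_homog ch)) (sE _ (chart_num_homog ch j)).
  suff E : tau j * pullback u sg - sg * pullback u (tau j) = 0.
    by rewrite -[RHS]E; ring.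
  apply: (meval_dense sg_neq0) => y; rewrite vE => sy.
  have [e eE] := eval_u dd sy.
  have uE : param u ((\row_i y i) 0) = param u y.
    by apply/rowP => i; rewrite !mxE -vE.
  have e1 := eE _ (chart_den_homog ch); have e2 := eE _ (chart_num_homog ch j).
  rewrite mevalB !mevalM !meval_pullback -uE e1 e2.
  rewrite (chart_coord ch) [sg.@[y]]vE [(tau j).@[y]]vE; field.
  exact: sy.
move=> k /=; rewrite mevalB !mevalM Dj ?Ds ?vx ?ux //.
Qed.

Let jac : 'M[K]_(n, N) := \matrix_(j, k)
  (sg.@[x 0] * (tau j)^`M(k).@[x 0] - (tau j).@[x 0] * sg^`M(k).@[x 0]).

Let jac' : 'M[K]_(n, N) := \matrix_(j, k) (if rep k == k then 0 else jac j k).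

(** [jac] is sg^2 times the differential of tau / sg, a left inverse of psi. *)
Let jac_inv : jac *m (\matrix_(k, i) (psi k)^`M(i).@[t0]) = (sg.@[x 0] ^+ 2)%:M.
Proof.
apply/matrixP => j i; rewrite !mxE.
have D1 p : (pullback psi p)^`M(i).@[t0] =
    \sum_k p^`M(k).@[x 0] * (psi k)^`M(i).@[t0].
  by rewrite mderiv_pullback (chart_base ch).
have E : pullback psi (tau j) = 'X_j * pullback psi sg.
  apply: mpoly_fun_eq => t.
  by rewrite mevalM mevalXU !meval_pullback (chart_coord ch).
have {E} := congr1 (fun p => p^`M(i).@[t0]) E.
rewrite mderivM mevalD !mevalM !D1 meval_pullback (chart_base ch) mevalXU => E.
under eq_bigr do rewrite !mxE mulrBl -!mulrA.
rewrite sumrB -!mulr_sumr E (chart_base_coord ch) mderivX mnm1E mulrDr.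
case: eqP => [->|_]; last by rewrite scale0r meval0 mulr0n; ring.
have -> : (U_(i) - U_(i))%MM = 0%MM by apply/mnmP => k; rewrite mnmBE mnm0E subnn.
by rewrite mpolyX0 scale1r meval1 mulr1n; ring.
Qed.

Let jac_euler j l : \sum_(k < N | b k == l) jac j k * x 0 k = 0.
Proof.
under eq_bigr do rewrite mxE mulrBl -!mulrA.
rewrite sumrB -!mulr_sumr (euler_block _ _ (chart_num_homog ch j)).
by rewrite (euler_block _ _ (chart_den_homog ch)); ring.
Qed.

(** The columns with rep k = k are cleared because h_k = 0 there. No rank is lost: the rows of [jac]
    satisfy Euler's relation of degree 0 in each block, which recovers the cleared column from the
    others, as x_k is nonzero. *)
Let jac'_free : row_free jac'.
Proof.
apply: inj_row_free => w w0.
have wjac k : rep k != k -> (w *m jac) 0 k = 0.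
  move=> rk; have := congr1 (fun A : 'rV_N => A 0 k) w0; rewrite [LHS]mxE [RHS]mxE => E.
  by rewrite mxE -[RHS]E; apply: eq_bigr => j _; rewrite [jac' _ _]mxE (negbTE rk).
have {}wjac : w *m jac = 0.
  apply/rowP => k; rewrite [RHS]mxE; have [rk|/wjac //] := eqVneq (rep k) k.
  have : \sum_(i < N | b i == b k) (w *m jac) 0 i * x 0 i = 0.
    under eq_bigr do rewrite mxE mulr_suml.
    rewrite exchange_big big1 // => j _ /=.
    under eq_bigr do rewrite -mulrA.
    by rewrite -mulr_sumr jac_euler mulr0.
  rewrite (bigD1 k) //= big1 ?addr0 => [/eqP|i /andP[/eqP bi ik]]; last first.
    rewrite wjac ?mul0r //; apply: contraNneq ik => ri.
    by rewrite -ri (rep_block bi) rk.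
  by rewrite mulf_eq0 -[k in x 0 k]rk (negbTE (rep_spec k).2) orbF => /eqP.
have := congr1 (mulmx^~ (\matrix_(k, i) (psi k)^`M(i).@[t0])) wjac.
rewrite mul0mx -mulmxA jac_inv mul_mx_scalar => /eqP.
by rewrite scaler_eq0 expf_eq0 (negbTE (chart_den_neq0 ch)) => /eqP.
Qed.

Lemma chart_smooth : smooth_at b X x.
Proof.
have [M MP] := h_relations.
pose M' j k := if rep k == k then 0 else M j k.
have jacE j k : jac' j k = (M' j k).@[x 0].
  by rewrite !mxE /M'; case: ifP => _; rewrite ?meval0 // (MP j).2.
have full : row_full jac'^T by rewrite /row_full mxrank_tr; exact: jac'_free.
pose f := fullrankfun full.
have f_inj : injective f by apply: fullrankfun_inj.
(* [f] selects n equations whose coefficient matrix in the syzygies is invertible at x. By Cramer's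
   rule, det B times each of them lies in the ideal of the remaining ones, indexed by [R]. *)
pose B : 'M[{mpoly K[N]}]_n := \matrix_(a, j) M' j (f a).
have Bx : (\det B).@[x 0] != 0.
  rewrite -[_.@[_]]/(meval (x 0) (\det B)) -det_map_mx.
  have -> : map_mx (meval (x 0)) B = rowsub f jac'^T.
    by apply/matrixP => a j; rewrite !mxE -jacE !mxE.
  by rewrite -unitfE -unitmxE; apply: fullrowsub_unit.
pose R := [set k | (rep k != k) && (k \notin codom f)].
pose g (a : 'I_#|R|) := h (enum_val a).
pose inI p := exists q : 'I_#|R| -> {mpoly K[N]}, p = \sum_a q a * g a.
have inI0 : inI 0 by exists (fun=> 0); rewrite big1 // => a _; rewrite mul0r.
have inID p q : inI p -> inI q -> inI (p + q).
  move=> [p' ->] [q' ->]; exists (fun a => p' a + q' a); rewrite -big_split.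
  by apply: eq_bigr => a _; rewrite mulrDl.
have inIM p q : inI p -> inI (q * p).
  move=> [p' ->]; exists (fun a => q * p' a); rewrite mulr_sumr.
  by apply: eq_bigr => a _; rewrite mulrA.
have inIS (I : finType) (P : pred I) (F : I -> {mpoly K[N]}) :
    (forall i, P i -> inI (F i)) -> inI (\sum_(i | P i) F i).
  by move=> IF; elim/big_ind: _.
have inIR k : k \in R -> inI (h k).
  move=> kR; exists (fun a => (a == enum_rank_in kR k)%:R).
  rewrite (bigD1 (enum_rank_in kR k)) //= eqxx mul1r big1 ?addr0 => [|a /negbTE->].
    by rewrite /g enum_rankK_in.
  by rewrite mul0r.
have inIB i : inI (\det B * h i).
  have [ri|ri] := eqVneq (rep i) i; first by rewrite h_rep // mulr0.
  have [/codomP [a ->]|fi] := boolP (i \in codom f); last first.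
    by apply/inIM/inIR; rewrite inE ri.
  pose H : 'rV[{mpoly K[N]}]_n := \row_a h (f a).
  have HB : inI ((H *m B *m \adj B) 0 a).
    rewrite mxE; apply/inIS => j _; rewrite mulrC; apply/inIM.
    have : \sum_k h k * M' j k = 0.
      rewrite -[RHS](MP j).1; apply: eq_bigr => k _; rewrite /M'.
      by case: eqP => // /h_rep ->; rewrite !mul0r.
    rewrite (bigID (mem (codom f))) /= => /eqP; rewrite addr_eq0 => /eqP E.
    have -> : (H *m B) 0 j = \sum_(k in codom f) h k * M' j k.
      rewrite mxE -big_uniq; last by rewrite map_inj_uniq ?enum_uniq.
      by rewrite big_image; apply: eq_bigr => a' _; rewrite !mxE.
    rewrite E -mulN1r; apply/inIM; apply/inIS => k fk; rewrite mulrC.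
    rewrite /M'; case: ifP => [_|/negbT rk]; first by rewrite mul0r.
    by apply/inIM/inIR; rewrite inE rk.
  by move: HB; rewrite -mulmxA mul_mx_adj mul_mx_scalar !mxE.
exists #|R|, g; split.
- by move=> a; apply: h_homog.
- split=> [a|d p hp pX]; first exact: h_vanishes.
  have [s sx [q E]] := h_generates hp pX.
  have [a aE] : inI (\det B * s * p).
    rewrite -mulrA E mulr_sumr; apply/inIS => i _.
    by rewrite mulrA mulrC; apply/inIM.
  exists (\det B * s); split; first by rewrite mevalM mulf_neq0.
  by exists a; rewrite aE subrr => y _; rewrite meval0.
(* For the independence of the gradients a vector [y] is built along which the equation of index
   [r0] has derivative 1 and the others in [R] have derivative 0. It is the basis vector of index
   [r0], corrected on the columns selected by [f] so as to lie in the kernel of [jac]. *)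
apply: inj_row_free => w w0; apply/rowP => a0; rewrite [RHS]mxE.
pose r0 := enum_val a0.
pose Bx' := rowsub f jac'^T.
have Bu : Bx' \in unitmx by apply: fullrowsub_unit.
pose z : 'rV[K]_n := - row r0 jac'^T *m invmx Bx'.
pose y : 'rV[K]_N := delta_mx 0 r0 + \sum_a z 0 a *: delta_mx 0 (f a).
have yR k : k \in R -> y 0 k = (k == r0)%:R.
  rewrite inE => /andP[_ fk]; rewrite !mxE eqxx summxE big1 ?addr0 // => a _.
  rewrite !mxE eqxx; case: eqP => [kf|_]; last by rewrite mulr0.
  by rewrite kf codom_f in fk.
have r0R : r0 \in R by apply: enum_valP.
have jacf k a : jac'^T (f a) k = Bx' a k by rewrite !mxE.
have yrep k : rep k = k -> y 0 k = 0.
  move=> rk; rewrite !mxE eqxx summxE; case: eqP => [kr|_].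
    by move: r0R; rewrite -kr inE rk eqxx.
  rewrite big1 ?addr0 // => a _; rewrite !mxE eqxx; case: eqP => [kf|]; rewrite ?mulr0 //.
  have := congr1 (fun A : 'M_n => A a a) (mulmxV Bu); rewrite /= [RHS]mxE eqxx mxE.
  rewrite big1 => [/eqP|j _]; first by rewrite eq_sym oner_eq0.
  by rewrite [Bx' a j]mxE !mxE -kf rk eqxx mul0r.
have yjac' : y *m jac'^T = 0.
  rewrite mulmxDl -rowE mulmx_suml.
  have -> : \sum_a (z 0 a *: delta_mx 0 (f a)) *m jac'^T = z *m Bx'.
    rewrite mulmx_sum_row; apply: eq_bigr => a _; rewrite -scalemxAl -rowE; congr (_ *: _).
    by apply/rowP => k; rewrite !mxE.
  by rewrite /z mulmxKV // addrN.
clearbody y.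
have yjac j : \sum_k jac j k * y 0 k = 0.
  have := congr1 (fun A : 'rV_n => A 0 j) yjac'; rewrite [LHS]mxE [RHS]mxE => E.
  rewrite -[RHS]E; apply: eq_bigr => k _; rewrite [in RHS]mxE [in RHS]mxE.
  by case: eqP => [/yrep ->|_]; rewrite ?mul0r ?mulr0 // mulrC.
pose delta p := differential p x y.
have dtau j : delta (tau j) * sg.@[x 0] = (tau j).@[x 0] * delta sg.
  apply/eqP; rewrite -subr_eq0 -[X in _ == X](yjac j) /delta /differential.
  rewrite mulr_suml mulr_sumr -sumrB; apply/eqP/eq_bigr => k _.
  by rewrite !mxE; ring.
(* [wt p k] says that p varies along [y] as sg^k does: p' / p = k sg' / sg. It holds for the tau_j
   with k = 1, hence for every [hat i] with the same k = D. These variations cancel in h_k and leave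
   y_k. *)
pose wt p k := delta p * sg.@[x 0] = p.@[x 0] * delta sg *+ k.
have wtM p q k l : wt p k -> wt q l -> wt (p * q) (k + l)%N.
  rewrite /wt /delta differentialM mevalM mulrDl mulrAC => -> E.
  by rewrite -mulrA E mulrnDr; congr (_ + _); rewrite -?mulrnAl -?mulrnAr; ring.
have wt1 : wt 1 0 by rewrite /wt /delta -mpolyC1 differentialC mul0r mulr0n.
have wtX p k m : wt p k -> wt (p ^+ m) (m * k)%N.
  move=> pk; elim: m => [|m IHm]; first by rewrite expr0 mul0n.
  by rewrite exprS mulSn; apply/wtM.
have wt_hat i : wt (hat i) D.
  rewrite /wt /hat /homogenize /delta differential_sum (raddf_sum (meval _)) !mulr_suml.
  rewrite -sumrMnl !big_seq; apply: eq_bigr => m mp /=.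
  rewrite differentialZ mevalZ -!mulrA -mulrnAr; congr (_ * _).
  suff : wt ((\prod_i tau i ^+ m i) * sg ^+ (D - mdeg m)) D by [].
  have mD : (mdeg m <= D)%N by rewrite ltnW // (leq_trans (msize_mdeg_lt mp)).
  rewrite -[X in wt _ X](subnKC mD); apply/wtM; last first.
    by rewrite -[X in wt _ X]muln1; apply/wtX; rewrite /wt mulrC.
  rewrite mdegE; elim/big_rec2: _ => // j k p _ pk; apply/wtM => //.
  by rewrite -[X in wt _ X]muln1; apply/wtX; apply: dtau.
have dh k : delta (h k) = y 0 k.
  apply: (mulfI (chart_den_neq0 ch)).
  have rr : rep (rep k) = rep k by apply: rep_block; exact: (rep_spec k).1.
  have := wt_hat k; have := wt_hat (rep k); rewrite /wt !hatx.
  rewrite /h /v /u /mu -scalerAl -scalerBr /delta differentialZ differentialB.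
  rewrite !differentialM !differentialXU !mevalXU !hatx (yrep _ rr) mul0r add0r.
  move: (differential _ _ _) (differential _ _ _) (differential sg x y) => A' A E EA EA'.
  have -> e : sg.@[x 0] * (c k * (A * x 0 k + e - x 0 (rep k) * A')) =
      c k * (A * sg.@[x 0] * x 0 k + e * sg.@[x 0] - x 0 (rep k) * (A' * sg.@[x 0])).
    by ring.
  rewrite EA EA' -!mulrnAr /c.
  move: (c0 k) (E *+ D); move: (_ ^+ D) (x 0 (rep k)) => S r Sr F.
  move: Sr; rewrite mulf_eq0 negb_or => /andP[S0 r0']; field.
  by rewrite S0 r0'.
have := congr1 (fun A : 'rV_N => (A *m y^T) 0 0) w0.
rewrite mul0mx [RHS]mxE -mulmxA mxE (bigD1 a0) //= big1 ?addr0 => [|a aa0].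
  rewrite mxE; under eq_bigr do rewrite [_ a0 _]mxE [y^T _ _]mxE.
  by rewrite -/(differential (g a0) x y) -/(delta _) dh yR // eqxx mulr1.
rewrite [(_ *m _) a 0]mxE; under eq_bigr do rewrite [_ a _]mxE [y^T _ _]mxE.
rewrite -/(differential (g a) x y) -/(delta _) dh yR ?enum_valP //.
by rewrite (inj_eq enum_val_inj) (negbTE aa0) mulr0.
Qed.

End ChartSmooth.

(** * Blow-ups and their charts *)

Definition block_degree (d : nat -> nat) (k l : nat) : nat :=
  if l is l'.+1 then d l' else k.

Section BlowupForms.
Variables (K : closedFieldType) (N m : nat) (b : 'I_N -> nat).
Implicit Types (p : {mpoly K[N]}) (z : 'rV[K]_(N + m.+1)).

Definition lift_form p : {mpoly K[N + m.+1]} :=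
  pullback (fun i => 'X_(lshift m.+1 i)) p.

Definition fiber_var (k : 'I_m.+1) : {mpoly K[N + m.+1]} := 'X_(rshift N k).

Lemma meval_lift p z : (lift_form p).@[z 0] = p.@[lsubmx z 0].
Proof.
by rewrite meval_pullback; apply: meval_eq => i; rewrite paramE mevalXU mxE.
Qed.

Lemma meval_fiber_var k z : (fiber_var k).@[z 0] = rsubmx z 0 k.
Proof. by rewrite mevalXU mxE. Qed.

Lemma blocks_ext_lshift i : blocks_ext b (m := m) (lshift m.+1 i) = (b i).+1.
Proof.
rewrite /blocks_ext; case: splitP => [j /= /ord_inj -> //|k /= e].
by have := ltn_ord i; rewrite e ltnNge leq_addr.
Qed.

Lemma blocks_ext_rshift k : blocks_ext b (m := m) (rshift N k) = 0%N.
Proof.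
rewrite /blocks_ext; case: splitP => [j /= e|//].
by have := ltn_ord j; rewrite -e ltnNge leq_addr.
Qed.

Lemma lift_homog d p : is_multihomog b d p ->
  is_multihomog (blocks_ext b (m := m)) (block_degree d 0) (lift_form p).
Proof.
move=> /multihomogP hp; apply/multihomogP => l c z; rewrite !meval_lift.
case: l => [|l] /=.
  rewrite mul1r; apply: meval_eq => i; rewrite !mxE.
  by rewrite blocks_ext_lshift.
rewrite -hp; apply: meval_eq => i; rewrite !mxE blocks_ext_lshift eqSS.
by case: ifP.
Qed.

Lemma fiber_var_homog k :
  is_multihomog (blocks_ext b (m := m)) (block_degree (fun=> 0%N) 1) (fiber_var k).
Proof.
apply: eq_multihomog (multihomogX _ _) => l; rewrite blocks_ext_rshift.
by case: l.
Qed.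

Lemma meval_fiber_scale d (F : {mpoly K[N + m.+1]}) (y : 'rV[K]_N) (w : 'rV[K]_m.+1) c :
  is_multihomog (blocks_ext b (m := m)) d F ->
  F.@[(row_mx y (c *: w)) 0] = c ^+ d 0%N * F.@[(row_mx y w) 0].
Proof.
move=> /multihomogP hF; rewrite -hF; apply: meval_eq => i; rewrite [RHS]mxE.
rewrite -[i]splitK; case: (split i) => j /=.
  by rewrite blocks_ext_lshift !row_mxEl.
by rewrite blocks_ext_rshift !row_mxEr mxE.
Qed.

Lemma is_point_ext z : is_point (blocks_ext b (m := m)) z <->
  is_point b (lsubmx z) /\ rsubmx z != 0.
Proof.
split=> [pz|[py /rV0Pn [k wk]] i].
  split=> [i|].
    have [j] := pz (lshift m.+1 i); rewrite blocks_ext_lshift -[j]splitK.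
    case: (split j) => j' /=; rewrite ?blocks_ext_lshift ?blocks_ext_rshift // => -[bj] zj.
    by exists j' => //; rewrite mxE.
  have [j] := pz (rshift N ord0); rewrite blocks_ext_rshift -[j]splitK.
  case: (split j) => j' /=; rewrite ?blocks_ext_lshift ?blocks_ext_rshift // => _ zj.
  by apply/rV0Pn; exists j'; rewrite mxE.
rewrite -[i]splitK; case: (split i) => i' /=.
  have [j bj yj] := py i'; exists (lshift m.+1 j); rewrite ?blocks_ext_lshift ?bj //.
  by move: yj; rewrite mxE.
by exists (rshift N k); rewrite ?blocks_ext_rshift //; move: wk; rewrite mxE.
Qed.

End BlowupForms.

Arguments lift_homog {K N} m {b d p} _.
Arguments fiber_var_homog K {N m} b k.

Section Blowup.
Variables (K : closedFieldType) (N m : nat) (b : 'I_N -> nat) (X : 'rV[K]_N -> Prop).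
Variables (g : 'I_m.+1 -> {mpoly K[N]}) (dg : nat -> nat).
Hypothesis hg : forall k, is_multihomog b dg (g k).
Hypothesis X_closed : forall y, X y <-> zclosure b X y.

Local Notation bX := (blocks_ext b (m := m)).
Local Notation BX := (blowup b X g).

Definition graph_map (i : 'I_(N + m.+1)) : {mpoly K[N]} :=
  match split i with inl j => 'X_j | inr k => g k end.

Lemma param_graph_map (y : 'rV[K]_N) : param graph_map (y 0) = row_mx y (\row_k (g k).@[y 0]).
Proof.
apply/rowP => i; rewrite paramE mxE /graph_map; case: (split i) => j.
  by rewrite mevalXU.
by rewrite mxE.
Qed.

Lemma graph_map_homog d F : is_multihomog bX d F ->
  is_multihomog b (fun l => d l.+1 + dg l * d 0)%N (pullback graph_map F).
Proof.
move=> hF; have /multihomogP hF' := hF; apply/multihomogP => l c y.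
rewrite !meval_pullback !param_graph_map.
have -> : \row_k (g k).@[scale_block b l c y 0] = c ^+ dg l *: \row_k (g k).@[y 0].
  by apply/rowP => k; rewrite !mxE; have /multihomogP -> := @hg k.
rewrite (meval_fiber_scale _ _ _ hF) exprD exprM -mulrA mulrCA; congr (_ * _).
rewrite -hF'; apply: meval_eq => i; rewrite [RHS]mxE -[i]splitK.
case: (split i) => j /=; last by rewrite blocks_ext_rshift !row_mxEr.
by rewrite blocks_ext_lshift !row_mxEl mxE eqSS.
Qed.

Lemma blowup_closed z : BX z <-> zclosure bX BX z.
Proof.
split=> [BXz|[pz hz]]; first by have [pz _] := BXz; split=> // d p _; apply.
split=> // d p hp pG; by apply: (hz _ _ hp) => y [_ hy]; apply: hy hp pG.
Qed.

Lemma graph_blowup z : graph b X g z -> BX z.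
Proof. by move=> Gz; have [pz _ _] := Gz; split=> // d p _; apply. Qed.

(** It suffices to test the points (y, g(y)): on the graph the fibre coordinates are a multiple of
    g(y), and the scalar comes out by homogeneity. *)
Lemma vanishes_blowup d F : is_multihomog bX d F ->
  vanishes_on X (pullback graph_map F) -> vanishes_on BX F.
Proof.
move=> hF FX y [_ hy]; apply: (hy _ _ hF) => {hy}z [_ Xz [c zE]].
rewrite -[z]hsubmxK zE (meval_fiber_scale _ _ _ hF) -param_graph_map.
by rewrite -meval_pullback FX // mulr0.
Qed.

Lemma blowup_lsubmx z : BX z -> X (lsubmx z).
Proof.
move=> [/is_point_ext [py _] hz]; apply/X_closed; split=> // d p hp pX.
rewrite -meval_lift; apply: (hz _ _ (lift_homog m hp)) => y [_ Xy _].
by rewrite meval_lift pX.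
Qed.

Lemma blowup_minors z k l : BX z ->
  rsubmx z 0 k * (g l).@[lsubmx z 0] = rsubmx z 0 l * (g k).@[lsubmx z 0].
Proof.
move=> BXz; pose F := fiber_var K N k * lift_form m (g l) - fiber_var K N l * lift_form m (g k).
have hF : is_multihomog bX (fun l => block_degree (fun=> 0%N) 1 l + block_degree dg 0 l)%N F.
  by apply: multihomogB; apply: multihomogM (fiber_var_homog _ _ _) (lift_homog _ (@hg _)).
have : F.@[z 0] = 0.
  apply: (vanishes_blowup hF) BXz => y Xy; rewrite meval_pullback param_graph_map.
  rewrite mevalB !mevalM !meval_fiber_var !meval_lift row_mxKl row_mxKr !mxE; ring.
by rewrite mevalB !mevalM !meval_fiber_var !meval_lift => /subr0_eq.
Qed.

Lemma blowup_off_base z l : BX z -> (g l).@[lsubmx z 0] != 0 ->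
  exists2 c, c != 0 & rsubmx z = c *: \row_k (g k).@[lsubmx z 0].
Proof.
move=> BXz gl; pose c := rsubmx z 0 l / (g l).@[lsubmx z 0].
have E : rsubmx z = c *: \row_k (g k).@[lsubmx z 0].
  apply/rowP => k; rewrite [RHS]mxE [X in _ * X]mxE /c mulrAC -(blowup_minors k l BXz) mulfK //.
exists c => //; have [/is_point_ext [_]] := BXz.
by rewrite E scaler_eq0 negb_or => /andP[].
Qed.

End Blowup.

Section BlowupChart.
Variables (K : closedFieldType) (n N m : nat) (b : 'I_N -> nat) (X : 'rV[K]_N -> Prop).
Variables (g : 'I_m.+1 -> {mpoly K[N]}) (dg : nat -> nat).
Hypothesis hg : forall k, is_multihomog b dg (g k).
Variables (psi : 'I_N -> {mpoly K[n]}) (t0 : 'I_n -> K).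
Variables (tau : 'I_n -> {mpoly K[N]}) (sg : {mpoly K[N]}) (dd : nat -> nat).
Variable z : 'rV[K]_(N + m.+1).
Hypothesis ch : chart b X (lsubmx z) psi t0 tau sg dd.
Hypothesis BXz : blowup b X g z.

Local Notation bX := (blocks_ext b (m := m)).
Local Notation BX := (blowup b X g).

Definition ext_param (sub : 'I_n -> {mpoly K[n]}) (omega : 'I_m.+1 -> {mpoly K[n]})
    (i : 'I_(N + m.+1)) : {mpoly K[n]} :=
  match split i with inl j => pullback sub (psi j) | inr k => omega k end.

Lemma param_ext sub omega t : param (ext_param sub omega) t =
  row_mx (param psi (param sub t 0)) (\row_k (omega k).@[t]).
Proof.
apply/rowP => i; rewrite paramE mxE /ext_param; case: (split i) => j.
  by rewrite paramE meval_pullback.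
by rewrite mxE.
Qed.

(** [sub] is the change of coordinates on the base, and the fibre coordinates [omega] are g up to
    the ratio rho / theta. Where theta, rho and the old denominator are nonzero and omega is not
    zero, the parametrized point lies on the graph. Conversely, a form vanishing on the parametrized
    points pulls back to zero along the graph map because [sub] is dominant. *)
Lemma chart_blowup sub omega theta rho t0' tau' sg' dd' :
  param sub t0' 0 =1 t0 -> (forall k, (omega k).@[t0'] = rsubmx z 0 k) ->
  theta != 0 -> rho != 0 ->
  (forall t k, theta.@[t] * (omega k).@[t] =
     rho.@[t] * (g k).@[param psi (param sub t 0) 0]) ->
  (forall q, pullback sub q = 0 -> q = 0) ->
  (forall i, is_multihomog bX dd' (tau' i)) -> is_multihomog bX dd' sg' ->
  sg'.@[z 0] != 0 ->
  (forall t i, (tau' i).@[param (ext_param sub omega) t 0] =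
     t i * sg'.@[param (ext_param sub omega) t 0]) ->
  (forall t, sg'.@[param (ext_param sub omega) t 0] != 0 ->
     sg.@[param psi (param sub t 0) 0] != 0 /\ exists k, (omega k).@[t] != 0) ->
  chart bX BX z (ext_param sub omega) t0' tau' sg' dd'.
Proof.
move=> sub0 om0 th0 rho0 omE sub_dom htau hsg sgz tauE sg_pt.
have pt0 : param psi (param sub t0' 0) = lsubmx z.
  rewrite -(chart_base ch); apply/rowP => i; rewrite !paramE.
  exact: meval_eq.
have pt t : sg.@[param psi (param sub t 0) 0] != 0 -> (exists k, (omega k).@[t] != 0) ->
    is_point bX (param (ext_param sub omega) t).
  move=> sgt [k okt]; apply/is_point_ext; rewrite param_ext row_mxKl row_mxKr; split.
    exact: chart_is_point ch _ sgt.
  by apply/rV0Pn; exists k; rewrite mxE.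
split=> //.
- rewrite param_ext pt0 -[RHS]hsubmxK; congr row_mx.
  by apply/rowP => k; rewrite mxE om0.
- by move=> t /sg_pt [? ?]; apply: pt.
- move=> d p hp; split=> [pB t|pB].
    have [/is_point_ext [_ /rV0Pn [k zk]] _] := BXz.
    rewrite -meval_pullback.
    suff -> : pullback (ext_param sub omega) p = 0 by rewrite meval0.
    pose q := theta * rho * pullback sub (pullback psi sg) * omega k.
    have q0 : q != 0.
      rewrite !mulf_neq0 //; apply: (@meval_neq0 _ _ _ t0'); last by rewrite om0.
      by rewrite !meval_pullback pt0 (chart_den_neq0 ch).
    apply: (meval_dense q0) => {}t; rewrite !mevalM !mulf_eq0 !negb_or !meval_pullback.
    move=> /andP[/andP[/andP[tht rhot] sgt] omt].
    apply/pB/graph_blowup; split; first by apply: pt => //; exists k.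
      by rewrite param_ext row_mxKl; apply: chart_mem ch _ sgt.
    exists (rho.@[t] / theta.@[t]); rewrite param_ext row_mxKr row_mxKl.
    by apply/rowP => j; rewrite !mxE mulrAC -omE mulrC mulrA mulVf ?mul1r.
  apply: (vanishes_blowup hp).
  have hG := graph_map_homog hg hp; apply/(chart_generic ch hG) => t.
  rewrite -meval_pullback.
  suff /sub_dom -> : pullback sub (pullback psi (pullback (graph_map g) p)) = 0.
    by rewrite meval0.
  have q0 : theta * rho != 0 by rewrite mulf_neq0.
  apply: (meval_dense q0) => {}t; rewrite mevalM mulf_eq0 negb_or => /andP[tht rhot].
  rewrite !meval_pullback param_graph_map.
  have -> : \row_k (g k).@[param psi (param sub t 0) 0] =
      (theta.@[t] / rho.@[t]) *: \row_k (omega k).@[t].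
    by apply/rowP => k; rewrite !mxE mulrAC omE mulrC mulrA mulVf ?mul1r.
  by rewrite (meval_fiber_scale _ _ _ hp) -param_ext pB mulr0.
exact: blowup_closed.
Qed.

Lemma pullback_id (p : {mpoly K[n]}) : pullback (fun i => 'X_i) p = p.
Proof. by rewrite /pullback comp_mpoly_id. Qed.

Lemma param_id (t : 'I_n -> K) : param (fun i => 'X_i) t 0 =1 t.
Proof. by move=> i; rewrite paramE mevalXU. Qed.

(** Off the common zeros of g the blow-up is an isomorphism. The constant [c] matches the given
    representative of the fibre coordinates. *)
Lemma chart_blowup_away l : (g l).@[lsubmx z 0] != 0 -> exists c : K,
  chart bX BX z (ext_param (fun i => 'X_i) (fun k => c *: pullback psi (g k))) t0
   (fun i => lift_form m (tau i) * fiber_var K N l) (lift_form m sg * fiber_var K N l)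
   (fun l => block_degree dd 0 l + block_degree (fun=> 0%N) 1 l)%N.
Proof.
move=> gl; have [c c0 zE] := blowup_off_base hg BXz gl.
have pid t : param psi (param (fun i => 'X_i) t 0) = param psi t.
  by apply/rowP => i; rewrite !paramE; apply/meval_eq/param_id.
exists c; apply: (@chart_blowup _ _ 1 c%:MP).
- exact: param_id.
- by move=> k; rewrite mevalZ meval_pullback (chart_base ch) zE !mxE.
- exact: oner_neq0.
- by rewrite mpolyC_eq0.
- by move=> t k; rewrite meval1 mul1r mevalZ mevalC meval_pullback pid.
- by move=> q; rewrite pullback_id.
- move=> i; apply: multihomogM (fiber_var_homog _ _ _).
  exact: lift_homog (chart_num_homog ch i).
- by apply: multihomogM (fiber_var_homog _ _ _); apply: lift_homog (chart_den_homog ch).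
- rewrite mevalM meval_lift meval_fiber_var mulf_neq0 ?(chart_den_neq0 ch) // zE !mxE.
  by rewrite mulf_neq0.
- move=> t i; rewrite !mevalM !meval_lift param_ext row_mxKl pid (chart_coord ch).
  by rewrite mulrA.
move=> t; rewrite mevalM meval_lift meval_fiber_var param_ext row_mxKl row_mxKr mxE.
by rewrite mulf_eq0 negb_or => /andP[? ?]; split=> //; exists l.
Qed.

End BlowupChart.

(** * Blowing up a coordinate subspace *)

Lemma multihomog_uniq (K : closedFieldType) n (b : 'I_n -> nat) d d' (p : {mpoly K[n]}) :
  p != 0 -> is_multihomog b d p -> is_multihomog b d' p -> d =1 d'.
Proof.
rewrite -msupp_eq0; case E: (msupp p) => [//|m r] _ hp hp' l.
by rewrite -(hp m) -?(hp' m) // E inE eqxx.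
Qed.

(** In a monomial of p each variable is replaced by one of the same factor that is nonzero at x. The
    result balances degrees without introducing a zero at the point. *)
Lemma exists_form_neq0 (K : closedFieldType) n (b : 'I_n -> nat) d (p : {mpoly K[n]}) x :
  p != 0 -> is_multihomog b d p -> is_point b x ->
  exists2 u : {mpoly K[n]}, is_multihomog b d u & u.@[x 0] != 0.
Proof.
rewrite -msupp_eq0; case E: (msupp p) => [//|m r] _ hp px.
have [f fb fx] := fin_all_exists2 px.
exists (\prod_i 'X_(f i) ^+ m i); last first.
  by rewrite rmorph_prod; apply/prodf_neq0 => i _; rewrite rmorphXn /= mevalXU expf_neq0.
apply/multihomogP => l c y; rewrite -(hp m) ?E ?inE ?eqxx // -prodrXr !rmorph_prod.
rewrite [X in X * _]big_mkcond -big_split; apply: eq_bigr => i _ /=.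
rewrite !rmorphXn /= !mevalXU mxE fb.
by case: ifP => _; rewrite ?exprMn ?mul1r.
Qed.

Definition kill n (K : closedFieldType) (S : pred 'I_n) (i : 'I_n) : {mpoly K[n]} :=
  if S i then 0 else 'X_i.

Lemma kill_coordinate_ideal n (K : closedFieldType) (S : pred 'I_n) (q : {mpoly K[n]}) :
  pullback (kill K S) q = 0 -> exists c, q = \sum_(i | S i) c i * 'X_i.
Proof.
move=> q0; have [c [E _]] := mpoly_difference q (fun i => 'X_i) (kill K S).
exists c; have -> : q = pullback (fun i => 'X_i) q - pullback (kill K S) q.
  by rewrite pullback_id q0 subr0.
rewrite E [RHS]big_mkcond.
by apply: eq_bigr => i _; rewrite /kill; case: ifP => _; rewrite ?subr0 ?subrr ?mul0r // mulrC.
Qed.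

Definition strict_transform (K : closedFieldType) N m (X : 'rV[K]_N -> Prop)
    (g : 'I_m.+1 -> {mpoly K[N]}) (s p : {mpoly K[N]}) (q : {mpoly K[N + m.+1]}) :=
  exists a : 'I_m.+1 -> {mpoly K[N]},
    vanishes_on X (s * p - \sum_k a k * g k) /\
    q = \sum_k lift_form m (a k) * fiber_var K N k.

Lemma strict_transform_graph (K : closedFieldType) N m (X : 'rV[K]_N -> Prop)
    (g : 'I_m.+1 -> {mpoly K[N]}) s p q z c :
  strict_transform X g s p q -> X (lsubmx z) ->
  rsubmx z = c *: \row_k (g k).@[lsubmx z 0] ->
  q.@[z 0] = c * (s.@[lsubmx z 0] * p.@[lsubmx z 0]).
Proof.
move=> [a [va ->]] Xz zE; have := va _ Xz; rewrite mevalB mevalM => /subr0_eq ->.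
rewrite !(raddf_sum (meval _)) mulr_sumr; apply: eq_bigr => k _ /=.
by rewrite !mevalM meval_lift meval_fiber_var zE !mxE; ring.
Qed.

Lemma strict_transform_graph_map (K : closedFieldType) N m (X : 'rV[K]_N -> Prop)
    (g : 'I_m.+1 -> {mpoly K[N]}) s p q y :
  strict_transform X g s p q -> X y ->
  q.@[row_mx y (\row_k (g k).@[y 0]) 0] = s.@[y 0] * p.@[y 0].
Proof.
move=> st Xy; rewrite (strict_transform_graph (c := 1) st) ?row_mxKl ?row_mxKr ?mul1r //.
by rewrite scale1r.
Qed.

Section BlowupAlong.
Variables (K : closedFieldType) (n N m : nat) (b : 'I_N -> nat) (X C : 'rV[K]_N -> Prop).
Variables (g : 'I_m.+1 -> {mpoly K[N]}) (dg : nat -> nat).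
Hypothesis hg : forall k, is_multihomog b dg (g k).
Variables (psi : 'I_N -> {mpoly K[n]}) (t0 : 'I_n -> K).
Variables (tau : 'I_n -> {mpoly K[N]}) (sg : {mpoly K[N]}) (dd : nat -> nat).
Variable z : 'rV[K]_(N + m.+1).
Hypothesis ch : chart b X (lsubmx z) psi t0 tau sg dd.
Hypothesis BXz : blowup b X g z.
Hypothesis gen : generates_at b X C g (lsubmx z).
Variable S : pred 'I_n.
Hypothesis tauC : forall i, S i -> vanishes_on C (tau i).
Variable gam : {mpoly K[n]}.
Hypothesis gam0 : exists2 t : 'I_n -> K, (forall i, S i -> t i = 0) & gam.@[t] != 0.
Hypothesis paramC : forall t, (forall i, S i -> t i = 0) ->
  sg.@[param psi t 0] != 0 -> gam.@[t] != 0 -> C (param psi t).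

Local Notation bX := (blocks_ext b (m := m)).
Local Notation BX := (blowup b X g).
Local Notation x := (lsubmx z).

Definition monoidal (e : 'I_n) (i : 'I_n) : {mpoly K[n]} :=
  if S i && (i != e) then 'X_i * 'X_e else 'X_i.

(** If t0 is off the subspace {t_i = 0, i in S}, some t_i serves as the unit [kap]. If it is on it,
    g_k o psi vanishes on the part of the subspace where sg and [gam] are nonzero; this part is
    dense, so g_k o psi lies in the ideal of the subspace. Membership in C is thus needed only
    generically. *)
Lemma center_equations : exists kap (c : 'I_m.+1 -> 'I_n -> {mpoly K[n]}),
  kap.@[t0] != 0 /\ forall k, kap * pullback psi (g k) = \sum_(i | S i) c k i * 'X_i.
Proof.
have [i /andP[Si ti]|tS] := pickP (fun i => S i && (t0 i != 0)).
  exists 'X_i, (fun k j => if j == i then pullback psi (g k) else 0).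
  rewrite mevalXU; split=> // k; rewrite (bigD1 i) //= eqxx big1 ?addr0 1?mulrC // => j.
  by case/andP => _ /negbTE ->; rewrite mul0r.
suff h k : exists c, pullback psi (g k) = \sum_(i | S i) c i * 'X_i.
  have [c cE] := fin_all_exists h.
  by exists 1, c; rewrite meval1 oner_neq0; split=> // k; rewrite mul1r.
apply: kill_coordinate_ideal.
have killE (t : 'I_n -> K) i : param (kill K S) t 0 i = if S i then 0 else t i.
  by rewrite paramE /kill; case: ifP => _; rewrite ?meval0 ?mevalXU.
have kill_fix (t : 'I_n -> K) : (forall i, S i -> t i = 0) -> param (kill K S) t 0 =1 t.
  by move=> t0S i; rewrite killE; case: ifP => // /t0S.
have q0 : pullback (kill K S) (pullback psi sg * gam) != 0.
  rewrite [pullback _ _]rmorphM mulf_neq0 //.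
    apply: (@meval_neq0 _ _ _ t0); rewrite meval_pullback (meval_eq _ (kill_fix _ _)).
      by rewrite meval_pullback (chart_base ch) (chart_den_neq0 ch).
    by move=> i Si; have := tS i; rewrite Si => /eqP.
  have [t t0S gt] := gam0; apply: (@meval_neq0 _ _ _ t).
  by rewrite meval_pullback (meval_eq _ (kill_fix _ t0S)).
apply: (meval_dense q0) => t; rewrite !meval_pullback mevalM mulf_eq0 negb_or.
rewrite !meval_pullback => /andP[st gt]; apply: gen.1; apply: paramC => // i Si.
by rewrite killE Si.
Qed.

Lemma blowup_center_neq0 : exists l, g l != 0.
Proof.
have [l gl|g0] := pickP (fun l => g l != 0); first by exists l.
have [_ hz] := BXz.
have h1 : is_multihomog bX (fun=> 0%N) (1 : {mpoly K[N + m.+1]}).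
  by rewrite -mpolyC1; apply: multihomogC.
suff : (1 : {mpoly K[N + m.+1]}).@[z 0] = 0 by rewrite meval1 => /eqP; rewrite oner_eq0.
apply: (hz _ _ h1) => y [/is_point_ext [_ /rV0Pn [k yk]] _ [c yE]].
by move: yk; rewrite yE !mxE; have /negbFE/eqP -> := g0 k; rewrite meval0 mulr0 eqxx.
Qed.

(** One multiplier [s], the product of the individual ones, gives all strict transforms the same
    degree and makes their ratios those of the tau_i. *)
Lemma common_strict_transforms : exists ds s (Q : 'I_n -> {mpoly K[N + m.+1]}),
  [/\ is_multihomog b ds s, s.@[x 0] != 0 & forall i, S i ->
   [/\ is_multihomog bX (block_degree (fun l => ds l + dd l - dg l)%N 1) (Q i),
       forall l, (dg l <= ds l + dd l)%N & strict_transform X g s (tau i) (Q i)]].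
Proof.
have nz i s : s.@[x 0] != 0 -> ~ vanishes_on X (s * tau i).
  move=> sx vs.
  have : pullback psi (s * tau i) = 0.
    apply: (@meval_dense _ _ _ (pullback psi sg)).
      apply: (@meval_neq0 _ _ _ t0).
      by rewrite meval_pullback (chart_base ch) (chart_den_neq0 ch).
    by move=> t; rewrite !meval_pullback => st; apply/vs/(chart_mem ch).
  have tauE : pullback psi (tau i) = 'X_i * pullback psi sg.
    apply: mpoly_fun_eq => t; rewrite mevalM mevalXU !meval_pullback.
    exact: chart_coord ch _ _.
  rewrite [pullback _ _]rmorphM /= -!/(pullback _ _) tauE; apply/eqP.
  rewrite !mulf_neq0 //; first 1 last.
  - by rewrite -msupp_eq0 msuppX.
  - apply: (@meval_neq0 _ _ _ t0).
    by rewrite meval_pullback (chart_base ch) (chart_den_neq0 ch).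
  - by apply: (@meval_neq0 _ _ _ t0); rewrite meval_pullback (chart_base ch).
have scX y (lam : 'I_(\max_(i < N) b i).+1 -> K) :
    (forall l, lam l != 0) -> X y -> X (scale_all lam y).
  exact: chart_scale_all ch _ _.
have h i : exists r : {mpoly K[N]} * ('I_m.+1 -> {mpoly K[N]}),
   r.1.@[x 0] != 0 /\ exists ds, is_multihomog b ds r.1 /\ (S i -> exists da,
    [/\ forall k, is_multihomog b da (r.2 k),
        forall l, (da l + dg l = ds l + dd l)%N &
        vanishes_on X (r.1 * tau i - \sum_k r.2 k * g k)]).
  have [Si|nSi] := boolP (S i); last first.
    exists (1, fun=> 0); rewrite meval1 oner_neq0; split=> //.
    by exists (fun=> 0%N); rewrite -mpolyC1; split=> //; apply: multihomogC.
  have [ds [da [s [a [hs sx ha dE va]]]]] :=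
    generates_at_homog scX gen hg (chart_num_homog ch i) (tauC Si) (nz i).
  by exists (s, a); split=> //; exists ds; split=> // _; exists da.
have [r rP] := fin_all_exists h; pose s := \prod_(i | S i) (r i).1.
have [ds hs] : exists ds, is_multihomog b ds s.
  by apply: multihomog_prod => i _; have [_ [d [? _]]] := rP i; exists d.
have sx : s.@[x 0] != 0.
  by rewrite rmorph_prod; apply/prodf_neq0 => i _; have [] := rP i.
pose co i := \prod_(j | S j && (j != i)) (r j).1.
exists ds, s, (fun i => \sum_k lift_form m ((r i).2 k * co i) * fiber_var K N k).
split=> // i Si; have [_ [di [hi /(_ Si) [da [ha dE va]]]]] := rP i.
have [dc hc] : exists dc, is_multihomog b dc (co i).
  by apply: multihomog_prod => j _; have [_ [d [? _]]] := rP j; exists d.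
have sE : s = (r i).1 * co i by rewrite /s (bigD1 i).
have dsE l : (ds l = di l + dc l)%N.
  have hs' : is_multihomog b (fun l => di l + dc l)%N s by rewrite sE; apply: multihomogM.
  exact: multihomog_uniq (meval_neq0 sx) hs hs' l.
have dE' l : (da l + dc l + dg l = ds l + dd l)%N.
  by rewrite dsE addnAC dE addnAC.
split.
- apply: multihomog_sum => k _.
  apply: eq_multihomog (multihomogM (lift_homog m (multihomogM (@ha k) hc)) (fiber_var_homog K b k)).
  by case=> [|l] //=; rewrite addn0 -dE' addnK.
- by move=> l; rewrite -dE' leq_addl.
exists (fun k => (r i).2 k * co i); split=> // y Xy.
rewrite -[RHS](mul0r (co i).@[y 0]) -(va y Xy) -mevalM; congr meval.
by rewrite mulrBl mulr_suml sE mulrAC; congr (_ - _); apply: eq_bigr => k _; rewrite mulrAC.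
Qed.

(** Up to units at the point, the tau_i with i in S are combinations of the g_k and conversely. The
    first fact defines the Q_i from the fibre coordinates; the second recovers the fibre coordinates
    from the Q_i, so that some Q_e is nonzero at z. *)
Lemma chart_blowup_center : exists e ds s (Q : 'I_n -> {mpoly K[N + m.+1]})
    (omega : 'I_m.+1 -> {mpoly K[n]}) rho t0' dd',
  [/\ S e, is_multihomog b ds s /\ s.@[x 0] != 0,
      forall i, S i -> (exists d, is_multihomog bX d (Q i)) /\
                       strict_transform X g s (tau i) (Q i),
      (Q e).@[z 0] != 0 /\ (forall k, 'X_e * omega k =
         rho * pullback (monoidal e) (pullback psi (g k)))
    & chart bX BX z (ext_param psi (monoidal e) omega) t0'
       (fun i => if S i && (i != e) then lift_form m sg * Q i else lift_form m (tau i) * Q e)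
       (lift_form m sg * Q e) dd'].
Proof.
have [kap [c [kap0 cE]]] := center_equations.
have [ds [s [Q [hs sx QP]]]] := common_strict_transforms.
have [l gl] := blowup_center_neq0.
have Xx : X x by exact: chart_base_mem ch.
have [u hu ux] := exists_form_neq0 gl (@hg l) (chart_base_is_point ch).
have sgx := chart_den_neq0 ch.
have hsg := chart_den_homog ch.
have xE i : (tau i).@[x 0] = t0 i * sg.@[x 0] by exact: chart_base_coord ch i.
have X_closed := chart_closed ch.
(* The relation expressing g_k through the tau_i, homogenized and multiplied by [s], becomes on the
   graph a relation between fibre coordinates and the Q_i, and extends to z. The form [u]
   compensates the degree of g_k. *)
have zE k : rsubmx z 0 k =
    (kap.@[t0] * sg.@[x 0] * s.@[x 0])^-1 * \sum_(i | S i) (c k i).@[t0] * (Q i).@[z 0].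
  pose nu := kap * pullback psi u.
  pose D := (msize nu + \sum_(i < n) msize (c k i))%N.
  have nuD : (msize nu <= D)%N by rewrite leq_addr.
  have cD i : (msize (c k i) <= D)%N.
    by apply: leq_trans (leq_addl _ _); rewrite (bigD1 i) //= leq_addr.
  clearbody D.
  pose nuh := homogenize tau sg D nu; pose ch' i := homogenize tau sg D (c k i).
  have hh v : (msize v <= D)%N -> is_multihomog b (fun l => D * dd l)%N (homogenize tau sg D v).
    by move=> vD; apply: homogenize_multihomog => //; exact: chart_num_homog ch.
  have star : vanishes_on X (nuh * sg * g k - u * \sum_(i | S i) ch' i * tau i).
    pose d' l := (D * dd l + dd l + dg l)%N.
    have hd' : is_multihomog b d' (nuh * sg * g k - u * \sum_(i | S i) ch' i * tau i).
      apply: multihomogB; first exact: multihomogM (multihomogM (hh _ nuD) hsg) (@hg k).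
      have hS : is_multihomog b (fun l => D * dd l + dd l)%N (\sum_(i | S i) ch' i * tau i).
        apply: multihomog_sum => i _.
        exact: multihomogM (hh _ (cD i)) (chart_num_homog ch i).
      by apply: eq_multihomog (multihomogM hu hS) => l'; rewrite addnC.
    apply/(chart_generic ch hd') => t; have tE := chart_coord ch t.
    rewrite mevalB !mevalM (meval_homogenize nuD tE) mevalM meval_pullback.
    rewrite (raddf_sum (meval _)) /=.
    have -> : \sum_(i | S i) (ch' i * tau i).@[param psi t 0] =
        sg.@[param psi t 0] ^+ D * sg.@[param psi t 0] *
        (kap.@[t] * (g k).@[param psi t 0]).
      have := congr1 (meval t) (cE k); rewrite mevalM meval_pullback => ->.
      rewrite (raddf_sum (meval _)) mulr_sumr; apply: eq_bigr => i _ /=.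
      by rewrite !mevalM mevalXU tE (meval_homogenize (cD i) tE); ring.
    by ring.
  pose F := lift_form m (nuh * sg * s) * fiber_var K N k
            - lift_form m u * \sum_(i | S i) lift_form m (ch' i) * Q i.
  have hF : is_multihomog bX (block_degree (fun l => D * dd l + dd l + ds l)%N 1) F.
    apply: multihomogB.
      have h1 := multihomogM (lift_homog m (multihomogM (multihomogM (hh _ nuD) hsg) hs))
        (fiber_var_homog K b k).
      by apply: eq_multihomog h1; case=> [|l'] //=; rewrite addn0.
    rewrite mulr_sumr; apply: multihomog_sum => i Si; have [hQ le _] := QP i Si.
    have h1 := multihomogM (lift_homog m hu) (multihomogM (lift_homog m (hh _ (cD i))) hQ).
    by apply: eq_multihomog h1; case=> [|l'] //=; rewrite addnCA subnKC // [(_ + dd _)%N]addnC addnA.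
  have : F.@[z 0] = 0.
    apply: (vanishes_blowup hF) BXz => y Xy; rewrite meval_pullback param_graph_map.
    rewrite mevalB !mevalM meval_fiber_var !meval_lift row_mxKl row_mxKr.
    rewrite (raddf_sum (meval _)) /=.
    have -> : \sum_(i | S i) (lift_form m (ch' i) * Q i).@[row_mx y (\row_j (g j).@[y 0]) 0] =
        s.@[y 0] * (\sum_(i | S i) ch' i * tau i).@[y 0].
      rewrite (raddf_sum (meval (y 0))) mulr_sumr; apply: eq_bigr => i Si /=.
      have [_ _ st] := QP i Si.
      by rewrite !mevalM meval_lift row_mxKl (strict_transform_graph_map st Xy); ring.
    have := star y Xy; rewrite mevalB !mevalM [_ 0 k]mxE => /subr0_eq E.
    by rewrite mulrCA -E; ring.
  rewrite /F mevalB !mevalM meval_fiber_var !meval_lift !mevalM.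
  rewrite (raddf_sum (meval (z 0))) /=.
  under eq_bigr do rewrite mevalM meval_lift (meval_homogenize (cD _) xE) -mulrA.
  rewrite -mulr_sumr (meval_homogenize nuD xE) mevalM meval_pullback (chart_base ch).
  have := expf_neq0 D sgx; move: (_ ^+ D) (\sum_(i | _) _) => sD sm sD0 /subr0_eq E.
  set a := kap.@[t0] * _ * _; have a0 : a != 0 by rewrite !mulf_neq0.
  apply: (mulfI (mulf_neq0 (mulf_neq0 sD0 ux) a0)).
  transitivity (u.@[x 0] * (sD * sm)); first by rewrite -E /a; ring.
  by rewrite -[RHS]mulrA mulVKf //; ring.
have [e /andP[Se Qe]] : exists e, S e && ((Q e).@[z 0] != 0).
  apply/existsP; apply: contraT; rewrite negb_exists => /forallP Q0.
  have [/is_point_ext [_ /rV0Pn [k /eqP zk]] _] := BXz; case: zk.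
  rewrite zE big1 ?mulr0 // => i Si; have := Q0 i; rewrite Si /= negbK => /eqP ->.
  by rewrite mulr0.
(* Q_i tau_e = Q_e tau_i holds on the graph, hence on the blow-up; it ensures that the new base
   point [t0'] lies over t0. *)
have ratio i : S i -> (Q i).@[z 0] * t0 e = (Q e).@[z 0] * t0 i.
  move=> Si; have [hQi _ sti] := QP i Si; have [hQe _ ste] := QP e Se.
  pose F := Q i * lift_form m (tau e) - Q e * lift_form m (tau i).
  have hF := multihomogB (multihomogM hQi (lift_homog m (chart_num_homog ch e)))
                         (multihomogM hQe (lift_homog m (chart_num_homog ch i))).
  have : F.@[z 0] = 0.
    apply: (vanishes_blowup hF) BXz => y Xy; rewrite meval_pullback param_graph_map.
    rewrite mevalB !mevalM !meval_lift row_mxKl.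
    by rewrite (strict_transform_graph_map sti Xy) (strict_transform_graph_map ste Xy); ring.
  rewrite /F mevalB !mevalM !meval_lift !xE !mulrA => /subr0_eq /(mulIf sgx) //.
(* This scalar makes [omega] at [t0'] equal, and not only proportional, to the fibre coordinates of
   z. *)
pose C0 := (Q e).@[z 0] / (kap.@[t0] * sg.@[x 0] * s.@[x 0]).
have C00 : C0 != 0 by rewrite !mulf_neq0 ?invr_neq0 ?mulf_neq0.
pose y i : {mpoly K[n]} := if i == e then 1 else 'X_i.
pose omega k := C0 *: \sum_(i | S i) pullback (monoidal e) (c k i) * y i.
pose rho := C0 *: pullback (monoidal e) kap.
pose t0' i := if S i && (i != e) then (Q i).@[z 0] / (Q e).@[z 0] else t0 i.
have monoidalE i : S i -> monoidal e i = 'X_e * y i.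
  by rewrite /monoidal /y => ->; case: eqP => [->|_]; rewrite ?mulr1 //= mulrC.
have omE k : 'X_e * omega k = rho * pullback (monoidal e) (pullback psi (g k)).
  have -> : rho * pullback (monoidal e) (pullback psi (g k)) =
      C0 *: pullback (monoidal e) (kap * pullback psi (g k)).
    by rewrite /rho -scalerAl [in RHS]/pullback rmorphM.
  rewrite cE /omega -scalerAr /pullback (raddf_sum (comp_mpoly _)) mulr_sumr; congr (_ *: _).
  apply: eq_bigr => i Si /=; rewrite rmorphM /= comp_mpolyXU -tnth_nth tnth_mktuple.
  by rewrite monoidalE // mulrCA.
have t0'E : param (monoidal e) t0' 0 =1 t0.
  move=> i; rewrite paramE /monoidal /t0'; case: ifP => [/andP[Si ie]|nSi].
    by rewrite mevalM !mevalXU Si ie eqxx andbF /= mulrAC ratio // mulrC mulKf.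
  by rewrite mevalXU nSi.
have yE t i : (y i).@[t] = if i == e then 1 else t i.
  by rewrite /y; case: eqP => _; rewrite ?meval1 ?mevalXU.
have subE t i : param (monoidal e) t 0 i = if S i && (i != e) then t i * t e else t i.
  by rewrite paramE /monoidal; case: ifP => _; rewrite ?mevalM !mevalXU.
have omEt t k : t e * (omega k).@[t] =
    rho.@[t] * (g k).@[param psi (param (monoidal e) t 0) 0].
  by have /(congr1 (meval t)) := omE k; rewrite !mevalM mevalXU !meval_pullback.
have Xe0 : 'X_e != 0 :> {mpoly K[n]} by rewrite -msupp_eq0 msuppX.
have rho0 : rho != 0.
  apply: (@meval_neq0 _ _ _ t0'); rewrite mevalZ meval_pullback (meval_eq _ t0'E).
  by rewrite mulf_neq0.
(* In the chart Q_i is Q_e times [y i]. Only the product with X_e can be computed from the graph;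
   X_e is then cancelled as a polynomial, which covers the exceptional divisor t_e = 0. *)
have QE t i : S i -> (Q i).@[param (ext_param psi (monoidal e) omega) t 0] =
    rho.@[t] * (s.@[param psi (param (monoidal e) t 0) 0] *
      sg.@[param psi (param (monoidal e) t 0) 0]) * (y i).@[t].
  move=> Si; have [_ _ [a [va ->]]] := QP i Si.
  pose qa k := pullback (monoidal e) (pullback psi (a k)) * omega k.
  pose qb := rho * pullback (monoidal e) (pullback psi (s * sg)) * y i.
  have -> : (\sum_k lift_form m (a k) * fiber_var K N k).@[
      param (ext_param psi (monoidal e) omega) t 0] = (\sum_k qa k).@[t].
    rewrite !(raddf_sum (meval _)); apply: eq_bigr => k _ /=.
    rewrite !mevalM meval_lift meval_fiber_var param_ext row_mxKl row_mxKr mxE.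
    by rewrite !meval_pullback.
  suff -> : \sum_k qa k = qb by rewrite !mevalM !meval_pullback mevalM.
  apply: (mulfI Xe0); apply: mpoly_fun_eq => {}t.
  suff : ('X_e * \sum_k qa k - 'X_e * qb) = 0 by move=> /subr0_eq ->.
  have q0 : pullback (monoidal e) (pullback psi sg) != 0.
    apply: (@meval_neq0 _ _ _ t0'); rewrite meval_pullback (meval_eq _ t0'E).
    by rewrite meval_pullback (chart_base ch).
  apply: (meval_dense q0) => {}t; rewrite !meval_pullback => sgt.
  have := va _ (chart_mem ch sgt); rewrite mevalB (raddf_sum (meval _)) /= => /subr0_eq E.
  rewrite mevalB mevalM mevalXU (raddf_sum (meval t)) mulr_sumr /=.
  have -> : \sum_k t e * (qa k).@[t] =
      rho.@[t] * \sum_k (a k * g k).@[param psi (param (monoidal e) t 0) 0].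
    rewrite mulr_sumr; apply: eq_bigr => k _; rewrite !mevalM !meval_pullback.
    by rewrite mulrCA omEt; ring.
  rewrite -E /qb !mevalM !meval_pullback mevalM mevalXU (chart_coord ch) subE Si yE /=.
  by case: eqP => [->|_] /=; ring.
exists e, ds, s, Q, omega, rho, t0'.
have [hQe le ste] := QP e Se.
pose dq := block_degree (fun l => ds l + dd l - dg l)%N 1.
exists (fun l => block_degree dd 0 l + dq l)%N; split=> //.
- by move=> i /QP [h _ st]; split=> //; exists dq.
apply: (chart_blowup hg ch BXz t0'E _ Xe0 rho0).
- move=> k; rewrite zE /omega mevalZ (raddf_sum (meval t0')) /= /C0.
  move: (kap.@[t0] * _ * _)^-1 => iA; rewrite -mulrA mulrCA.
  congr (_ * _); rewrite mulr_sumr; apply: eq_bigr => i Si /=.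
  rewrite mevalM meval_pullback (meval_eq _ t0'E) yE /t0' Si /= mulrCA; congr (_ * _).
  by case: eqP => [->|_] /=; rewrite ?mulr1 // mulrC divfK.
- by move=> t k; rewrite mevalXU omEt.
- move=> q q0; apply: (meval_dense Xe0) => t; rewrite mevalXU => te.
  have := congr1 (meval (fun i => if S i && (i != e) then t i / t e else t i)) q0.
  rewrite meval0 meval_pullback => <-; apply: meval_eq => i.
  rewrite subE eqxx andbF; case: (S i && (i != e)) => //.
  by rewrite divfK.
- move=> i; case: ifP => [/andP[Si _]|_]; last first.
    exact: multihomogM (lift_homog m (chart_num_homog ch i)) hQe.
  by have [hQi _ _] := QP i Si; apply: multihomogM (lift_homog m hsg) hQi.
- exact: multihomogM (lift_homog m hsg) hQe.
- by rewrite mevalM meval_lift mulf_neq0.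
- move=> t i; case: ifP => [/andP[Si ie]|nSi].
    rewrite !mevalM !meval_lift !QE // !yE eqxx (negbTE ie); ring.
  rewrite !mevalM !meval_lift param_ext row_mxKl (chart_coord ch) subE nSi.
  by rewrite mulrA.
move=> t; rewrite mevalM meval_lift param_ext row_mxKl mulf_eq0 negb_or -param_ext.
move=> /andP[sgt Qt]; split=> //; apply/existsP; apply: contraT; rewrite negb_exists.
move=> /forallP om0; case/eqP: Qt; have [_ _ [a [_ ->]]] := QP e Se.
rewrite (raddf_sum (meval _)) big1 // => k _ /=; rewrite mevalM meval_fiber_var.
by rewrite param_ext row_mxKr mxE; have := om0 k; rewrite negbK => /eqP ->; rewrite mulr0.
Qed.

End BlowupAlong.

(** * Charts of the space of matrices *)

Lemma ord4_ind (P : 'I_4 -> Prop) : P 0 -> P 1 -> P 2 -> P 3 -> forall i, P i.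
Proof.
move=> P0 P1 P2 P3 [[|[|[|[|//]]]] lt].
- by rewrite (_ : Ordinal lt = 0) //; apply: val_inj.
- by rewrite (_ : Ordinal lt = 1) //; apply: val_inj.
- by rewrite (_ : Ordinal lt = 2) //; apply: val_inj.
by rewrite (_ : Ordinal lt = 3) //; apply: val_inj.
Qed.

(* Row i of a 4 x 4 matrix is indexed by (s, t) in {0, 1}^2, i = 2 s + t. *)
Definition flip_t (i : 'I_4) : 'I_4 := nth 0 [:: 1; 0; 3; 2] i.
Definition flip_s (i : 'I_4) : 'I_4 := nth 0 [:: 2; 3; 0; 1] i.
Definition flip_st (i : 'I_4) : 'I_4 := nth 0 [:: 3; 2; 1; 0] i.
Definition s_index (i : 'I_4) : 'I_2 := nth 0 [:: 0; 0; 1; 1] i.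
Definition t_index (i : 'I_4) : 'I_2 := nth 0 [:: 0; 1; 0; 1] i.
Definition row_sign (R : pzRingType) (i : 'I_4) : R := nth 0 [:: 1; -1; -1; 1] i.

(** A 2 x 2 determinant can be expanded from any of its four entries up to sign, so every row can
    serve as the pivot row [i0]. *)
Lemma quad_row (R : comPzRingType) (v : 'I_4 -> R) i :
  v 0 * v 3 - v 1 * v 2 =
  row_sign R i * (v i * v (flip_st i) - v (flip_t i) * v (flip_s i)).
Proof.
elim/ord4_ind: i; rewrite /row_sign /=; ring.
Qed.

Lemma flip_neq i : [/\ (flip_t i == i) = false, (flip_s i == i) = false,
  (flip_st i == i) = false & [/\ (flip_s i == flip_t i) = false,
  (flip_st i == flip_t i) = false & (flip_st i == flip_s i) = false]].
Proof. by elim/ord4_ind: i. Qed.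

Lemma flip_ind (P : 'I_4 -> Prop) i0 :
  P i0 -> P (flip_t i0) -> P (flip_s i0) -> P (flip_st i0) -> forall i, P i.
Proof.
elim/ord4_ind: i0; rewrite /flip_t /flip_s /flip_st /= => P0 P1 P2 P3;
  by apply: ord4_ind.
Qed.

Lemma index_flip i : [/\ s_index (flip_t i) = s_index i,
  t_index (flip_s i) = t_index i, s_index (flip_st i) = s_index (flip_s i)
  & t_index (flip_st i) = t_index (flip_t i)].
Proof. by elim/ord4_ind: i. Qed.

Section ChartEntries.
Variables (R : comNzRingType) (i0 c : 'I_4) (T : 'I_15 -> R).

(* The coordinates [T] are delta (0), rho_j (1-3), p_j (4-6), q_j (7-9), a (10), b (11) and
   m_j (12-14), with j running over the columns other than [c]; in column [c] they are
   completed by m = 1, p = q = 0 and rho = 2 delta. *)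
Definition at_col (none : R) (off : nat) (j : 'I_4) : R :=
  if unlift c j is Some k then T (inord (off + k)) else none.

Definition m_ := at_col 1 12.
Definition p_ := at_col 0 4.
Definition q_ := at_col 0 7.
Definition r_ := at_col (T (inord 0) *+ 2) 1.
Definition delta_ := T (inord 0).
Definition a_ := T (inord 10).
Definition b_ := T (inord 11).

Definition entry (i j : 'I_4) : R :=
  if i == i0 then m_ j else if i == flip_t i0 then a_ * m_ j + p_ j
  else if i == flip_s i0 then b_ * m_ j + q_ j
  else (a_ * b_ - delta_) * m_ j + a_ * q_ j + b_ * p_ j + r_ j.

Lemma entry_row : [/\ entry i0 =1 m_, entry (flip_t i0) =1 (fun j => a_ * m_ j + p_ j),
  entry (flip_s i0) =1 (fun j => b_ * m_ j + q_ j) &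
  entry (flip_st i0) =1 (fun j => (a_ * b_ - delta_) * m_ j + a_ * q_ j + b_ * p_ j + r_ j)].
Proof.
have [e1 e2 e3 [e4 e5 e6]] := flip_neq i0.
by split=> j; rewrite /entry ?eqxx ?e1 ?e2 ?e3 ?e4 ?e5 ?e6.
Qed.

Lemma at_col_c none off : at_col none off c = none.
Proof. by rewrite /at_col unlift_none. Qed.

Lemma at_col_lift none off k : at_col none off (lift c k) = T (inord (off + k)).
Proof. by rewrite /at_col liftK. Qed.

End ChartEntries.

Lemma at_col_morph (R R' : comNzRingType) (h : R -> R') c (T : 'I_15 -> R) none off j :
  h (at_col c T none off j) = at_col c (h \o T) (h none) off j.
Proof. by rewrite /at_col; case: (unlift c j). Qed.

Lemma entry_morph (R R' : comNzRingType) (h : {rmorphism R -> R'}) i0 c T i j :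
  h (entry i0 c T i j) = entry i0 c (h \o T) i j.
Proof.
rewrite /entry /m_ /p_ /q_ /r_ /a_ /b_ /delta_.
by do 3?[case: ifP => _]; rewrite ?rmorphD ?rmorphM ?rmorphB ?rmorphM ?at_col_morph
  ?rmorph1 ?rmorph0 ?rmorphMn.
Qed.

Section BaseChart.
Variables (K : closedFieldType) (i0 c : 'I_4).
Local Notation i1 := (flip_t i0).
Local Notation i2 := (flip_s i0).
Local Notation i3 := (flip_st i0).

Definition entry_form (i j : 'I_4) : {mpoly K[4 * 4]} := 'X_(mxvec_index i j).
Local Notation xv := entry_form.

Lemma meval_entry_form i j (x : 'rV[K]_(4 * 4)) : (xv i j).@[x 0] = vec_mx x i j.
Proof. by rewrite mevalXU mxE. Qed.

(* The numerators, over the common denominator M_(i0 c)^2, of the coordinates of [M]. *)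
Definition coord_val (R : comNzRingType) (M : 'I_4 -> 'I_4 -> R) (k : 'I_15) : R :=
  if (k < 1)%N then M i0 c * M i3 c - M i1 c * M i2 c
  else if (k < 4)%N then let j := lift c (inord (k - 1)) in
    M i0 c * M i3 j + M i0 j * M i3 c - M i1 c * M i2 j - M i1 j * M i2 c
  else if (k < 7)%N then let j := lift c (inord (k - 4)) in M i0 c * M i1 j - M i1 c * M i0 j
  else if (k < 10)%N then let j := lift c (inord (k - 7)) in M i0 c * M i2 j - M i2 c * M i0 j
  else if (k < 11)%N then M i0 c * M i1 c
  else if (k < 12)%N then M i0 c * M i2 c
  else let j := lift c (inord (k - 12)) in M i0 c * M i0 j.

Definition base_num (k : 'I_15) : {mpoly K[4 * 4]} := coord_val entry_form k.
Definition base_den : {mpoly K[4 * 4]} := xv i0 c * xv i0 c.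
(** The scalar [z0] is the pivot entry of a given representative, because [chart_base] is an
    equality of coordinate vectors and not only of points. *)
Definition base_param (z0 : K) (I : 'I_(4 * 4)) : {mpoly K[15]} :=
  z0 *: mxvec (\matrix_(i, j) entry i0 c (fun k => 'X_k : {mpoly K[15]}) i j) 0 I.

Lemma vec_base_param z0 (t : 'I_15 -> K) :
  vec_mx (param (base_param z0) t) = z0 *: \matrix_(i, j) entry i0 c t i j.
Proof.
apply/matrixP => i j; rewrite mxE paramE /base_param mevalZ mxvecE !mxE; congr (_ * _).
rewrite [LHS]entry_morph /entry /m_ /p_ /q_ /r_ /a_ /b_ /delta_ /at_col /=.
by rewrite !mevalXU; case: (unlift c j) => [k|] //=; rewrite !mevalXU.
Qed.

Lemma vec_base_paramE z0 (t : 'I_15 -> K) i j :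
  vec_mx (param (base_param z0) t) i j = z0 * entry i0 c t i j.
Proof. by rewrite vec_base_param 2!mxE. Qed.

Lemma eq_coord_val (R : comNzRingType) (M M' : 'I_4 -> 'I_4 -> R) k :
  (forall i j, M i j = M' i j) -> coord_val M k = coord_val M' k.
Proof. by move=> e; rewrite /coord_val !e. Qed.

Lemma meval_coord_val (M : 'I_4 -> 'I_4 -> {mpoly K[4 * 4]}) v k :
  (coord_val M k).@[v] = coord_val (fun i j => (M i j).@[v]) k.
Proof.
rewrite /coord_val; do 6?[case: ifP => _]; by rewrite ?mevalB ?mevalD ?mevalM // ?mevalB ?mevalD ?mevalM.
Qed.

Lemma coord_ind (P : 'I_15 -> Prop) :
  P (inord 0) -> (forall k : 'I_3, P (inord (1 + k))) ->
  (forall k : 'I_3, P (inord (4 + k))) -> (forall k : 'I_3, P (inord (7 + k))) ->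
  P (inord 10) -> P (inord 11) -> (forall k : 'I_3, P (inord (12 + k))) ->
  forall k, P k.
Proof.
move=> P0 P1 P4 P7 P10 P11 P12 k; rewrite -(inord_val k).
have shift off : (off <= k)%N -> (k < off + 3)%N -> (forall i : 'I_3, P (inord (off + i))) ->
    P (inord k).
  move=> ok ko /(_ (inord (k - off))); rewrite inordK ?subnKC //.
  by rewrite ltn_subLR // addnC.
have [k1|k1] := ltnP k 1; first by move: k1; rewrite ltnS leqn0 => /eqP ->.
have [k4|k4] := ltnP k 4; first exact: shift P1.
have [k7|k7] := ltnP k 7; first exact: shift P4.
have [k10|k10] := ltnP k 10; first exact: shift P7.
move: k10; rewrite leq_eqVlt => /orP[/eqP <- //|k10].
move: k10; rewrite leq_eqVlt => /orP[/eqP <- //|k11].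
by apply: shift P12.
Qed.

Lemma coord_valE (R : comNzRingType) (M : 'I_4 -> 'I_4 -> R) :
  [/\ coord_val M (inord 0) = M i0 c * M i3 c - M i1 c * M i2 c,
      coord_val M (inord 10) = M i0 c * M i1 c,
      coord_val M (inord 11) = M i0 c * M i2 c &
   forall k : 'I_3, let j := lift c k in
   [/\ coord_val M (inord (1 + k)) =
          M i0 c * M i3 j + M i0 j * M i3 c - M i1 c * M i2 j - M i1 j * M i2 c,
       coord_val M (inord (4 + k)) = M i0 c * M i1 j - M i1 c * M i0 j,
       coord_val M (inord (7 + k)) = M i0 c * M i2 j - M i2 c * M i0 j &
       coord_val M (inord (12 + k)) = M i0 c * M i0 j]].
Proof.
split; rewrite /coord_val ?inordK // => k; have k3 := ltn_ord k.
have lt off : (off <= 12)%N -> (off + k < 15)%N.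
  by move=> o12; apply: (@leq_ltn_trans (12 + k)); rewrite ?leq_add2r // -[15%N]/(12 + 3)%N ltn_add2l.
rewrite !inordK ?lt // !addKn !inord_val.
have n1 m off : (m <= off)%N -> (off + k < m)%N = false.
  by move=> mo; apply/negbTE; rewrite -leqNgt (leq_trans mo) ?leq_addr.
have n2 m off : (off + 3 <= m)%N -> (off + k < m)%N = true.
  by move=> mo; apply: leq_trans mo; rewrite ltn_add2l.
rewrite (n1 1%N 1%N) // (n2 4%N 1%N) // (n1 1%N 4%N) // (n1 4%N 4%N) // (n2 7%N 4%N) //.
rewrite (n1 1%N 7%N) // (n1 4%N 7%N) // (n1 7%N 7%N) // (n2 10%N 7%N) // (n1 1%N 12%N) //.
Qed.

Lemma coord_val_entry (R : comNzRingType) (T : 'I_15 -> R) (z0 : R) k :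
  coord_val (fun i j => z0 * entry i0 c T i j) k = T k * (z0 * z0).
Proof.
have [E0 E1 E2 E3] := entry_row i0 c T.
have [C0 C10 C11 Ck] := coord_valE (fun i j => z0 * entry i0 c T i j).
elim/coord_ind: k => [|k|k|k|||k].
- rewrite C0 !E0 !E1 !E2 !E3 /m_ /p_ /q_ /r_ !at_col_c /delta_; ring.
- have [-> _ _ _] := Ck k.
  rewrite !E0 !E1 !E2 !E3 /m_ /p_ /q_ /r_ !at_col_c !at_col_lift /delta_; ring.
- by have [_ -> _ _] := Ck k; rewrite !E0 !E1 /m_ /p_ !at_col_c !at_col_lift; ring.
- by have [_ _ -> _] := Ck k; rewrite !E0 !E2 /m_ /q_ !at_col_c !at_col_lift; ring.
- by rewrite C10 E0 E1 /m_ /p_ !at_col_c /a_; ring.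
- by rewrite C11 E0 E2 /m_ /q_ !at_col_c /b_; ring.
by have [_ _ _ ->] := Ck k; rewrite !E0 /m_ !at_col_c !at_col_lift; ring.
Qed.

Lemma entry_coord_val (M : 'I_4 -> 'I_4 -> K) i j : M i0 c != 0 ->
  M i0 c * entry i0 c (fun k => coord_val M k / (M i0 c * M i0 c)) i j = M i j.
Proof.
move=> z0; set T := fun k => _.
have [E0 E1 E2 E3] := entry_row i0 c T.
have [C0 C10 C11 Ck] := coord_valE M.
have col : forall j, j = c \/ exists k, j = lift c k.
  by move=> j'; case: (unliftP c j') => [k|] ->; [right; exists k | left].
move: i; apply: (flip_ind (i0 := i0)); rewrite ?E0 ?E1 ?E2 ?E3;
  rewrite /m_ /p_ /q_ /r_ /a_ /b_ /delta_; case: (col j) => [|[k]] ->;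
  rewrite ?at_col_c ?at_col_lift /T ?C0 ?C10 ?C11;
  try (have [e1 e4 e7 e12] := Ck k; rewrite ?e1 ?e4 ?e7 ?e12); by field.
Qed.

Lemma P15P (x : 'rV[K]_(4 * 4)) : P15 x <-> vec_mx x != 0.
Proof.
rewrite vec_mx_eq0.
split=> [/(_ (mxvec_index 0 0)) [I _ xI]|/rV0Pn [I xI] J]; last by exists I.
by apply/rV0Pn; exists I.
Qed.

Lemma P15_closed (y : 'rV[K]_(4 * 4)) : P15 y <-> zclosure b15 (@P15 K) y.
Proof. by split=> [py|[]//]; split=> // d p _; apply. Qed.

Lemma base_chart (x : 'rV[K]_(4 * 4)) : vec_mx x i0 c != 0 ->
  chart b15 (@P15 K) x (base_param (vec_mx x i0 c))
    (fun k => coord_val (vec_mx x) k / (vec_mx x i0 c * vec_mx x i0 c))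
    base_num base_den (fun l => if l is 0 then 2 else 0)%N.
Proof.
move=> z0; have coordE t k : (base_num k).@[param (base_param (vec_mx x i0 c)) t 0] =
    t k * base_den.@[param (base_param (vec_mx x i0 c)) t 0].
  have e0 : entry i0 c t i0 c = 1 by have [-> _ _ _] := entry_row i0 c t; rewrite /m_ at_col_c.
  rewrite /base_num meval_coord_val /base_den mevalM !meval_entry_form.
  rewrite !vec_base_paramE e0 mulr1 -(@coord_val_entry _ t).
  by apply: eq_coord_val => i j; rewrite meval_entry_form vec_base_paramE.
have pt_surj (y : 'rV[K]_(4 * 4)) : vec_mx y i0 c != 0 -> param (base_param (vec_mx y i0 c))
    (fun k => coord_val (vec_mx y) k / (vec_mx y i0 c * vec_mx y i0 c)) = y.
  move=> y0; apply: (can_inj (@vec_mxK _ _ _)).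
  by apply/matrixP => i j; rewrite vec_base_paramE entry_coord_val.
have hxv i j : is_multihomog b15 (fun l => if l is 0 then 1 else 0)%N (xv i j).
  by apply: eq_multihomog (multihomogX _ _); case.
have hxv2 i j k l : is_multihomog b15 (fun l => if l is 0 then 2 else 0)%N (xv i j * xv k l).
  by apply: eq_multihomog (multihomogM (hxv i j) (hxv k l)); case.
split.
- exact: pt_surj.
- by rewrite mevalM meval_entry_form mulf_neq0.
- move=> k; rewrite /base_num /coord_val.
  by do 6?[case: ifP => _]; repeat first [apply: multihomogB | apply: multihomogD]; apply: hxv2.
- exact: hxv2.
- exact: coordE.
- move=> t; rewrite mevalM meval_entry_form => h; apply/P15P.
  by apply: contraNneq h => ->; rewrite mxE mul0r.
- move=> d p hp; split=> [pX t|pX y Py].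
    apply: pX; apply/P15P; apply/eqP => /matrixP /(_ i0 c).
    rewrite vec_base_paramE [RHS]mxE; have [-> _ _ _] := entry_row i0 c t.
    by rewrite /m_ at_col_c mulr1 => /eqP; rewrite (negbTE z0).
  suff -> : p = 0 by rewrite meval0.
  have X0 : xv i0 c != 0 by rewrite -msupp_eq0 msuppX.
  apply: (meval_dense X0) => v.
  pose w : 'rV[K]_(4 * 4) := \row_i v i.
  have vE q : q.@[v] = q.@[w 0] by apply: meval_eq => i; rewrite mxE.
  rewrite !vE meval_entry_form => w0; rewrite -[w]pt_surj //.
  (* The image of the parametrization contains only vectors with one fixed pivot entry; the others
     with nonzero pivot are reached by scaling. *)
  set t := fun k => _; pose lam := vec_mx w i0 c / vec_mx x i0 c.
  have -> : param (base_param (vec_mx w i0 c)) t =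
      scale_block b15 0 lam (param (base_param (vec_mx x i0 c)) t).
    apply/rowP => i; rewrite [RHS]mxE /= !paramE /base_param !mevalZ mulrA divfK //.
  by have /multihomogP -> := hp; rewrite pX mulr0.
exact: P15_closed.
Qed.

End BaseChart.

(** * The loci Z1, Z2, C1 and the bundle G *)

Section Rulings.
Variable K : closedFieldType.
Implicit Types (x w : 'rV[K]_(4 * 4)).

Definition ruling_locus (s : bool) x : Prop := if s then Z2 x else Z1 x.

(** The matrix whose column j is the Segre image of [p] and column j of [w], that is, a matrix with
    image in the line of parameter [p]; [s] selects the ruling. *)
Definition ruling_entry (s : bool) (p : 'cV[K]_2) (w : 'M[K]_(2, 4)) (i j : 'I_4) : K :=
  if s then w (s_index i) j * p (t_index i) 0 else p (s_index i) 0 * w (t_index i) j.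

Lemma segreE (p t : 'cV[K]_2) i : segre p t i 0 = p (s_index i) 0 * t (t_index i) 0.
Proof. by elim/ord4_ind: i; rewrite mxE. Qed.

Definition ruling_point (s : bool) (p t : 'cV[K]_2) : 'cV[K]_4 :=
  if s then segre t p else segre p t.

Lemma ruling_pointE s p t i : ruling_point s p t i 0 =
  if s then t (s_index i) 0 * p (t_index i) 0 else p (s_index i) 0 * t (t_index i) 0.
Proof. by case: s; rewrite segreE. Qed.

Lemma ruling_locus_def s x : ruling_locus s x <-> P15 x /\
  exists2 p : 'cV[K]_2, p != 0 & forall u, im_pt x u ->
    exists t : 'cV[K]_2, t != 0 /\ exists2 c : K, c != 0 & u = c *: ruling_point s p t.
Proof. by case: s. Qed.

(** The cone over a line of the ruling is a linear space, so only the columns matter: the parameters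
    of the columns on the line assemble into [w], a zero column getting parameter 0. *)
Lemma ruling_locusP s x : ruling_locus s x <-> P15 x /\
  exists2 p : 'cV[K]_2, p != 0 & exists w : 'M[K]_(2, 4),
    forall i j, vec_mx x i j = ruling_entry s p w i j.
Proof.
rewrite ruling_locus_def; split=> -[Px [p p0 H]]; split=> //; exists p => //.
  have h j : exists t : 'cV[K]_2, forall i, vec_mx x i j = ruling_point s p t i 0.
    have xj : vec_mx x *m delta_mx j 0 = col j (vec_mx x) by rewrite colE.
    have [u0|u0] := eqVneq (col j (vec_mx x)) 0.
      exists 0 => i; have := congr1 (fun A : 'cV_4 => A i 0) u0.
      rewrite mxE [RHS]mxE => ->; rewrite ruling_pointE.
      by case: s {H}; rewrite !mxE ?mulr0 ?mul0r.
    have [|t [_ [c _ uE]]] := H (col j (vec_mx x)); first by split=> //; exists (delta_mx j 0).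
    exists (c *: t) => i; have := congr1 (fun A : 'cV_4 => A i 0) uE.
    rewrite mxE [RHS]mxE => ->; rewrite !ruling_pointE.
    by case: s {H uE}; rewrite [(c *: t) _ _]mxE; ring.
  have [t tE] := fin_all_exists h.
  exists (\matrix_(a, j) t j a 0) => i j; rewrite tE ruling_pointE /ruling_entry.
  by case: s {H h tE}; rewrite mxE.
case: H => w wE u [u0 [v uE]].
have E : u = ruling_point s p (w *m v).
  apply/colP => i; rewrite ruling_pointE uE mxE.
  have -> : \sum_j vec_mx x i j * v j 0 = \sum_j ruling_entry s p w i j * v j 0.
    by apply: eq_bigr => j _; rewrite wE.
  rewrite /ruling_entry; case: s {wE}; rewrite mxE ?mulr_suml ?mulr_sumr;
    by apply: eq_bigr => j _; rewrite ?mulrA // mulrAC.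
exists (w *m v); split; last by exists 1; rewrite ?oner_neq0 ?scale1r.
apply: contraNneq u0 => wv; rewrite E wv; apply/eqP/colP => i.
by rewrite ruling_pointE; case: s {wE E}; rewrite !mxE ?mulr0 ?mul0r.
Qed.

Definition is_D (k : 'I_15) : bool := (k < 4)%N.
(* The coordinates p_j for [s = false], q_j for [s = true]. *)
Definition is_PQ (s : bool) (k : 'I_15) : bool :=
  if s then (7 <= k < 10)%N else (4 <= k < 7)%N.

Variables i0 c : 'I_4.

Lemma ruling_coord_vanish s x k : ruling_locus s x -> is_D k || is_PQ (~~ s) k ->
  coord_val i0 c (vec_mx x) k = 0.
Proof.
move=> /ruling_locusP [_ [p _ [w wE]]] hk.
rewrite (eq_coord_val _ _ _ wE) /coord_val /ruling_entry.
have [e1 e2 e3 e4] := index_flip i0.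
case: (ltnP k 1) => k1; first by case: s {wE hk}; rewrite ?e1 ?e2 ?e3 ?e4; ring.
case: (ltnP k 4) => k4; first by case: s {wE hk}; rewrite ?e1 ?e2 ?e3 ?e4; ring.
have nD : is_D k = false by rewrite /is_D ltnNge k4.
rewrite nD /= in hk; case: s wE hk => _; rewrite /is_PQ /= => /andP[ka kb].
  by rewrite kb ?e1 ?e2 ?e3 ?e4; ring.
by rewrite ltnNge ka /= kb ?e1 ?e2 ?e3 ?e4; ring.
Qed.

Lemma base_param_P15 z0 (t : 'I_15 -> K) : z0 != 0 -> P15 (param (base_param i0 c z0) t).
Proof.
move=> z00; apply/P15P/eqP => /matrixP /(_ i0 c).
rewrite vec_base_paramE [RHS]mxE; have [-> _ _ _] := entry_row i0 c t.
by rewrite /m_ at_col_c mulr1 => /eqP; rewrite (negbTE z00).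
Qed.

Lemma at_col0 (t : 'I_15 -> K) off j : (off + 3 <= 15)%N ->
  (forall k : 'I_15, (off <= k < off + 3)%N -> t k = 0) -> at_col c t 0 off j = 0.
Proof.
move=> o15 h; rewrite /at_col; case: (unlift c j) => // k; apply: h.
have k3 : (off + k < off + 3)%N by rewrite ltn_add2l.
by rewrite inordK ?(leq_trans k3) // leq_addr.
Qed.

Lemma base_param_ruling s z0 (t : 'I_15 -> K) : z0 != 0 ->
  (forall k, is_D k || is_PQ (~~ s) k -> t k = 0) ->
  ruling_locus s (param (base_param i0 c z0) t).
Proof.
move=> z00 h; apply/ruling_locusP; split; first exact: base_param_P15.
have hD k : is_D k -> t k = 0 by move=> Dk; apply: h; rewrite Dk.
have hPQ k : is_PQ (~~ s) k -> t k = 0 by move=> Dk; apply: h; rewrite Dk orbT.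
have d0 : delta_ t = 0 by apply: hD; rewrite /is_D inordK.
have r0 j : r_ c t j = 0.
  have t0 : t (inord 0) *+ 2 = 0 by rewrite -/(delta_ t) d0 mul0rn.
  by rewrite /r_ t0; apply: at_col0 => // k /andP[_ k4]; apply: hD.
have [E0 E1 E2 E3] := entry_row i0 c t; have [e1 e2 e3 e4] := index_flip i0.
have sn : (s_index (flip_s i0) == s_index i0) = false by elim/ord4_ind: (i0).
have tn : (t_index (flip_t i0) == t_index i0) = false by elim/ord4_ind: (i0).
case: s h hPQ => /= h hPQ.
  have p0 j : p_ c t j = 0 by apply: at_col0.
  (* The parameter of the line is the ratio 1 : a of the entries of column [c] in the rows [i0] and
     [flip_t i0]. *)
  exists (\col_a (if a == t_index i0 then 1 else a_ t)).
    by apply/cV0Pn; exists (t_index i0); rewrite mxE eqxx oner_neq0.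
  exists (\matrix_(a, j) (if a == s_index i0 then z0 * m_ c t j
                          else z0 * (b_ t * m_ c t j + q_ c t j))) => i j.
  rewrite vec_base_paramE /ruling_entry !mxE.
  by move: i; apply: (flip_ind (i0 := i0)); rewrite ?E0 ?E1 ?E2 ?E3 ?e1 ?e2 ?e3 ?e4 ?eqxx
    ?sn ?tn ?p0 ?r0 ?d0; ring.
have q0 j : q_ c t j = 0 by apply: at_col0.
exists (\col_a (if a == s_index i0 then 1 else b_ t)).
  by apply/cV0Pn; exists (s_index i0); rewrite mxE eqxx oner_neq0.
exists (\matrix_(a, j) (if a == t_index i0 then z0 * m_ c t j
                        else z0 * (a_ t * m_ c t j + p_ c t j))) => i j.
rewrite vec_base_paramE /ruling_entry !mxE.
by move: i; apply: (flip_ind (i0 := i0)); rewrite ?E0 ?E1 ?E2 ?E3 ?e1 ?e2 ?e3 ?e4 ?eqxx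
  ?sn ?tn ?q0 ?r0 ?d0; ring.
Qed.

Lemma base_num_vanish s k : is_D k || is_PQ (~~ s) k ->
  vanishes_on (ruling_locus s) (base_num K i0 c k).
Proof.
move=> hk x Zx; rewrite /base_num meval_coord_val -[RHS](ruling_coord_vanish Zx hk).
by apply: eq_coord_val => i j; apply: meval_entry_form.
Qed.

Lemma C1_ruling s x : C1 x -> ruling_locus s x.
Proof. by case: s => -[]. Qed.

Lemma base_num_C1 k : [|| is_D k, is_PQ false k | is_PQ true k] ->
  vanishes_on (@C1 K) (base_num K i0 c k).
Proof.
move=> hk x Cx; have [h|] := boolP (is_D k || is_PQ true k).
  exact: (base_num_vanish (s := false) h (C1_ruling false Cx)).
rewrite negb_or => /andP[nD nQ]; apply: (base_num_vanish (s := true) _ (C1_ruling true Cx)).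
by move: hk; rewrite (negbTE nD) (negbTE nQ) orbF.
Qed.

Lemma base_param_C1 z0 (t : 'I_15 -> K) : z0 != 0 ->
  (forall k, [|| is_D k, is_PQ false k | is_PQ true k] -> t k = 0) ->
  C1 (param (base_param i0 c z0) t).
Proof.
move=> z00 h; split; [apply: (@base_param_ruling false) | apply: (@base_param_ruling true)] => //.
  by move=> k hk; apply: h; case/orP: hk => ->; rewrite ?orbT.
by move=> k hk; apply: h; case/orP: hk => ->; rewrite ?orbT.
Qed.

Definition point_form (v : 'cV[K]_4) : {mpoly K[4 * 4]} :=
  let l i := \sum_j v j 0 *: entry_form K i j in l 0 * l 3 - l 1 * l 2.

Lemma meval_quadric (v : 'I_4 -> K) : (quadric K).@[v] = v 0 * v 3 - v 1 * v 2.
Proof. by rewrite mevalB !mevalM !mevalXU. Qed.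

Lemma meval_point_form v x :
  (point_form v).@[x 0] = (quadric K).@[fun i => (vec_mx x *m v) i 0].
Proof.
rewrite meval_quadric mevalB !mevalM; do !congr (_ - _); do ?congr (_ * _);
  rewrite (raddf_sum (meval _)) mxE; apply: eq_bigr => j _ /=;
  by rewrite mevalZ meval_entry_form mulrC.
Qed.

Lemma entry_form_homog i j :
  is_multihomog b15 (fun l => if l is 0 then 1 else 0)%N (entry_form K i j).
Proof. by apply: eq_multihomog (multihomogX _ _); case. Qed.

Lemma point_form_homog v :
  is_multihomog b15 (fun l => if l is 0 then 2 else 0)%N (point_form v).
Proof.
have hl i : is_multihomog b15 (fun l => if l is 0 then 1 else 0)%N
    (\sum_j v j 0 *: entry_form K i j).
  by apply: multihomog_sum => j _; apply/multihomogZ/entry_form_homog.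
by apply: multihomogB; apply: eq_multihomog (multihomogM (hl _) (hl _)); case.
Qed.

Lemma Gfiber_differential x w v : v != 0 -> Gfiber x w -> differential (point_form v) x w = 0.
Proof.
move=> v0 Gw; apply: Gw v0 _ _ (@point_form_homog v) _ => y [_ <-].
exact: meval_point_form.
Qed.

Lemma point_form_delta j : point_form (delta_mx j 0) =
  entry_form K 0 j * entry_form K 3 j - entry_form K 1 j * entry_form K 2 j.
Proof.
have E i : \sum_k (delta_mx j 0 : 'cV[K]_4) k 0 *: entry_form K i k = entry_form K i j.
  rewrite (bigD1 j) //= mxE !eqxx scale1r big1 ?addr0 // => k /negbTE kj.
  by rewrite mxE kj scale0r.
by rewrite /point_form !E.
Qed.

Lemma point_form_delta2 j k : point_form (delta_mx j 0 + delta_mx k 0) =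
  (entry_form K 0 j + entry_form K 0 k) * (entry_form K 3 j + entry_form K 3 k) -
  (entry_form K 1 j + entry_form K 1 k) * (entry_form K 2 j + entry_form K 2 k).
Proof.
have E i l : \sum_k (delta_mx l 0 : 'cV[K]_4) k 0 *: entry_form K i k = entry_form K i l.
  rewrite (bigD1 l) //= mxE !eqxx scale1r big1 ?addr0 // => k' /negbTE kj.
  by rewrite mxE kj scale0r.
have E2 i : \sum_l (delta_mx j 0 + delta_mx k 0 : 'cV[K]_4) l 0 *: entry_form K i l =
    entry_form K i j + entry_form K i k.
  by rewrite -!E -big_split; apply: eq_bigr => l _; rewrite mxE scalerDl.
by rewrite /point_form !E2.
Qed.

Lemma row_sign2 i : row_sign {mpoly K[4 * 4]} i * row_sign _ i = 1.
Proof. by elim/ord4_ind: i; rewrite /row_sign /= ?mulrNN mulr1. Qed.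

(* The D-coordinates are polarizations of the forms f(phi v). *)
Lemma base_num_D_differential x w k : Gfiber x w -> is_D k ->
  differential (base_num K i0 c k) x w = 0.
Proof.
move=> Gw; rewrite /is_D /base_num /coord_val => k4; rewrite k4.
have delta0 j : (delta_mx j 0 : 'cV[K]_4) != 0.
  by apply/cV0Pn; exists j; rewrite mxE !eqxx oner_neq0.
pose sn : K := row_sign K i0.
have snE : row_sign {mpoly K[4 * 4]} i0 = sn%:MP.
  by rewrite /sn; elim/ord4_ind: (i0); rewrite /row_sign /= ?rmorphN ?rmorph1.
have scale p q : p = row_sign _ i0 * q -> differential q x w = 0 -> differential p x w = 0.
  by move=> ->; rewrite snE mul_mpolyC differentialZ => ->; rewrite mulr0.
case: ifP => [_|nk].
  apply: (scale _ (point_form (delta_mx c 0))); last exact: Gfiber_differential.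
  rewrite point_form_delta.
  by have := quad_row (fun i => entry_form K i c) i0 => /= ->; rewrite mulrA row_sign2 mul1r.
set j := lift c _.
apply: (scale _ (point_form (delta_mx c 0 + delta_mx j 0) - point_form (delta_mx c 0)
   - point_form (delta_mx j 0))).
  rewrite point_form_delta2 !point_form_delta.
  have := quad_row (fun i => entry_form K i c + entry_form K i j) i0 => /= ->.
  have := quad_row (fun i => entry_form K i c) i0 => /= ->.
  have := quad_row (fun i => entry_form K i j) i0 => /= ->.
  by rewrite -!mulrBr mulrA row_sign2; ring.
have jc0 : (delta_mx c 0 + delta_mx j 0 : 'cV[K]_4) != 0.
  apply/cV0Pn; exists c; rewrite !mxE !eqxx /= (negbTE (neq_lift _ _)).
  by rewrite addr0 oner_neq0.
rewrite differentialB (Gfiber_differential (delta0 j) Gw) differentialB.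
by rewrite (Gfiber_differential jc0 Gw) (Gfiber_differential (delta0 c) Gw) !subr0.
Qed.

Lemma ruling_point_condition s v x : ruling_locus s x -> point_condition v x.
Proof.
move=> /ruling_locusP [Px [p _ [w wE]]]; split=> //.
rewrite meval_quadric.
have E i : (vec_mx x *m v) i 0 = ruling_point s p (w *m v) i 0.
  rewrite mxE ruling_pointE.
  have -> : \sum_j vec_mx x i j * v j 0 = \sum_j ruling_entry s p w i j * v j 0.
    by apply: eq_bigr => j _; rewrite wE.
  rewrite /ruling_entry; case: s {wE}; rewrite mxE ?mulr_suml ?mulr_sumr;
    by apply: eq_bigr => j _; rewrite ?mulrA // mulrAC.
by rewrite !E !ruling_pointE; case: s {wE E}; rewrite /s_index /t_index /=; ring.
Qed.

End Rulings.

(** * Tangent vectors in the fibres of G *)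

Lemma differential_line (K : closedFieldType) n (p : {mpoly K[n]}) (t v : 'rV[K]_n) :
  (forall e : K, p.@[(t + e *: v) 0] = 0) -> differential p t v = 0.
Proof.
move=> h; pose line i : {mpoly K[1]} := (t 0 i)%:MP + v 0 i *: 'X_ord0.
have pt s : param line s = t + s ord0 *: v.
  by apply/rowP => i; rewrite paramE mevalD mevalC mevalZ mevalXU !mxE mulrC.
have p0 : pullback line p = 0 by apply: mpoly_fun0 => s; rewrite meval_pullback pt.
have := differential_pullback line p 0 (const_mx 1).
rewrite p0 pt mxE scale0r addr0 -{1}mpolyC0 differentialC => /esym.
suff -> : \row_i differential (line i) 0 (const_mx 1) = v by [].
apply/rowP => i; rewrite mxE differentialD differentialC differentialZ differentialXU mxE.
by rewrite add0r mulr1.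
Qed.

Section Tangent.
Variables (K : closedFieldType) (i0 c : 'I_4) (z0 : K).
Hypothesis z00 : z0 != 0.
Local Notation phi := (base_param i0 c z0).

(** With v_D = 0, v is the sum of a part without q-coordinates and a part with q-coordinates only.
    The line through t in the first direction is mapped into Z_1 = {D = q = 0}, in the second into
    Z_2 = {D = p = 0}, and both loci lie in every point condition. *)
Lemma base_param_Gfiber (t v : 'rV[K]_15) :
  (forall k, [|| is_D k, is_PQ false k | is_PQ true k] -> t 0 k = 0) ->
  (forall k, is_D k -> v 0 k = 0) ->
  Gfiber (param phi (t 0)) (\row_i differential (phi i) t v).
Proof.
move=> tS vD u u0 d p hp pX; rewrite -differential_pullback.
pose v1 : 'rV[K]_15 := \row_k (if is_PQ true k then 0 else v 0 k).
pose v2 : 'rV[K]_15 := \row_k (if is_PQ true k then v 0 k else 0).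
have -> : v = v1 + v2.
  by apply/rowP => k; rewrite !mxE; case: ifP => _; rewrite ?add0r ?addr0.
rewrite differentialDr; apply/eqP; rewrite -[X in _ == X]addr0; apply/eqP.
congr (_ + _); apply: differential_line => e; rewrite meval_pullback.
  apply/pX/(@ruling_point_condition _ false)/base_param_ruling => // k hk.
  rewrite !mxE tS ?add0r; last by case/orP: hk => ->; rewrite ?orbT.
  case: ifP => [_|nQ]; rewrite ?mulr0 // vD ?mulr0 //; case/orP: hk => // Qk.
  by have := nQ; rewrite (Qk : is_PQ true k = true).
apply/pX/(@ruling_point_condition _ true)/base_param_ruling => // k hk.
rewrite !mxE tS ?add0r; last by case/orP: hk => ->; rewrite ?orbT.
case: ifP => [Qk|nQ]; rewrite ?mulr0 // vD ?mulr0 //; move: hk => /orP[//|]; move: Qk; rewrite /is_PQ => /andP[k7 _] /andP[_].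
by rewrite ltnNge k7.
Qed.

End Tangent.

(** * The map alpha in a chart *)

Section LinearForms.
Variable R : comNzRingType.
Implicit Types (A B : 'I_4 -> R) (g : 'I_4 -> 'I_4 -> R).

Definition linear_form A : {mpoly R[4]} := \sum_j A j *: 'X_j.

(** The sum runs over ordered pairs, so [g] may be a bilinear form that is not symmetric. *)
Definition quad_coef g (u : 'X_{1..4}) : R :=
  \sum_j \sum_k (if (U_(j) + U_(k))%MM == u then g j k else 0).

Lemma mcoeff_quad g u :
  (\sum_j \sum_k g j k *: ('X_j * 'X_k : {mpoly R[4]}))@_u = quad_coef g u.
Proof.
rewrite (raddf_sum (mcoeff u)); apply: eq_bigr => j _ /=.
rewrite (raddf_sum (mcoeff u)); apply: eq_bigr => k _ /=.
rewrite -mpolyXD mcoeffZ mcoeffX.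
by case: eqP => _; rewrite ?mulr1 ?mulr0.
Qed.

Lemma linear_formM A B : linear_form A * linear_form B =
  \sum_j \sum_k (A j * B k) *: ('X_j * 'X_k).
Proof.
rewrite /linear_form mulr_suml; apply: eq_bigr => j _.
rewrite mulr_sumr; apply: eq_bigr => k _.
by rewrite -scalerAl -scalerAr scalerA.
Qed.

Lemma linear_formD A B : linear_form (fun j => A j + B j) = linear_form A + linear_form B.
Proof. by rewrite -big_split; apply: eq_bigr => j _; rewrite scalerDl. Qed.

Lemma linear_formZ a A : linear_form (fun j => a * A j) = a%:MP * linear_form A.
Proof. by rewrite mulr_sumr; apply: eq_bigr => j _; rewrite mul_mpolyC scalerA. Qed.

Lemma eq_linear_form A B : A =1 B -> linear_form A = linear_form B.
Proof. by move=> e; apply: eq_bigr => j _; rewrite e. Qed.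

Lemma quad_coefB g g' u :
  quad_coef (fun j k => g j k - g' j k) u = quad_coef g u - quad_coef g' u.
Proof.
rewrite -sumrB; apply: eq_bigr => j _; rewrite -sumrB; apply: eq_bigr => k _.
by case: ifP => _; rewrite ?subr0.
Qed.

Lemma quad_coefZ a g u : quad_coef (fun j k => a * g j k) u = a * quad_coef g u.
Proof.
rewrite mulr_sumr; apply: eq_bigr => j _; rewrite mulr_sumr; apply: eq_bigr => k _.
by case: ifP => _; rewrite ?mulr0.
Qed.

Lemma mcoeff_linear_formM A B u :
  (linear_form A * linear_form B)@_u = quad_coef (fun j k => A j * B k) u.
Proof. by rewrite linear_formM mcoeff_quad. Qed.

End LinearForms.

Section Alpha.
Variable K : closedFieldType.

Lemma quadric_compE (phi : 'M[K]_4) : quadric_comp phi =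
  linear_form (phi 0) * linear_form (phi 3) - linear_form (phi 1) * linear_form (phi 2).
Proof.
rewrite /quadric_comp /quadric rmorphB !rmorphM /= !comp_mpolyXU -!tnth_nth.
by rewrite !tnth_mktuple.
Qed.

Definition alpha_form (u : monomial2) : {mpoly K[4 * 4]} :=
  quad_coef (fun j k => entry_form K 0 j * entry_form K 3 k
                      - entry_form K 1 j * entry_form K 2 k) (val u).

Lemma meval_alpha_form u (x : 'rV[K]_(4 * 4)) : (alpha_form u).@[x 0] = alpha x u.
Proof.
rewrite /alpha quadric_compE mcoeffB !mcoeff_linear_formM -quad_coefB.
rewrite (raddf_sum (meval _)); apply: eq_bigr => j _ /=.
rewrite (raddf_sum (meval _)); apply: eq_bigr => k _ /=.
by case: ifP => _; rewrite ?meval0 // mevalB !mevalM !meval_entry_form.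
Qed.

Lemma alpha_form_homog u : is_multihomog b15 (fun l => if l is 0 then 2 else 0)%N (alpha_form u).
Proof.
apply: multihomog_sum => j _; apply: multihomog_sum => k _.
case: ifP => _; last exact: multihomog0.
by apply: multihomogB;
  apply: eq_multihomog (multihomogM (@entry_form_homog K _ _) (@entry_form_homog K _ _)); case.
Qed.

(* f(phi X) = z0^2 (+-1) (Y (R - delta Y) - P Q), where Y, P, Q, R are the linear
   forms with coefficients m_j, p_j, q_j, r_j. *)
Lemma alpha_base i0 c z0 (t : 'I_15 -> K) u : alpha (param (base_param i0 c z0) t) u =
  z0 * z0 * row_sign K i0 * quad_coef (fun j k =>
    m_ c t j * (r_ c t k - delta_ t * m_ c t k) - p_ c t j * q_ c t k) (val u).
Proof.
rewrite /alpha quadric_compE.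
have := quad_row (fun i => linear_form (vec_mx (param (base_param i0 c z0) t) i)) i0 => /= ->.
have [E0 E1 E2 E3] := entry_row i0 c t.
have lE i E : entry i0 c t i =1 E ->
    linear_form (vec_mx (param (base_param i0 c z0) t) i) = z0%:MP * linear_form E.
  move=> e; rewrite -linear_formZ; apply: eq_linear_form => j.
  by rewrite vec_base_paramE e.
rewrite (lE _ _ E0) (lE _ _ E1) (lE _ _ E2) (lE _ _ E3) !linear_formD !linear_formZ.
set Y := linear_form (m_ c t); set P := linear_form (p_ c t); set Q := linear_form (q_ c t).
have -> : row_sign {mpoly K[4]} i0 = (row_sign K i0)%:MP.
  by elim/ord4_ind: (i0); rewrite /row_sign /= ?rmorphN ?rmorph1.
rewrite quad_coefB -!mcoeff_linear_formM -mcoeffB -mcoeffCM; congr mcoeff.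
have -> : linear_form (fun j => r_ c t j - delta_ t * m_ c t j) =
    linear_form (r_ c t) - (delta_ t)%:MP * Y.
  rewrite linear_formD -mulNr -[- _%:MP]rmorphN -linear_formZ; congr (_ + _).
  by apply: eq_linear_form => j; rewrite mulNr.
by rewrite !rmorphM rmorphB rmorphM /= -/Y -/P -/Q; ring.
Qed.

(** With capitals for the linear forms, the hypothesis says M (R - d M) = h P Q. At the basis vector
    of index [c] this reads d = 0. Then P, Q and R do not change along this vector while M has
    coefficient 1: moving along it until M = 0 gives h P Q = 0, and until M = 1 gives R = 0. *)
Lemma reduced_alpha_zero c (m r p q : 'I_4 -> K) d h :
  m c = 1 -> r c = d *+ 2 -> p c = 0 -> q c = 0 ->
  (forall u : monomial2,
    quad_coef (fun j k => m j * (r k - d * m k) - p j * q k * h) (val u) = 0) ->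
  [/\ d = 0, forall j, r j = 0 & h != 0 -> linear_form p * linear_form q = 0].
Proof.
move=> mc rc pc qc H.
pose ev (A : 'I_4 -> K) (X : 'I_4 -> K) := \sum_j A j * X j.
have evE A X : (linear_form A).@[X] = ev A X.
  rewrite (raddf_sum (meval X)); apply: eq_bigr => j _ /=.
  by rewrite mevalZ mevalXU.
have E X : ev m X * (ev r X - d * ev m X) = ev p X * ev q X * h.
  have : linear_form m * (linear_form r - d%:MP * linear_form m) -
      linear_form p * linear_form q * h%:MP = 0.
    have -> : linear_form r - d%:MP * linear_form m = linear_form (fun k => r k - d * m k).
      rewrite linear_formD -mulNr -[- _%:MP]rmorphN -linear_formZ; congr (_ + _).
      by apply: eq_linear_form => j; rewrite mulNr.
    apply/mpolyP => u; rewrite mcoeff0 mcoeffB [_ * h%:MP]mulrC mcoeffCM.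
    rewrite !mcoeff_linear_formM -quad_coefZ -quad_coefB.
    have [u2|u2] := boolP (mdeg u == 2%N); last first.
      rewrite /quad_coef big1 // => j _; rewrite big1 // => k _.
      case: eqP => // uE; case/eqP: u2; rewrite -uE mdegD !mdeg1 //.
    rewrite -[RHS](H (exist _ u u2)); apply: eq_bigr => j _; apply: eq_bigr => k _.
    by case: ifP => _ //; rewrite [h * _]mulrC.
  move/(congr1 (meval X)); rewrite meval0 mevalB !mevalM mevalB mevalM !mevalC !evE.
  exact: subr0_eq.
pose dl (j0 j : 'I_4) : K := (j == j0)%:R.
have ev_dl A j0 : ev A (dl j0) = A j0.
  rewrite /ev (bigD1 j0) //= /dl eqxx mulr1 big1 ?addr0 // => j /negbTE->.
  by rewrite mulr0.
have d0 : d = 0.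
  have := E (dl c); rewrite !ev_dl mc rc pc !mul0r mul1r mulr1 mulr2n addrK //.
have shift A X e : ev A (fun j => X j + e * dl c j) = ev A X + e * A c.
  rewrite /ev -[in RHS](ev_dl A c) /ev mulr_sumr -big_split; apply: eq_bigr => j _ /=.
  by rewrite mulrDr mulrCA.
have rc0 : r c = 0 by rewrite rc d0 mul0rn.
have PQ X : ev p X * ev q X * h = 0.
  have := E (fun j => X j + (- ev m X) * dl c j).
  by rewrite !shift mc rc0 pc qc mulr1 addrN mul0r !mulr0 !addr0.
have R0 X : ev r X = 0.
  have := E (fun j => X j + (1 - ev m X) * dl c j).
  by rewrite !shift mc rc0 pc qc mulr1 addrC subrK d0 !mulr0 !addr0 mul0r subr0 mul1r PQ.
split=> // [j|h0]; first by rewrite -(ev_dl r) R0.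
apply: mpoly_fun0 => X; rewrite mevalM !evE.
by have /eqP := PQ X; rewrite mulf_eq0 (negbTE h0) orbF => /eqP.
Qed.

Lemma linear_form_neq0 (A : 'I_4 -> K) j : A j != 0 -> linear_form A != 0.
Proof.
apply: contraNneq => /(congr1 (mcoeff U_(j))); rewrite mcoeff0 (raddf_sum (mcoeff _)).
rewrite (bigD1 j) //= mcoeffZ mcoeffXU eqxx mulr1 big1 ?addr0 => [-> //|k /negbTE kj].
by rewrite mcoeffZ mcoeffXU kj mulr0.
Qed.

Lemma coord_col c off (k : 'I_15) (t : 'I_15 -> K) none : (off <= k < off + 3)%N ->
  (off + 3 <= 15)%N -> exists j, at_col c t none off j = t k.
Proof.
move=> /andP[ok ko] o15; exists (lift c (inord (k - off))); rewrite at_col_lift inordK.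
  by rewrite subnKC // inord_val.
by rewrite ltn_subLR // addnC.
Qed.

Lemma at_col_scale (R : comNzRingType) c (T y : 'I_15 -> R) th off :
  (off + 3 <= 15)%N -> (forall k : 'I_15, (off <= k < off + 3)%N -> T k = th * y k) ->
  forall none j, at_col c T (th * none) off j = th * at_col c y none off j.
Proof.
move=> o15 h none j; rewrite /at_col; case: (unlift c j) => // k; apply: h.
have k3 : (off + k < off + 3)%N by rewrite ltn_add2l.
by rewrite inordK ?(leq_trans k3) // leq_addr.
Qed.

(** If the D-, p- and q-coordinates carry factors th, thp, thq with thp thq = th h, then th splits
    off all coefficients of alpha and leaves Y (R - delta Y) - h P Q in the reduced coordinates [y].
    These cofactors cannot all vanish at t0 if some reduced D-coordinate is nonzero there, or if h,
    P and Q are, since a product of nonzero linear forms is nonzero. *)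
Lemma alpha_factor i0 c z0 (T y : 'I_15 -> {mpoly K[15]}) th thp thq h (t0 : 'I_15 -> K) :
  z0 != 0 ->
  (forall k, is_D k -> T k = th * y k) ->
  (forall k, is_PQ false k -> T k = thp * y k) ->
  (forall k, is_PQ true k -> T k = thq * y k) -> thp * thq = th * h ->
  (exists2 k, is_D k & (y k).@[t0] != 0) \/ [/\ h.@[t0] != 0,
    exists2 k, is_PQ false k & (y k).@[t0] != 0 &
    exists2 k, is_PQ true k & (y k).@[t0] != 0] ->
  exists (beta : monomial2 -> {mpoly K[15]}) D,
   [/\ forall u t, alpha (param (base_param i0 c z0) (fun k => (T k).@[t])) u =
                   th.@[t] * (beta u).@[t],
       forall u, (msize (beta u) <= D)%N & exists u, (beta u).@[t0] != 0].
Proof.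
move=> z00 TD TP TQ thE nz.
pose gam j k := m_ c T j * (r_ c y k - delta_ y * m_ c T k) - p_ c y j * q_ c y k * h.
pose s := (z0 * z0 * row_sign K i0).
have s0 : s != 0.
  rewrite !mulf_neq0 //; elim/ord4_ind: (i0); rewrite /row_sign /= ?oppr_eq0 oner_neq0 //.
pose beta (u : monomial2) := s *: quad_coef gam (val u).
have ev_col t S none off j : (at_col c S none off j).@[t] =
   at_col c (fun k => (S k).@[t]) none.@[t] off j by rewrite /at_col; case: (unlift c j).
exists beta, (\max_j \max_k msize (gam j k))%N; split.
- move=> u t; rewrite alpha_base -/s mevalZ mulrCA; congr (_ * _).
  rewrite -[th.@[t]]/(meval t th) -mevalM -quad_coefZ (raddf_sum (meval t)).
  apply: eq_bigr => j _ /=; rewrite (raddf_sum (meval t)); apply: eq_bigr => k _ /=.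
  case: ifP => _; last by rewrite meval0.
  rewrite /gam /m_ /r_ /p_ /q_ /delta_.
  have D0 : T (inord 0) = th * y (inord 0) by apply: TD; rewrite /is_D inordK.
  have rE := at_col_scale c (off := 1) (T := T) (y := y) (th := th) isT _ (y (inord 0) *+ 2) k.
  have {}rE : at_col c T (T (inord 0) *+ 2) 1 k = th * at_col c y (y (inord 0) *+ 2) 1 k.
    by rewrite D0 -mulrnAr rE // => l /andP[_ l4]; apply: TD.
  have pE : at_col c T 0 4 j = thp * at_col c y 0 4 j.
    by rewrite -[in LHS](mulr0 thp); apply: at_col_scale.
  have qE : at_col c T 0 7 k = thq * at_col c y 0 7 k.
    by rewrite -[in LHS](mulr0 thq); apply: at_col_scale.
  have ev1 S j' : at_col c (fun l => (S l).@[t]) 1 12 j' = (at_col c S 1 12 j').@[t].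
    by rewrite ev_col meval1.
  have ev0 S off j' : at_col c (fun l => (S l).@[t]) 0 off j' = (at_col c S 0 off j').@[t].
    by rewrite ev_col meval0.
  rewrite !ev1 !ev0 pE qE.
  have -> : at_col c (fun l => (T l).@[t]) ((T (inord 0)).@[t] *+ 2) 1 k =
      (th * at_col c y (y (inord 0) *+ 2) 1 k).@[t].
    by rewrite -rE ev_col mevalMn.
  have := congr1 (meval t) thE; rewrite !mevalM D0 mevalM => thE'.
  rewrite mevalB !mevalM mevalB mevalM.
  have -> a b : thp.@[t] * a * (thq.@[t] * b) = th.@[t] * h.@[t] * a * b.
    by rewrite -thE'; ring.
  by ring.
- move=> u; apply: leq_trans (msizeZ_le _ _) _.
  apply: leq_trans (mmeasure_sum _ _ _ _) _.
  apply/bigmax_leqP => j _; apply: leq_trans (leq_bigmax j).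
  apply: leq_trans (mmeasure_sum _ _ _ _) _; apply/bigmax_leqP => k _.
  by apply: leq_trans (leq_bigmax k); case: ifP => _ //; rewrite mmeasure0.
pose ev (S : 'I_15 -> {mpoly K[15]}) k := (S k).@[t0].
have betaE u : (beta u).@[t0] = s * quad_coef (fun j k =>
    m_ c (ev T) j * (r_ c (ev y) k - delta_ (ev y) * m_ c (ev T) k)
    - p_ c (ev y) j * q_ c (ev y) k * h.@[t0]) (val u).
  rewrite mevalZ; congr (_ * _); rewrite (raddf_sum (meval t0)).
  apply: eq_bigr => j _ /=; rewrite (raddf_sum (meval t0)); apply: eq_bigr => k _ /=.
  case: ifP => _; last by rewrite meval0.
  rewrite mevalB !mevalM mevalB mevalM /m_ /r_ /p_ /q_ !ev_col !meval1 !meval0 mevalMn //.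
suff : ~ forall u, (beta u).@[t0] = 0.
  have deg2 (jk : 'I_4 * 'I_4) : mdeg (U_(jk.1) + U_(jk.2))%MM == 2%N by rewrite mdegD !mdeg1.
  pose mon (jk : 'I_4 * 'I_4) : monomial2 := exist _ (U_(jk.1) + U_(jk.2))%MM (deg2 jk).
  move=> nb; have [jk bjk|b0] := pickP (fun jk => (beta (mon jk)).@[t0] != 0).
    by exists (mon jk).
  case: nb => u; have [jk /eqP uE|nu] := pickP (fun jk => (U_(jk.1) + U_(jk.2))%MM == val u).
    have -> : u = mon jk by apply: val_inj.
    by have /negbFE/eqP := b0 jk.
  rewrite betaE /quad_coef big1 ?mulr0 // => j _; rewrite big1 // => k _.
  by have := nu (j, k) => /= ->.
move=> b0; have H : forall u : monomial2, quad_coef (fun j k =>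
    m_ c (ev T) j * (r_ c (ev y) k - delta_ (ev y) * m_ c (ev T) k)
    - p_ c (ev y) j * q_ c (ev y) k * h.@[t0]) (val u) = 0.
  by move=> u; apply: (mulfI s0); rewrite mulr0 -betaE.
have mc : m_ c (ev T) c = 1 by exact: at_col_c.
have rc : r_ c (ev y) c = delta_ (ev y) *+ 2 by exact: at_col_c.
have pc : p_ c (ev y) c = 0 by exact: at_col_c.
have qc : q_ c (ev y) c = 0 by exact: at_col_c.
have [d0 r0 pq0] := reduced_alpha_zero mc rc pc qc H; case: nz => [[k Dk /eqP[]]|[h0 [k Pk yk] [l Ql yl]]].
  have [k0|k0] := posnP k; first by rewrite (_ : k = inord 0) //; apply: val_inj; rewrite /= inordK.
  have k14 : (1 <= k < 1 + 3)%N by rewrite k0.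
  have [j jE] := coord_col c (ev y) (delta_ (ev y) *+ 2) k14 isT.
  by rewrite -/(ev y k) -jE; apply: r0.
have [j jE] := coord_col c (ev y) 0 (Pk : (4 <= k < 4 + 3)%N) isT.
have [j' jE'] := coord_col c (ev y) 0 (Ql : (7 <= l < 7 + 3)%N) isT.
move: (pq0 h0) => /eqP; rewrite mulf_eq0 => /orP[] /eqP e0.
  by have := linear_form_neq0 (A := p_ c (ev y)) (j := j); rewrite /p_ jE e0 eqxx => /(_ yk).
by have := linear_form_neq0 (A := q_ c (ev y)) (j := j'); rewrite /q_ jE' e0 eqxx => /(_ yl).
Qed.

End Alpha.

(** * The first blow-up and C2 *)

Lemma generates_at_vanish (K : closedFieldType) n (b : 'I_n -> nat) (X C : 'rV[K]_n -> Prop)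
    r (g : 'I_r -> {mpoly K[n]}) x d p :
  generates_at b X C g x -> X x -> is_multihomog b d p -> vanishes_on C p ->
  (forall k, (g k).@[x 0] = 0) -> p.@[x 0] = 0.
Proof.
move=> [_ gen] Xx hp pC g0; have [s [sx [a va]]] := gen d p hp pC.
have := va x Xx; rewrite mevalB mevalM (raddf_sum (meval _)) big1 => [|k _ /=]; last first.
  by rewrite mevalM g0 mulr0.
by rewrite subr0 => /eqP; rewrite mulf_eq0 (negbTE sx) => /eqP.
Qed.

Lemma generates_at_neq0 (K : closedFieldType) n (b : 'I_n -> nat) (X C : 'rV[K]_n -> Prop)
    r (g : 'I_r -> {mpoly K[n]}) x d p :
  generates_at b X C g x -> X x -> is_multihomog b d p -> vanishes_on C p ->
  p.@[x 0] != 0 -> exists k, (g k).@[x 0] != 0.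
Proof.
move=> gen Xx hp pC px; have [k gk|g0] := pickP (fun k => (g k).@[x 0] != 0); first by exists k.
case/eqP: px; apply: generates_at_vanish gen Xx hp pC _ => k.
by have /negbFE/eqP := g0 k.
Qed.

Section ProperTransform.
Variables (K : closedFieldType) (N m : nat) (b : 'I_N -> nat) (X C Z : 'rV[K]_N -> Prop).
Variables (g : 'I_m.+1 -> {mpoly K[N]}) (dg : nat -> nat).
Hypothesis hg : forall k, is_multihomog b dg (g k).
Hypothesis X_closed : forall y, X y <-> zclosure b X y.
Hypothesis base_locus : forall y, X y -> (forall k, (g k).@[y 0] = 0) -> C y.

(** Off C the fibre coordinates are a multiple of g, so q is a multiple of s p and vanishes over Z;
    this passes to the closure. *)
Lemma strict_transform_proper d s p q : is_multihomog (blocks_ext b (m := m)) d q ->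
  strict_transform X g s p q -> vanishes_on Z p ->
  vanishes_on (proper_transform b X C g Z) q.
Proof.
move=> hq st pZ z [_ hz]; apply: (hz _ _ hq) => {hz}y [BXy Zy nCy].
have Xy := blowup_lsubmx X_closed BXy.
have [l gl|g0] := pickP (fun k => (g k).@[lsubmx y 0] != 0).
  have [c _ yE] := blowup_off_base hg BXy gl.
  by rewrite (strict_transform_graph st Xy yE) (pZ _ Zy) !mulr0.
by case: nCy; apply: base_locus => // k; have /negbFE/eqP := g0 k.
Qed.

Lemma lift_proper d p : is_multihomog b d p -> vanishes_on Z p ->
  vanishes_on (proper_transform b X C g Z) (lift_form m p).
Proof.
move=> hp pZ z [_ hz]; apply: (hz _ _ (lift_homog m hp)) => y [_ Zy _].
by rewrite meval_lift pZ.
Qed.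

End ProperTransform.

Lemma vanishesMl (K : closedFieldType) n (X : 'rV[K]_n -> Prop) p q :
  vanishes_on X q -> vanishes_on X (p * q).
Proof. by move=> qX x Xx; rewrite mevalM qX // mulr0. Qed.

Lemma vanishesMr (K : closedFieldType) n (X : 'rV[K]_n -> Prop) p q :
  vanishes_on X p -> vanishes_on X (p * q).
Proof. by move=> pX x Xx; rewrite mevalM pX // mul0r. Qed.

Lemma eq_param (K : closedFieldType) n N (psi : 'I_N -> {mpoly K[n]}) (t t' : 'I_n -> K) :
  t =1 t' -> param psi t = param psi t'.
Proof. by move=> tt; apply/rowP => i; rewrite !paramE; apply: meval_eq. Qed.

Definition is_S1 (k : 'I_15) : bool := [|| is_D k, is_PQ false k | is_PQ true k].

Lemma is_S1P k : is_S1 k -> is_D k \/ exists s, is_PQ s k.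
Proof. by case/or3P => h; [left | right; exists false | right; exists true]. Qed.

Lemma is_PQ_D s k : is_PQ s k -> is_D k = false.
Proof.
rewrite /is_PQ /is_D; case: s => /andP[h _]; apply/negbTE; rewrite -leqNgt //.
exact: leq_trans h.
Qed.

Lemma is_PQ_neg s k : is_PQ s k -> is_PQ (~~ s) k = false.
Proof.
rewrite /is_PQ; case: s => /= /andP[h1 h2]; apply/negbTE/negP => /andP[h3 h4].
  by move: h4; rewrite ltnNge h1.
by move: h2; rewrite ltnNge h3.
Qed.

Lemma is_PQ_S1 s k : is_PQ s k -> is_S1 k.
Proof. by rewrite /is_S1; case: s => ->; rewrite ?orbT. Qed.

Lemma is_D_S1 k : is_D k -> is_S1 k.
Proof. by rewrite /is_S1 => ->. Qed.

Section Tower.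
Variable K : closedFieldType.
Variables (m1 : nat) (g1 : 'I_m1.+1 -> {mpoly K[4 * 4]}).
Hypothesis pi1 : presents_center b15 (@P15 K) (@C1 K) g1.

Local Notation W1 := (V1 g1).
Local Notation bb1 := (@b1 m1).

Lemma base_coord_neq0 (x : 'rV[K]_(4 * 4)) : P15 x -> exists i j, vec_mx x i j != 0.
Proof. by move=> /P15P /matrix0Pn [i [j h]]; exists i, j. Qed.

Lemma C1_base_locus x : P15 x -> (forall k, (g1 k).@[x 0] = 0) -> C1 x.
Proof.
move=> Px g0; have [i0 [c z0]] := base_coord_neq0 Px; have ch := base_chart z0.
rewrite -(chart_base ch); apply: base_param_C1 => // k Sk.
have := generates_at_vanish (pi1.2 x Px) Px (chart_num_homog ch k) (base_num_C1 _ _ Sk) g0.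
by rewrite (chart_base_coord ch) => /eqP; rewrite mulf_eq0 (negbTE (chart_den_neq0 ch)) orbF => /eqP.
Qed.

Definition tilde s := proper_transform b15 (@P15 K) (@C1 K) g1 (ruling_locus s).

Lemma V1_closed y : W1 y <-> zclosure bb1 W1 y.
Proof. exact: blowup_closed. Qed.

Definition num1 i0 c (e : 'I_15) (Q : 'I_15 -> {mpoly K[4 * 4 + m1.+1]}) k :=
  if is_S1 k && (k != e) then lift_form m1 (base_den K i0 c) * Q k
  else lift_form m1 (base_num K i0 c k) * Q e.

Definition den1 i0 c e (Q : 'I_15 -> {mpoly K[4 * 4 + m1.+1]}) :=
  lift_form m1 (base_den K i0 c) * Q e.

(** Besides the chart, the strict transforms are kept for equations of C2 and of the proper
    transforms, and the relation between [omega] and [g1] for computing the fibre over C1. *)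
Record chart1 (z : 'rV[K]_(4 * 4 + m1.+1)) i0 c z0 e s Q omega rho t1 dd1 : Prop := Chart1 {
  chart1_z0 : z0 != 0 :> K;
  chart1_e : is_S1 e;
  chart1_homog : forall k, is_S1 k -> exists d, is_multihomog bb1 d (Q k);
  chart1_st : forall k, is_S1 k ->
    strict_transform (@P15 K) g1 s (base_num K i0 c k) (Q k);
  chart1_Qe : (Q e).@[z 0] != 0;
  chart1_omega : forall k, 'X_e * omega k =
    rho * pullback (monoidal K is_S1 e) (pullback (base_param i0 c z0) (g1 k));
  chart1_chart : chart bb1 W1 z (ext_param (base_param i0 c z0) (monoidal K is_S1 e) omega)
     t1 (num1 i0 c e Q) (den1 i0 c e Q) dd1
}.

Lemma V1_chart z : W1 z ->
  exists i0 c z0 e s Q omega rho t1 dd1, @chart1 z i0 c z0 e s Q omega rho t1 dd1.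
Proof.
move=> V1z; have Px := blowup_lsubmx (@P15_closed K) V1z.
have [i0 [c z0]] := base_coord_neq0 Px; have ch := base_chart z0.
have [[dg hg] gen] := pi1.
have [|t tS _ _|e [ds [s [Q [omega [rho [t1 [dd1 [Se _ QP [Qe omE] ch1]]]]]]]]] :=
  @chart_blowup_center K 15 _ m1 b15 _ (@C1 K) g1 dg hg _ _ _ _ _ z ch V1z (gen _ Px)
    is_S1 (fun k Sk => base_num_C1 i0 c Sk) 1.
- by exists (fun=> 0) => //; rewrite meval1 oner_neq0.
- by apply: base_param_C1.
exists i0, c, (vec_mx (lsubmx z) i0 c), e, s, Q, omega, rho, t1, dd1.
by split=> // k /QP [].
Qed.

Lemma tilde_vanish s i0 c s0 Q d k : is_D k || is_PQ (~~ s) k ->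
  is_multihomog bb1 d Q -> strict_transform (@P15 K) g1 s0 (base_num K i0 c k) Q ->
  vanishes_on (tilde s) Q.
Proof.
have [[dg hg] _] := pi1; move=> hk hQ st.
exact: (strict_transform_proper hg (@P15_closed K) C1_base_locus hQ st (base_num_vanish _ _ hk)).
Qed.

(** Over x in C1 the value of Q is proportional to sum a_j(x) dg_j(w). Differentiating s tau_k = sum
    a_j g_j along w turns this sum into s(x) dtau_k(w), which is zero because w lies in the fibre of
    G. *)
Lemma C2_vanish_D i0 c s0 Q k : is_D k ->
  strict_transform (@P15 K) g1 s0 (base_num K i0 c k) Q -> vanishes_on (C2 g1) Q.
Proof.
move=> Dk [a [va ->]] z [_ Cx [w [Gw _ [e zE]]]].
have gx j : (g1 j).@[lsubmx z 0] = 0 by have [Px _] := Cx.1; apply: (pi1.2 _ Px).1.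
have px : (base_num K i0 c k).@[lsubmx z 0] = 0 by apply: base_num_C1 Cx; apply: is_D_S1.
(* The identity is given at nonzero vectors only; to be differentiated it must hold between
   polynomials. *)
have E : s0 * base_num K i0 c k - \sum_j a j * g1 j = 0.
  have X0 : 'X_(mxvec_index 0 0) != 0 :> {mpoly K[4 * 4]} by rewrite -msupp_eq0 msuppX.
  apply: (meval_dense X0) => v; rewrite mevalXU => v0.
  rewrite (meval_eq (v2 := (\row_i v i : 'rV[K]_(4 * 4)) 0)) => [|i]; last by rewrite mxE.
  by apply: va => J; exists (mxvec_index 0 0) => //; rewrite mxE.
have := congr1 (fun p => differential p (lsubmx z) w) E.
rewrite differentialB -[in RHS]mpolyC0 differentialC differentialM px mulr0 add0r.
rewrite (base_num_D_differential _ _ Gw Dk) mulr0 sub0r differential_sum => /eqP.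
rewrite oppr_eq0 => /eqP E'; rewrite (raddf_sum (meval _)) /=.
transitivity (e * \sum_j differential (a j * g1 j) (lsubmx z) w); last by rewrite E' mulr0.
rewrite mulr_sumr; apply: eq_bigr => j _.
rewrite mevalM meval_lift meval_fiber_var zE differentialM gx mulr0 add0r !mxE.
by rewrite mulrCA.
Qed.

Lemma C2_vanish_lift k i0 c : is_S1 k -> vanishes_on (C2 g1) (lift_form m1 (base_num K i0 c k)).
Proof. by move=> Sk z [_ Cx _]; rewrite meval_lift; apply: base_num_C1 Cx. Qed.

Definition is_S2 e (k : 'I_15) := is_D k || (k == e).

Section Level1.
Variables (z : 'rV[K]_(4 * 4 + m1.+1)) (i0 c : 'I_4) (z0 : K) (e : 'I_15).
Variables (s : {mpoly K[4 * 4]}) (Q : 'I_15 -> {mpoly K[4 * 4 + m1.+1]}).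
Variables (omega : 'I_m1.+1 -> {mpoly K[15]}) (rho : {mpoly K[15]}) (t1 : 'I_15 -> K).
Variable dd1 : nat -> nat.
Hypothesis c1 : chart1 z i0 c z0 e s Q omega rho t1 dd1.
Local Notation phi := (base_param i0 c z0).
Local Notation sub1 := (monoidal K is_S1 e).
Local Notation psi1 := (ext_param phi sub1 omega).

Lemma monoidal_eval S e' (t : 'I_15 -> K) k :
  param (monoidal K S e') t 0 k = if S k && (k != e') then t k * t e' else t k.
Proof. by rewrite paramE /monoidal; case: ifP => _; rewrite ?mevalM !mevalXU. Qed.

Lemma base_den_neq0 (t : 'I_15 -> K) : (base_den K i0 c).@[param phi t 0] != 0.
Proof.
rewrite mevalM !meval_entry_form vec_base_paramE.
have [-> _ _ _] := entry_row i0 c t; rewrite /m_ at_col_c mulr1.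
by rewrite mulf_neq0 ?(chart1_z0 c1).
Qed.

Lemma base_num_param (t : 'I_15 -> K) k :
  (base_num K i0 c k).@[param phi t 0] = t k * (base_den K i0 c).@[param phi t 0].
Proof.
have e0 : entry i0 c t i0 c = 1 by have [-> _ _ _] := entry_row i0 c t; rewrite /m_ at_col_c.
rewrite /base_num meval_coord_val /base_den mevalM !meval_entry_form.
rewrite !vec_base_paramE e0 mulr1 -(@coord_val_entry i0 c _ t).
by apply: eq_coord_val => i j; rewrite meval_entry_form vec_base_paramE.
Qed.

Lemma param_notin_C1 (t : 'I_15 -> K) k : is_S1 k -> t k != 0 -> ~ C1 (param phi t).
Proof.
move=> Sk tk /(base_num_C1 i0 c Sk); rewrite base_num_param => /eqP.
by rewrite mulf_eq0 (negbTE tk) (negbTE (base_den_neq0 _)).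
Qed.

Lemma C2_vanish_num sd k : is_PQ sd e -> is_S2 e k -> vanishes_on (C2 g1) (num1 i0 c e Q k).
Proof.
move=> PQe; rewrite /is_S2 /num1; have [->|ke] := eqVneq k e.
  by rewrite andbF => _; apply/vanishesMr/C2_vanish_lift/chart1_e/c1.
rewrite orbF => Dk; rewrite is_D_S1 //=; apply: vanishesMl.
exact: C2_vanish_D Dk (chart1_st c1 (is_D_S1 Dk)).
Qed.

(* The fibre coordinate of a chart point over C1 is dg1(w), where w is the image of the
   tangent vector obtained by differentiating the chart in the direction of t_e. *)
Lemma C2_param sd t : is_PQ sd e -> (forall k, is_S2 e k -> t k = 0) ->
  (den1 i0 c e Q).@[param psi1 t 0] != 0 -> C2 g1 (param psi1 t).
Proof.
move=> PQe tS den0; have te : t e = 0 by apply: tS; rewrite /is_S2 eqxx orbT.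
have Se := chart1_e c1; have ch := chart1_chart c1.
pose tb : 'rV[K]_15 := param sub1 t.
have tbS k : is_S1 k -> tb 0 k = 0.
  move=> Sk; rewrite monoidal_eval Sk /=; case: eqP => [->|_] /=; first exact: te.
  by rewrite te mulr0.
have Cx : C1 (param phi (tb 0)) by apply: base_param_C1 (chart1_z0 c1) _.
pose dir : 'rV[K]_15 := delta_mx 0 e.
pose v : 'rV[K]_15 := \row_k differential (sub1 k) (\row_i t i) dir.
have vE k : v 0 k = if k == e then 1 else if is_S1 k then t k else 0.
  rewrite mxE /monoidal; have [->|ke] := eqVneq k e.
    by rewrite andbF differentialXU mxE !eqxx.
  rewrite andbT; case: ifP => _; last by rewrite differentialXU mxE (negbTE ke) andbF.
  rewrite differentialM !differentialXU !mevalXU !mxE !eqxx (negbTE ke) andbF.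
  by rewrite mul0r add0r mulr1.
have tE (p : {mpoly K[15]}) : p.@[(\row_i t i : 'rV[K]_15) 0] = p.@[t].
  by apply: meval_eq => i; rewrite mxE.
have tbE : param sub1 ((\row_i t i : 'rV[K]_15) 0) = tb.
  by apply: eq_param => i; rewrite mxE.
split; first exact: chart_is_point ch _ den0.
  by rewrite param_ext row_mxKl.
exists (\row_i differential (phi i) tb v); rewrite param_ext row_mxKl row_mxKr; split.
- apply: (@base_param_Gfiber K i0 c z0 (chart1_z0 c1) tb v) => [k Sk|k Dk]; first exact: tbS.
  rewrite vE; case: eqP => [ke|_]; first by move: Dk; rewrite ke (is_PQ_D PQe).
  by rewrite is_D_S1 // tS // /is_S2 Dk.
(* The vector is not tangent to C1: the numerator of index [e] vanishes on C1 and has a nonzero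
   derivative along it. *)
- move=> tan; have ch0 : exists d, is_multihomog b15 d (base_num K i0 c e).
    have [x x0] : exists x : 'rV[K]_(4 * 4), vec_mx x i0 c != 0.
      exists (param phi t); rewrite vec_base_paramE.
      have [-> _ _ _] := entry_row i0 c t; rewrite /m_ at_col_c mulr1.
      exact: chart1_z0 c1.
    by have h := chart_num_homog (base_chart x0) e; eexists; apply: h.
  have [d hd] := ch0; have := tan _ _ hd (base_num_C1 _ _ Se).
  rewrite -differential_pullback.
  have -> : pullback phi (base_num K i0 c e) = 'X_e * pullback phi (base_den K i0 c).
    apply: mpoly_fun_eq => u.
    by rewrite mevalM mevalXU !meval_pullback base_num_param.
  rewrite differentialM differentialXU mevalXU tbS // mul0r addr0 vE eqxx mul1r.
  by rewrite meval_pullback => /eqP; rewrite (negbTE (base_den_neq0 _)).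
exists rho.@[t]; apply/rowP => k; rewrite !mxE -differential_pullback.
have gx : (g1 k).@[param phi (tb 0) 0] = 0.
  by have [Px _] := Cx.1; apply: (pi1.2 _ Px).1 Cx.
(* At t_e = 0 the derivative of X_e omega_k in the direction of t_e is omega_k; that of the
   right-hand side is rho dg_k(w), since g_k vanishes at the base point. *)
have := congr1 (fun p => differential p (\row_i t i) dir) (chart1_omega c1 k).
rewrite !differentialM differentialXU mevalXU !tE mxE !eqxx mul1r mxE te mul0r addr0.
move=> ->; rewrite !meval_pullback -/tb gx mulr0 add0r.
by rewrite differential_pullback tbE.
Qed.

End Level1.

(** A common zero of [g2] is a zero of every form vanishing on C2. For e in D this contradicts that
    Q_e is nonzero; otherwise the coordinates in [is_S2 e] vanish, and such points lie in C2. *)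
Lemma C2_base_locus m2 (g2 : 'I_m2.+1 -> {mpoly K[4 * 4 + m1.+1]}) :
  presents_center bb1 W1 (C2 g1) g2 ->
  forall y, W1 y -> (forall k, (g2 k).@[y 0] = 0) -> C2 g1 y.
Proof.
move=> [_ gen] y Vy g0.
have [i0 [c [z0 [e [s [Q [omega [rho [t1 [dd1 c1]]]]]]]]]] := V1_chart Vy.
have Se := chart1_e c1; have ch := chart1_chart c1.
have [De|[sd PQe]] := is_S1P Se.
  have [d hd] := chart1_homog c1 Se.
  have := generates_at_vanish (gen y Vy) Vy hd (C2_vanish_D De (chart1_st c1 Se)) g0.
  by move=> Q0; have := chart1_Qe c1; rewrite Q0 eqxx.
rewrite -(chart_base ch); apply: (C2_param c1 PQe) => [k Sk|]; last first.
  by rewrite (chart_base ch) (chart_den_neq0 ch).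
have := generates_at_vanish (gen y Vy) Vy (chart_num_homog ch k) (C2_vanish_num c1 PQe Sk) g0.
by rewrite (chart_base_coord ch) => /eqP; rewrite mulf_eq0 (negbTE (chart_den_neq0 ch)) orbF => /eqP.
Qed.

End Tower.

(** * The second and third blow-ups *)

Lemma pullbackXU (K : closedFieldType) n N (psi : 'I_N -> {mpoly K[n]}) i :
  pullback psi 'X_i = psi i.
Proof. by rewrite /pullback comp_mpolyXU -tnth_nth tnth_mktuple. Qed.

Lemma pullbackM (K : closedFieldType) n N (psi : 'I_N -> {mpoly K[n]}) p q :
  pullback psi (p * q) = pullback psi p * pullback psi q.
Proof. exact: rmorphM. Qed.

Lemma lsubmx_param_ext (K : closedFieldType) n N m (psi : 'I_N -> {mpoly K[n]}) sub
    (omega : 'I_m.+1 -> {mpoly K[n]}) t :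
  lsubmx (param (ext_param psi sub omega) t) = param psi (param sub t 0).
Proof. by rewrite param_ext row_mxKl. Qed.

Section Tower.
Variable K : closedFieldType.
Variables (m1 : nat) (g1 : 'I_m1.+1 -> {mpoly K[4 * 4]}).
Hypothesis pi1 : presents_center b15 (@P15 K) (@C1 K) g1.
Variables (m2 : nat) (g2 : 'I_m2.+1 -> {mpoly K[4 * 4 + m1.+1]}).
Hypothesis pi2 : presents_center (@b1 m1) (V1 g1) (C2 g1) g2.
Variables (m3 : nat) (g3 : 'I_m3.+1 -> {mpoly K[4 * 4 + m1.+1 + m2.+1]}).
Hypothesis pi3 : presents_center (@b2 m1 m2) (V2 g1 g2) (C3 g1 g2) g3.

Local Notation W1 := (V1 g1).
Local Notation W2 := (V2 g1 g2).
Local Notation W3 := (V3 g1 g2 g3).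
Local Notation bb1 := (@b1 m1).
Local Notation bb2 := (@b2 m1 m2).
Local Notation bb3 := (@b3 m1 m2 m3).

Definition hat r := proper_transform bb1 W1 (C2 g1) g2 (tilde g1 r).

Lemma C3_hat z : C3 g1 g2 z <-> exists r, hat r z.
Proof.
split=> [[h|h]|[[] h]]; [by exists false | by exists true | by right | by left].
Qed.

Lemma C3_vanish F : (forall r, vanishes_on (hat r) F) -> vanishes_on (C3 g1 g2) F.
Proof. by move=> h z /C3_hat [r] /h. Qed.

Lemma V2_closed y : W2 y <-> zclosure bb2 W2 y.
Proof. exact: blowup_closed. Qed.

Lemma hat_vanish_st r d s p q : is_multihomog bb2 d q -> strict_transform W1 g2 s p q ->
  vanishes_on (tilde g1 r) p -> vanishes_on (hat r) q.
Proof.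
have [[dg hg] _] := pi2 => hq st.
exact: (strict_transform_proper hg (V1_closed g1) (C2_base_locus pi1 pi2) hq st).
Qed.

Lemma hat_vanish_lift r d p : is_multihomog bb1 d p -> vanishes_on (tilde g1 r) p ->
  vanishes_on (hat r) (lift_form m2 p).
Proof. by move=> hp pZ; apply: lift_proper hp pZ. Qed.

Definition good_at (z : 'rV[K]_(4 * 4 + m1.+1 + m2.+1 + m3.+1)) : Prop :=
  (exists (d : nat -> nat) (h : monomial2 -> {mpoly K[4 * 4 + m1.+1 + m2.+1 + m3.+1]}),
    [/\ forall t, is_multihomog bb3 d (h t), exists t, (h t).@[z 0] != 0
      & forall y, W3 y -> forall t u,
          (h t).@[y 0] * alpha3 y u = (h u).@[y 0] * alpha3 y t]) /\
  smooth_at bb3 W3 z.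

Lemma good_at_chart z psi3 t3 tau3 sg3 dd3 i0 c z0 (T y : 'I_15 -> {mpoly K[15]})
    th thp thq h :
  chart bb3 W3 z psi3 t3 tau3 sg3 dd3 -> z0 != 0 ->
  (forall t, lsubmx (lsubmx (lsubmx (param psi3 t))) =
     param (base_param i0 c z0) (fun k => (T k).@[t])) ->
  (forall k, is_D k -> T k = th * y k) ->
  (forall k, is_PQ false k -> T k = thp * y k) ->
  (forall k, is_PQ true k -> T k = thq * y k) -> thp * thq = th * h ->
  (exists2 k, is_D k & (y k).@[t3] != 0) \/ [/\ h.@[t3] != 0,
    exists2 k, is_PQ false k & (y k).@[t3] != 0 &
    exists2 k, is_PQ true k & (y k).@[t3] != 0] ->
  good_at z.
Proof.
move=> ch z00 psiE TD TP TQ thE nz; split; last exact: chart_smooth ch.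
have [beta [D [aE bD b0]]] := alpha_factor i0 c z00 TD TP TQ thE nz.
pose f u := lift_form m3 (lift_form m2 (lift_form m1 (alpha_form K u))).
have fE u (x : 'rV[K]_(4 * 4 + m1.+1 + m2.+1 + m3.+1)) : (f u).@[x 0] = alpha3 x u by rewrite !meval_lift meval_alpha_form.
have hf u := lift_homog m3 (lift_homog m2 (lift_homog m1 (@alpha_form_homog K u))).
have fT u t : (f u).@[param psi3 t 0] = th.@[t] * (beta u).@[t].
  by rewrite fE /alpha3 psiE aE.
have [d [h' [hh h0 hE]]] := chart_regular ch hf fT bD b0.
by exists d, h'; split=> // x W3x t u; rewrite -!fE; apply: hE.
Qed.

(** * Regularity and smoothness at a point of V_3 *)

Section Point.
Variable z3 : 'rV[K]_(4 * 4 + m1.+1 + m2.+1 + m3.+1).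
Hypothesis V3z : W3 z3.
Local Notation z2 := (lsubmx z3).
Local Notation z1 := (lsubmx z2).

Lemma V2_z2 : W2 z2. Proof. exact: (blowup_lsubmx V2_closed (V3z : blowup bb2 W2 g3 z3)). Qed.
Lemma V1_z1 : W1 z1. Proof. exact: (blowup_lsubmx (V1_closed g1) (V2_z2 : blowup bb1 W1 g2 z2)). Qed.

Variables (i0 c : 'I_4) (z0 : K) (e : 'I_15).
Variables (s : {mpoly K[4 * 4]}) (Q : 'I_15 -> {mpoly K[4 * 4 + m1.+1]}).
Variables (omega : 'I_m1.+1 -> {mpoly K[15]}) (rho : {mpoly K[15]}) (t1 : 'I_15 -> K).
Variable dd1 : nat -> nat.
Hypothesis c1 : chart1 g1 z1 i0 c z0 e s Q omega rho t1 dd1.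
Local Notation phi := (base_param i0 c z0).
Local Notation sub1 := (monoidal K is_S1 e).
Local Notation psi1 := (ext_param phi sub1 omega).

Let hQ k (Sk : is_S1 k) := chart1_homog c1 Sk.
Let stQ k (Sk : is_S1 k) := chart1_st c1 Sk.

Lemma tilde_vanish_Q r k : is_S1 k -> is_D k || is_PQ (~~ r) k -> vanishes_on (tilde g1 r) (Q k).
Proof.
by move=> Sk hk; have [d hd] := hQ Sk; apply: (tilde_vanish pi1 hk hd (stQ Sk)).
Qed.

(** [Q e] and its lift vanish on the later centres but not at the point, so both further blow-ups
    are isomorphisms there. The D-, p- and q-coordinates all carry the factor X_e, and the reduced
    D-coordinate of index e is 1. *)
Lemma good_at_D : is_D e -> good_at z3.
Proof.
move=> De; have Se := chart1_e c1; have ch1 := chart1_chart c1.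
have [[dg2 hg2] gen2] := pi2; have [[dg3 hg3] gen3] := pi3.
have [d hd] := hQ Se.
have [l2 gl2] := generates_at_neq0 (gen2 _ V1_z1) V1_z1 hd (C2_vanish_D pi1 De (stQ Se))
  (chart1_Qe c1).
have [c2 ch2] := chart_blowup_away hg2 ch1 V2_z2 gl2.
have vC3 : vanishes_on (C3 g1 g2) (lift_form m2 (Q e)).
  by apply: C3_vanish => r; apply: hat_vanish_lift hd _; apply: tilde_vanish_Q; rewrite ?De.
have nC3 : (lift_form m2 (Q e)).@[z2 0] != 0 by rewrite meval_lift; apply: chart1_Qe c1.
have [l3 gl3] := generates_at_neq0 (gen3 _ V2_z2) V2_z2 (lift_homog m2 hd) vC3 nC3.
have [c3 ch3] := chart_blowup_away hg3 ch2 V3z gl3.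
pose y k : {mpoly K[15]} := if k == e then 1 else 'X_k.
apply: (good_at_chart (T := sub1) (y := y) (th := 'X_e) (thp := 'X_e) (thq := 'X_e)
  (h := 'X_e) ch3 (chart1_z0 c1)) => //.
- move=> t; rewrite !lsubmx_param_ext; apply: eq_param => k; rewrite paramE.
  by apply: meval_eq => j; rewrite !param_id.
- move=> k Dk; rewrite /monoidal /y is_D_S1 //=.
  by case: eqP => [->|_] /=; rewrite ?mulr1 // mulrC.
- move=> k Pk; rewrite /monoidal /y (is_PQ_S1 Pk) /=; case: eqP => [ke|_] /=; last by rewrite mulrC.
  by have := is_PQ_D Pk; rewrite ke De.
- move=> k Pk; rewrite /monoidal /y (is_PQ_S1 Pk) /=; case: eqP => [ke|_] /=; last by rewrite mulrC.
  by have := is_PQ_D Pk; rewrite ke De.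
by left; exists e => //; rewrite /y eqxx meval1 oner_neq0.
Qed.

(** Let e2 be the index of the chart of the second blow-up. If e2 is in D, [Q2 e2] vanishes on the
    third centre, which therefore misses the point. If e2 = e, the third centre is cut out by D and
    by the p- or q-coordinates on the side opposite to e. *)
Lemma good_at_PQ sd : is_PQ sd e -> good_at z3.
Proof.
move=> Pe; have Se := chart1_e c1; have ch1 := chart1_chart c1.
have [[dg2 hg2] gen2] := pi2; have [[dg3 hg3] gen3] := pi3.
have De : is_D e = false := is_PQ_D Pe.
have s1e : sub1 e = 'X_e by rewrite /monoidal eqxx andbF.
have s1 k : is_S1 k -> k != e -> sub1 k = 'X_k * 'X_e by rewrite /monoidal => -> ->.
have hgam : exists2 t : 'I_15 -> K, (forall k, is_S2 e k -> t k = 0) &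
    (1 : {mpoly K[15]}).@[t] != 0.
  by exists (fun=> 0) => //; rewrite meval1 oner_neq0.
have [e2 [ds2 [s2 [Q2 [omega2 [rho2 [t2 [dd2 [Se2 _ QP2 [Qe2 _] ch2]]]]]]]]] :=
  chart_blowup_center hg2 ch1 V2_z2 (gen2 _ V1_z1) (fun k => C2_vanish_num pi1 c1 Pe (k := k))
    hgam (fun t tS den0 _ => C2_param pi1 c1 Pe tS den0).
have tau1D r k : is_D k -> vanishes_on (tilde g1 r) (num1 i0 c e Q k).
  move=> Dk; have ke : k != e by apply: contraTneq Dk => ->; rewrite De.
  rewrite /num1 is_D_S1 // ke; apply/vanishesMl/tilde_vanish_Q; rewrite ?Dk //.
  exact: is_D_S1.
have Q2D r k : is_D k -> vanishes_on (hat r) (Q2 k).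
  move=> Dk; have S2k : is_S2 e k by rewrite /is_S2 Dk.
  have [[d hd] st] := QP2 k S2k; exact: hat_vanish_st hd st (tau1D r k Dk).
have [De2|nDe2] := boolP (is_D e2).
  have [[d hd] _] := QP2 e2 Se2.
  have vC3 : vanishes_on (C3 g1 g2) (Q2 e2) by apply: C3_vanish => r; apply: Q2D.
  have [l3 gl3] := generates_at_neq0 (gen3 _ V2_z2) V2_z2 hd vC3 Qe2.
  have [c3 ch3] := chart_blowup_away hg3 ch2 V3z gl3.
  have ee2 : e != e2 by apply: contraTneq De2 => <-; rewrite De.
  pose y k : {mpoly K[15]} := if (k == e) || (k == e2) then 1 else 'X_k.
  pose th : {mpoly K[15]} := 'X_e * 'X_e2.
  have sub2e : monoidal K (is_S2 e) e2 e = th by rewrite /monoidal /is_S2 eqxx orbT ee2.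
  have hPQ r k : is_PQ r k -> pullback (monoidal K (is_S2 e) e2) (sub1 k) = th * y k.
    move=> Pk; rewrite /y; have [->|ke] /= := eqVneq k e.
      by rewrite s1e pullbackXU sub2e mulr1.
    rewrite s1 ?(is_PQ_S1 Pk) // pullbackM !pullbackXU sub2e /monoidal /is_S2 (is_PQ_D Pk) (negbTE ke) /=.
    have -> : (k == e2) = false by apply: contraTF De2 => /eqP <-; rewrite (is_PQ_D Pk).
    by rewrite mulrC.
  (* The D-coordinates carry X_e X_e2^2 and both the p and the q carry X_e X_e2; the product of the
     latter two factors is the former times X_e. *)
  apply: (good_at_chart (T := fun k => pullback (monoidal K (is_S2 e) e2) (sub1 k)) (y := y)
    (th := 'X_e2 * th) (thp := th) (thq := th) (h := 'X_e) ch3 (chart1_z0 c1)) => //.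
  - move=> t; rewrite !lsubmx_param_ext; apply: eq_param => k.
    rewrite paramE meval_pullback; apply: meval_eq => j; rewrite !paramE.
    by apply: meval_eq => j'; rewrite param_id.
  - move=> k Dk; have ke : (k == e) = false by apply: contraTF Dk => /eqP ->; rewrite De.
    rewrite s1 ?is_D_S1 ?ke // pullbackM !pullbackXU sub2e.
    rewrite /monoidal /y /is_S2 Dk ke /=.
    by case: eqP => [->|_] /=; rewrite ?mulr1 //; ring.
  - exact: hPQ.
  - exact: hPQ.
  - by rewrite /th; ring.
  by left; exists e2 => //; rewrite /y eqxx orbT meval1 oner_neq0.
have e2E : e2 = e by move: Se2; rewrite /is_S2 (negbTE nDe2) => /eqP.
move: Qe2 ch2; rewrite {}e2E {Se2 nDe2} => Qe2 ch2.
have [dQ hdQ] := hQ Se.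
(* [Q e] vanishes on the proper transform belonging to the other ruling. Multiplied by it, the
   equations of the component present in this chart vanish on the whole centre. *)
have ch2' := chart_rescale ch2 (lift_homog m2 hdQ)
  (_ : (lift_form m2 (Q e)).@[z2 0] != 0).
have {}ch2' := ch2' (eq_ind_r (fun a => a != 0) (chart1_Qe c1) (meval_lift _ _)).
pose S3 k := is_D k || is_PQ (~~ sd) k.
have eS3 : S3 e = false by rewrite /S3 De (is_PQ_neg Pe).
have tau2C k : S3 k -> vanishes_on (C3 g1 g2) (lift_form m2 (Q e) *
    (if is_S2 e k && (k != e) then lift_form m2 (den1 i0 c e Q) * Q2 k
     else lift_form m2 (num1 i0 c e Q k) * Q2 e)).
  move=> S3k; have ke : k != e by apply: contraTneq S3k => ->; rewrite eS3.
  apply: C3_vanish => r; rewrite /is_S2 (negbTE ke) orbF andbT.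
  case: ifP => [Dk|nDk]; first by apply/vanishesMl/vanishesMl/Q2D.
  have Pk : is_PQ (~~ sd) k by move: S3k; rewrite /S3 nDk.
  have [rs|rs] := eqVneq r sd.
    apply/vanishesMl/vanishesMr.
    have [d hd] := hQ (is_PQ_S1 Pk).
    apply: hat_vanish_lift (chart_num_homog ch1 k) _.
    rewrite /num1 (is_PQ_S1 Pk) ke; apply/vanishesMl/tilde_vanish_Q; first exact: is_PQ_S1 Pk.
    by rewrite rs Pk orbT.
  apply/vanishesMr/(hat_vanish_lift hdQ)/tilde_vanish_Q => //.
  have -> : ~~ r = sd by case: r rs; case: sd {Pe eS3 S3 S3k Pk}.
  by rewrite Pe orbT.
(* For t_e nonzero the point lies over a ruling locus outside C1, so it belongs to the proper
   transforms by definition and not only as a limit. This is why X_e is taken as [gam]. *)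
have V2C3 t : (forall k, S3 k -> t k = 0) ->
    (lift_form m2 (Q e) * (lift_form m2 (den1 i0 c e Q) * Q2 e)).@[
      param (ext_param psi1 (monoidal K (is_S2 e) e) omega2) t 0] != 0 ->
    ('X_e : {mpoly K[15]}).@[t] != 0 ->
    C3 g1 g2 (param (ext_param psi1 (monoidal K (is_S2 e) e) omega2) t).
  move=> tS den0; rewrite mevalXU => te; apply/C3_hat; exists sd.
  have V2t := chart_mem ch2' den0; have [pt2 _] := V2t.
  have V1t := blowup_lsubmx (V1_closed g1) (V2t : blowup bb1 W1 g2 _); have [pt1 _] := V1t.
  split=> // d p hp pv; apply: pv.
  set zt := param _ t in V2t V1t pt2 pt1 *.
  pose u := param sub1 (param (monoidal K (is_S2 e) e) t 0) 0.
  have uE k : u k = if is_S1 k && (k != e)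
      then (if is_S2 e k && (k != e) then t k * t e else t k) * t e else
      (if is_S2 e k && (k != e) then t k * t e else t k).
    by rewrite /u !monoidal_eval eqxx andbF.
  have xE : lsubmx (lsubmx zt) = param phi u by rewrite /zt !lsubmx_param_ext.
  have nC1 : ~ C1 (lsubmx (lsubmx zt)).
    by rewrite xE; apply: (param_notin_C1 c1 Se); rewrite uE eqxx !andbF.
  split=> //; last by case=> _ Cx _; apply: nC1 Cx.
  split=> // d' p' hp' pv'; apply: pv'; split=> //.
  rewrite xE; apply: base_param_ruling (chart1_z0 c1) _ => k S3k; rewrite uE tS //.
  by rewrite mul0r if_same mul0r if_same.
have hgam3 : exists2 t : 'I_15 -> K, (forall k, S3 k -> t k = 0) &
    ('X_e : {mpoly K[15]}).@[t] != 0.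
  exists (fun k => (k == e)%:R); last by rewrite mevalXU eqxx oner_neq0.
  by move=> k S3k; case: eqP => // ke; move: S3k; rewrite ke eS3.
have [e3 [ds3 [s3 [Q3 [omega3 [rho3 [t3 [dd3 [Se3 _ _ _ ch3]]]]]]]]] :=
  chart_blowup_center hg3 ch2' V3z (gen3 _ V2_z2) tau2C hgam3 V2C3.
have ee3 : (e == e3) = false by apply: contraTF Se3 => /eqP <-; rewrite eS3.
pose sub3 := monoidal K S3 e3.
(* The coordinates on P^15 in terms of those on V_3. The factors are X_e3 X_e^2 for D, which takes
   part in all three blow-ups, X_e on the side of e, and X_e3 X_e on the opposite side; hence h =
   1. *)
pose T k := pullback sub3 (pullback (monoidal K (is_S2 e) e) (sub1 k)).
pose y k : {mpoly K[15]} := if (k == e) || (k == e3) then 1 else 'X_k.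
have sub2e : monoidal K (is_S2 e) e e = 'X_e by rewrite /monoidal eqxx andbF.
have sub3e : sub3 e = 'X_e by rewrite /sub3 /monoidal eS3.
have sub3S k : S3 k -> sub3 k = 'X_e3 * y k.
  move=> S3k; rewrite /sub3 /monoidal S3k /y.
  have -> : (k == e) = false by apply: contraTF S3k => /eqP ->; rewrite eS3.
  by case: eqP => [->|_] /=; rewrite ?mulr1 // mulrC.
have TD k : is_D k -> T k = 'X_e3 * 'X_e * 'X_e * y k.
  move=> Dk; have ke : (k == e) = false by apply: contraTF Dk => /eqP ->; rewrite De.
  rewrite /T s1 ?is_D_S1 ?ke // pullbackM !pullbackXU sub2e.
  rewrite /monoidal /is_S2 Dk ke /= !pullbackM !pullbackXU sub3e sub3S /S3 ?Dk //; ring.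
have Tsd k : is_PQ sd k -> T k = 'X_e * y k.
  move=> Pk; have nS3 : S3 k = false by rewrite /S3 (is_PQ_D Pk) (is_PQ_neg Pk).
  have ke3 : (k == e3) = false by apply: contraTF Se3 => /eqP <-; rewrite nS3.
  rewrite /T /y ke3 orbF; have [->|ke] := eqVneq k e.
    by rewrite s1e pullbackXU sub2e pullbackXU sub3e mulr1.
  rewrite s1 ?(is_PQ_S1 Pk) // pullbackM !pullbackXU sub2e pullbackM pullbackXU sub3e.
  rewrite /monoidal /is_S2 (is_PQ_D Pk) (negbTE ke) /= pullbackXU /sub3 /monoidal nS3 /=.
  by rewrite mulrC.
have Tnsd k : is_PQ (~~ sd) k -> T k = 'X_e3 * 'X_e * y k.
  move=> Pk; have S3k : S3 k by rewrite /S3 Pk orbT.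
  have ke : (k == e) = false by apply: contraTF S3k => /eqP ->; rewrite eS3.
  rewrite /T s1 ?(is_PQ_S1 Pk) ?ke // pullbackM !pullbackXU sub2e pullbackM pullbackXU.
  by rewrite sub3e /monoidal /is_S2 (is_PQ_D Pk) ke /= pullbackXU sub3S //; ring.
have psiE t : lsubmx (lsubmx (lsubmx (param (ext_param (ext_param psi1
    (monoidal K (is_S2 e) e) omega2) sub3 omega3) t))) =
    param phi (fun k => (T k).@[t]).
  rewrite !lsubmx_param_ext; apply: eq_param => k.
  by rewrite paramE /T !meval_pullback.
have ye : (y e).@[t3] != 0 by rewrite /y eqxx meval1 oner_neq0.
have ye3 : (y e3).@[t3] != 0 by rewrite /y eqxx orbT meval1 oner_neq0.
(* The reduced coordinates of index e and e3 are both 1: either e3 is in D, or one of e and e3 is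
   among the p and the other among the q. *)
have nz : (exists2 k, is_D k & (y k).@[t3] != 0) \/ [/\ (1 : {mpoly K[15]}).@[t3] != 0,
    exists2 k, is_PQ false k & (y k).@[t3] != 0 &
    exists2 k, is_PQ true k & (y k).@[t3] != 0].
  have [De3|nD] := boolP (is_D e3); [by left; exists e3 | right].
  have Pe3 : is_PQ (~~ sd) e3 by move: Se3; rewrite /S3 (negbTE nD).
  rewrite meval1 oner_neq0; case: (sd) Pe Pe3 => Pe Pe3; split=> //;
    by [exists e | exists e3].
case: (sd) Tsd Tnsd => Tsd Tnsd.
  apply: (good_at_chart ch3 (chart1_z0 c1) psiE TD Tnsd Tsd _ nz).
  by ring.
apply: (good_at_chart ch3 (chart1_z0 c1) psiE TD Tsd Tnsd _ nz).
by ring.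
Qed.

End Point.

Lemma V3_good z : W3 z -> good_at z.
Proof.
move=> V3z; have [i0 [c [z0 [e [s [Q [omega [rho [t1 [dd1 c1]]]]]]]]]] := V1_chart pi1 (V1_z1 V3z).
by have [De|[sd Pe]] := is_S1P (chart1_e c1); [exact: (good_at_D V3z c1 De) | exact: (good_at_PQ V3z c1 Pe)].
Qed.

End Tower.

Theorem theorem4p10 (K : closedFieldType) (charK : [pchar K] =i pred0)
    (m1 : nat) (g1 : 'I_m1.+1 -> {mpoly K[4 * 4]})
    (pi1 : presents_center b15 (@P15 K) (@C1 K) g1)
    (m2 : nat) (g2 : 'I_m2.+1 -> {mpoly K[4 * 4 + m1.+1]})
    (pi2 : presents_center (@b1 m1) (V1 g1) (C2 g1) g2)
    (m3 : nat) (g3 : 'I_m3.+1 -> {mpoly K[4 * 4 + m1.+1 + m2.+1]})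
    (pi3 : presents_center (@b2 m1 m2) (V2 g1 g2) (C3 g1 g2) g3) :
  is_regular (@b3 m1 m2 m3) (V3 g1 g2 g3) (@alpha3 K m1 m2 m3) /\
  smooth (@b3 m1 m2 m3) (V3 g1 g2 g3).
Proof.
by split=> z V3z; have [reg sm] := V3_good pi1 pi2 pi3 V3z.
Qed.
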